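(* Let $G$ be a Lie group acting on $T^*TG\simeq(G\circledS\mathfrak g_1)\circledS(\mathfrak g_2^*\times\mathfrak g_3^* )$ by $((h,\xi,\mu,\nu);g)\mapsto(hg,\xi,\mu,\nu)$. The Poisson reduced manifold $T^*TG/G\simeq\mathfrak g_1\circledS(\mathfrak g_2^*\times\mathfrak g_3^* )$, with elements $(\xi,\mu,\nu)$, carries the Poisson bracket $$\{H,K\}(\xi,\mu,\nu)=\Big\langle\frac{\delta H}{\delta\xi},\frac{\delta K}{\delta\nu}\Big\rangle-\Big\langle\frac{\delta K}{\delta\xi},\frac{\delta H}{\delta\nu}\Big\rangle+\Big\langle\mu,\Big[\frac{\delta H}{\delta\mu},\frac{\delta K}{\delta\mu}\Big]\Big\rangle-\Big\langle\mathrm{ad}^*_\xi\frac{\delta K}{\delta\xi},\frac{\delta H}{\delta\mu}\Big\rangle+\Big\langle\mathrm{ad}^*_\xi\frac{\delta H}{\delta\xi},\frac{\delta K}{\delta\mu}\Big\rangle+\Big\langle\nu,\Big[\frac{\delta H}{\delta\mu},\frac{\delta K}{\delta\nu}\Big]-\Big[\frac{\delta K}{\delta\mu},\frac{\delta H}{\delta\nu}\Big]\Big\rangle$$ for two right invariant functionals $H=H(\xi,\mu,\nu)$ and $K=K(\xi,\mu,\nu)$ on $T^*TG$.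
   Context: $G$ is a (finite-dimensional) Lie group with identity $e$, $\mathfrak g=T_eG$, dual $\mathfrak g^*$; $\mathfrak g_i,\mathfrak g_i^*$ denote copies of $\mathfrak g,\mathfrak g^*$. $R_g$ is right multiplication, $T_e^*R_g:T_g^*G\to\mathfrak g^*$ the dual of $T_eR_g$. $\mathrm{Ad}_g=T_e(h\mapsto ghg^{-1})$, $\mathrm{ad}_\xi\eta=[\xi,\eta]=\frac{d}{dt}|_{t=0}\mathrm{Ad}_{\exp t\xi}\eta$, and $\mathrm{ad}^*_\xi:\mathfrak g^*\to\mathfrak g^*$ is defined by $\langle\mathrm{ad}^*_\xi\mu,\eta\rangle=-\langle\mu,[\xi,\eta]\rangle$. $TG$ is identified with $G\circledS\mathfrak g$ by $V_g\mapsto(g,T_gR_{g^{-1}}V_g)$, with group law $(g,\xi)(h,\eta)=(gh,\xi+\mathrm{Ad}_g\eta)$. $T^*TG=T^*(G\circledS\mathfrak g)$ is identified with $G\times\mathfrak g_1\times\mathfrak g_2^*\times\mathfrak g_3^*$ by sending a covector $(\alpha_g,\alpha_\xi)$ at $(g,\xi)$ to $(g,\xi,\mu,\nu)=(g,\xi,T_e^*R_g\alpha_g+\mathrm{ad}^*_\xi\alpha_\xi,\alpha_\xi)$; $\Omega_{T^*TG}$ is the canonical symplectic form $d\theta$ ($\theta$ the Liouville form) transported by this map. Hamiltonian vector fields are defined by $i_{X_H}\Omega=-dH$ and the Poisson bracket on $T^*TG$ is $\{H,K\}=dH(X_K)$. The Poisson reduced bracket is the restriction of this bracket to functions invariant under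 the group action (independent of $g$). $\frac{\delta H}{\delta\xi}\in\mathfrak g^*$, $\frac{\delta H}{\delta\mu},\frac{\delta H}{\delta\nu}\in\mathfrak g$ are partial derivatives. *)

(* Defs.v *)
From HB Require Import structures.
From mathcomp Require Import all_boot all_order all_algebra.
From mathcomp Require Import all_classical all_reals all_analysis.
Set Implicit Arguments.
Unset Strict Implicit.
Unset Printing Implicit Defensive.
Import Order.TTheory GRing.Theory Num.Theory.
Import numFieldNormedType.Exports.
Local Open Scope classical_set_scope.
Local Open Scope ring_scope.

(* C^k and C^oo maps on an open set A of a normed space; all the spaces used
   below are finite dimensional, so that continuity of x |-> 'd f x amounts to
   continuity of x |-> 'd f x v for every v. *)
Fixpoint Ck (R : realType) (V W : normedModType R) (k : nat) (A : set V)
    (f : V -> W) : Prop :=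
  match k with
  | 0 => forall x, A x -> {for x, continuous f}
  | k'.+1 => (forall x, A x -> differentiable f x) /\
             (forall v, Ck k' A (fun x => 'd f x v))
  end.

Definition smooth_on (R : realType) (V W : normedModType R) (A : set V)
    (f : V -> W) : Prop := forall k, Ck k A f.

(* A chart M -> V is given by total functions; only the values of [to_model]
   on [source] and those of [of_model] on the image of [source] matter. *)
Record chart (R : realType) (M : Type) (V : normedModType R) := Chart {
  source : set M;
  to_model :> M -> V;
  of_model : V -> M }.

(* A set with an atlas modelled on V, indexed so that [chart_at x] is a chart
   around x (any atlas can be indexed in this way). The tangent space at x is V, a vector being represented by its
   components in the chart [chart_at x]. *)
Record charted (R : realType) (V : normedModType R) := Charted {
  points :> Type;
  chart_at : points -> chart points V }.

(* The topology of the manifold is the one induced by the atlas. Neither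
   separation nor countability is required: a Lie group is automatically
   Hausdorff, since it is locally Euclidean and its operations are
   continuous. *)
Definition smooth_manifold (R : realType) (V : normedModType R)
    (M : charted V) : Prop :=
  [/\ forall x : M, source (chart_at x) x,
      forall x y : M, source (chart_at x) y ->
        of_model (chart_at x) (chart_at x y) = y &
      forall x y : M,
        let U := chart_at x @` (source (chart_at x) `&` source (chart_at y)) in
        open U /\ smooth_on U (chart_at y \o of_model (chart_at x))].

Section Maps.
Variables (R : realType) (V W : normedModType R).
Variables (M : charted V) (N : charted W) (f : M -> N).

Definition local_rep (x : M) : V -> W :=
  chart_at (f x) \o f \o of_model (chart_at x).

Definition smooth_map : Prop := forall x : M, exists U : set V,
  [/\ open U, U (chart_at x x),
      U `<=` chart_at x @` source (chart_at x),
      forall y, U y -> source (chart_at (f x)) (f (of_model (chart_at x) y)) &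
      smooth_on U (local_rep x)].

(* T_x f *)
Definition tangent (x : M) (v : V) : W := 'd (local_rep x) (chart_at x x) v.

End Maps.

Definition vec (R : realType) (V : normedModType R) : charted V :=
  Charted (fun _ : V => Chart setT id id).

Definition prodM (R : realType) (V W : normedModType R)
    (M : charted V) (N : charted W) : charted (V * W)%type :=
  @Charted R (V * W)%type (M * N)%type (fun x =>
    Chart (source (chart_at x.1) `*` source (chart_at x.2))
          (fun y => (chart_at x.1 y.1, chart_at x.2 y.2))
          (fun z => (of_model (chart_at x.1) z.1, of_model (chart_at x.2) z.2))).

Section Forms.
Variables (R : realType) (V : normedModType R) (M : charted V).

(* derivative at x of the change of charts from [chart_at x] to [chart_at y] *)
Definition coord_change (x y z : M) : V -> V :=
  'd (chart_at y \o of_model (chart_at x)) (chart_at x z).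

(* Exterior derivative of a 1-form: with theta written in the chart around x,
   (d theta)(u, v) = D_u (theta v) - D_v (theta u) for constant u and v. *)
Definition ext_deriv (theta : M -> V -> R) (x : M) (u v : V) : R :=
  let th (w y : V) : R :=
    let z := of_model (chart_at x) y in theta z (coord_change x z z w) in
  'D_u (th v) (chart_at x x) - 'D_v (th u) (chart_at x x).

Definition smooth_fun (H : M -> R^o) : Prop :=
  @smooth_map R V R^o M (vec R^o) H.

Definition dfun (H : M -> R^o) (x : M) (v : V) : R :=
  @tangent R V R^o M (vec R^o) H x v.

(* Hamiltonian vector field: i_X omega = - dH *)
Definition ham (omega : M -> V -> V -> R) (H : M -> R^o) (x : M) : V :=
  xget 0 [set X | forall v, omega x X v = - dfun H x v].

Definition poisson (omega : M -> V -> V -> R) (H K : M -> R^o) (x : M) : R :=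
  dfun H x (ham omega K x).

End Forms.

(* The dual of 'rV_n is 'cV_n *)
Definition pairing (R : realType) (n : nat) (a : 'cV[R]_n) (v : 'rV[R]_n) : R :=
  (v *m a) 0 0.

(* <dual_map f a, v> = <a, f v> for f linear *)
Definition dual_map (R : realType) (m n : nat) (f : 'rV[R]_m -> 'rV[R]_n)
    (a : 'cV[R]_n) : 'cV[R]_m := lin1_mx f *m a.

(* T^*M: a covector (x, a) at x is represented by its components a in the chart
   [chart_at x]; the charts of T^*M are those induced by the charts of M. *)
Definition cotangent (R : realType) (n : nat) (M : charted 'rV[R]_n) :
    charted ('rV[R]_n * 'cV[R]_n)%type :=
  @Charted R ('rV[R]_n * 'cV[R]_n)%type (M * 'cV[R]_n)%type (fun x0 =>
    let phi := chart_at x0.1 in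
    Chart [set xa | source phi xa.1]
          (fun xa => (phi xa.1, dual_map (coord_change x0.1 xa.1 xa.1) xa.2))
          (fun yb => let x := of_model phi yb.1 in
                     (x, dual_map (coord_change x x0.1 x) yb.2))).

Record lieGroup (R : realType) (n : nat) := LieGroup {
  lie_group :> groupType;
  lie_chart : lie_group -> chart lie_group 'rV[R]_n;
  lie_manifold : smooth_manifold (Charted lie_chart);
  lie_mul_smooth :
    @smooth_map R _ _ (prodM (Charted lie_chart) (Charted lie_chart))
      (Charted lie_chart) (fun x => x.1 * x.2)%g;
  lie_inv_smooth :
    @smooth_map R _ _ (Charted lie_chart) (Charted lie_chart)
      (fun x => x^-1)%g }.

Section Lie.
Variables (R : realType) (n : nat) (G : lieGroup R n).

(* the Lie algebra T_e G and its dual *)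
Let g := 'rV[R]_n.
Let gd := 'cV[R]_n.

Definition mfd : charted g := Charted (@lie_chart R n G).

(* T_e R_x and Ad_x *)
Definition TR (x : G) : g -> g := @tangent R _ _ mfd mfd (fun h => h * x)%g 1%g.

Definition Ad (x : G) : g -> g :=
  @tangent R _ _ mfd mfd (fun h => x * h * x^-1)%g 1%g.

Definition one_param (xi : g) (c : R^o -> G) : Prop :=
  [/\ @smooth_map R _ _ (vec R^o) mfd c,
      forall s t, c (s + t) = (c s * c t)%g &
      @tangent R _ _ (vec R^o) mfd c 0 1 = xi].

Definition lie_exp (xi : g) : G :=
  xget 1%g [set x | exists2 c, one_param xi c & x = c 1].

Definition lie_bracket (xi eta : g) : g :=
  derive1 (fun t : R => Ad (lie_exp (t *: xi)) eta) 0.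

(* <ad^*_xi mu, eta> = - <mu, [xi, eta]> *)
Definition ads (xi : g) (mu : gd) : gd := - dual_map (lie_bracket xi) mu.

Definition TG : charted (g * g)%type := prodM mfd (vec g).

(* T^*TG = T^*(G x g) = T^*G x T^*g, with elements ((g, alpha_g), (xi, alpha_xi)) *)
Definition TsTG : charted ((g * gd) * (g * gd))%type :=
  prodM (cotangent mfd) (cotangent (vec g)).

Definition TsTG_proj (a : TsTG) : TG := (a.1.1, a.2.1).

Definition liouville (a : TsTG) (w : (g * gd) * (g * gd)) : R :=
  let v := tangent TsTG_proj a w in pairing a.1.2 v.1 + pairing a.2.2 v.2.

Definition canonical_form : TsTG -> (g * gd) * (g * gd) -> (g * gd) * (g * gd) -> R :=
  ext_deriv liouville.

(* The trivialized T^*TG, with elements (g, (xi, (mu, nu))) *)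
Definition trivTsTG : charted (g * (g * (gd * gd)))%type :=
  prodM mfd (vec (g * (gd * gd))%type).

Definition triv (a : TsTG) : trivTsTG :=
  let: ((x, ax), (xi, axi)) := a in
  (x, (xi, (dual_map (TR x) ax + ads xi axi, axi))).

Definition triv_inv (p : trivTsTG) : TsTG :=
  xget (((1%g, 0), (0, 0)) : (G * gd) * (g * gd)) [set a | triv a = p].

Definition Omega (p : trivTsTG) (u v : g * (g * (gd * gd))) : R :=
  canonical_form (triv_inv p) (tangent triv_inv p u) (tangent triv_inv p v).

Definition bracketTsTG (H K : trivTsTG -> R^o) : trivTsTG -> R :=
  poisson Omega H K.

Definition act (p : trivTsTG) (x : G) : trivTsTG := ((p.1 * x)%g, p.2).

(* T^*TG / G, with elements (xi, (mu, nu)), and the projection onto it *)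
Definition reduced : charted (g * (gd * gd))%type := vec (g * (gd * gd))%type.

Definition red (p : trivTsTG) : reduced := p.2.

(* delta H / delta xi, delta H / delta mu and delta H / delta nu *)
Definition dxi (H : reduced -> R^o) (r : reduced) : gd :=
  \col_i 'D_(delta_mx 0 i) (fun x : g => H (x, r.2)) r.1.

Definition dmu (H : reduced -> R^o) (r : reduced) : g :=
  \row_i 'D_(delta_mx i 0) (fun m : gd => H (r.1, (m, r.2.2))) r.2.1.

Definition dnu (H : reduced -> R^o) (r : reduced) : g :=
  \row_i 'D_(delta_mx i 0) (fun m : gd => H (r.1, (r.2.1, m))) r.2.2.

End Lie.

(* Main.v *)
(* The Liouville form has the canonical coordinate expression in the induced
   charts of T^*TG, so that in the right trivialization the symplectic form
   involves only the derivative of v |-> T R_{h^-1} v, whose antisymmetrization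
   is given by the Maurer-Cartan equation. With m = mu - ad^*_xi nu, dots for
   the components of tangent vectors and U, V for the right-trivialized base
   components of u, v, this gives
     Omega(u, v) = <m, [U, V]> + <m'_u, V> - <m'_v, U>
                   + <nu'_u, xi'_v> - <nu'_v, xi'_u>.
   For right invariant H the equation i_X Omega = - dH is then solved
   explicitly, and the bracket follows, the terms in nu being simplified by the
   Jacobi identity.

   The bracket is defined through one-parameter subgroups, so these have to be
   constructed: a right invariant vector field has a local flow by Picard
   iteration, which is a local homomorphism and extends to R by
   c(t) = c(t / N)^N. In the chart around the identity the bracket is then
   the antisymmetrized mixed second derivative of the multiplication, by the
   symmetry of second derivatives. *)
Require Import Defs.
From HB Require Import structures.
From mathcomp Require Import all_boot all_order all_algebra.
From mathcomp Require Import all_classical all_reals all_analysis.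
From mathcomp Require Import ring lra.
Import Order.TTheory GRing.Theory Num.Theory.
Import numFieldNormedType.Exports.
Local Open Scope classical_set_scope.
Local Open Scope ring_scope.

Set Implicit Arguments.
Unset Strict Implicit.
Unset Printing Implicit Defensive.

(** * Differential calculus in finite dimension *)

(** [tangent] and [ham] are total: a missing derivative and an unsolvable equation both give default
    values. Every formula for a tangent map therefore rests on a proof of differentiability, and
    [is_diff], which carries the differential and its existence together, is the working notion.
    Moreover [tangent] takes its target chart at the image point, so the chart changes along a
    curve; [rep], [D] and [smooth_at] keep both charts fixed, and the original notions are recovered
    from them by conversion.

    Smoothness is expressed by derivatives in constant directions. A derivative in a varying
    direction is expanded over a finite family ([findim]); this yields composition and the product
    rule for families of linear maps without derivatives valued in operator spaces.

    [ham] selects some solution of [i_X Omega = - dK]. If [Y] is an explicit solution for [H],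
    antisymmetry gives dH(X) = - Omega(Y, X) = Omega(X, Y) = - dK(Y) for every such X, so the
    explicit fields determine the bracket whatever solution is selected. *)

Section Differentials.
Variable R : realType.
Implicit Types U V W : normedModType R.

(** This transfers a differential computed from a formula that holds only near a point, typically on
    a chart domain, to the map itself. *)
Lemma is_diff_near V W (f g : V -> W) x df :
  (\forall y \near x, f y = g y) -> is_diff x f df -> is_diff x g df.
Proof.
move=> fg [dfx <-].
have /diff_locallyP[dc fE] := dfx.
have gE : g \o shift x = cst (g x) + 'd f x +o_ 0 id.
  apply/eqaddoP => e e0.
  move/eqaddoP: fE => /(_ e e0) fE.
  have fgs : \forall h \near 0, f (h + x) = g (h + x).
    by move: fg; rewrite (near_shift 0) subr0.
  near=> h.
  have E : f (h + x) = g (h + x) by near: h.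
  have E0 : f x = g x by exact: nbhs_singleton fg.
  rewrite /= !fctE /= -E -E0.
  by near: h; apply: fE.
have dg := diff_unique dc gE.
split; last exact: dg.
by apply/diff_locallyP; rewrite dg.
Unshelve. all: by end_near. Qed.

Lemma is_diff_app V W (f : V -> W) x df v : is_diff x f df -> 'd f x v = df v.
Proof. by move=> [_ ->]. Qed.

Lemma is_diff_lin V W (f : V -> W) x : linear f -> continuous f -> is_diff x f f.
Proof.
move=> fl fc; pose M := GRing.isLinear.Build _ _ _ _ _ fl.
pose L : {linear V -> W} := HB.pack f M.
by split; [exact: (@linear_differentiable _ _ _ L)|exact: (@diff_lin _ _ _ L)].
Qed.

Lemma is_diffP V W (f : V -> W) x : differentiable f x -> is_diff x f ('d f x).
Proof. by move=> h; split. Qed.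

Lemma is_diff_compf U V W (f df : U -> V) (g dg : V -> W) x y :
  is_diff x f df -> f x = y -> is_diff y g dg ->
  is_diff x (fun z => g (f z)) (fun u => dg (df u)).
Proof. by move=> dfx <- dgy; exact: is_diff_comp. Qed.

Lemma is_diff_ext V W (f g : V -> W) x df dg :
  is_diff x f df -> f =1 g -> df =1 dg -> is_diff x g dg.
Proof. by move=> h /funext <- /funext <-. Qed.

Lemma is_diff_fst U V (x : U * V) : is_diff x fst fst.
Proof. by apply: is_diff_lin => // z; exact: cvg_fst. Qed.

Lemma is_diff_snd U V (x : U * V) : is_diff x snd snd.
Proof. by apply: is_diff_lin => // z; exact: cvg_snd. Qed.

Lemma is_diff_scale V W (a da : V -> R^o) (f df : V -> W) x :
  is_diff x a da -> is_diff x f df ->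
  is_diff x (fun z => (a z : R) *: f z)
    (fun u => (a x : R) *: df u + (da u : R) *: f x).
Proof.
move=> ha hf.
have lin : bilinear_for (GRing.Scale.Law.clone _ _ *:%R _)
   (GRing.Scale.Law.clone _ _ *:%R _) (fun (c : R^o) (w : W) => (c : R) *: w).
  split=> [w|c] k u v /=; first by rewrite scalerDl scalerA.
  by rewrite scalerDr !scalerA mulrC.
pose M := bilinear_isBilinear.Build R R^o W W _ _
  (fun (c : R^o) (w : W) => (c : R) *: w) lin.
pose L : {bilinear R^o -> W -> W} := HB.pack (fun (c : R^o) (w : W) => (c : R) *: w) M.
have Lc : continuous (fun p : R^o * W => L p.1 p.2).
  by move=> p; exact: scale_continuous.
have dL : is_diff (a x, f x) (fun p : R^o * W => L p.1 p.2)
   (fun q => L (a x) q.2 + L q.1 (f x)).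
  by split; [exact: differentiable_bilin|rewrite diff_bilin].
exact: (is_diff_compf (is_diff_pair ha hf) erefl dL).
Qed.

Lemma is_diff_sum V W n (f df : 'I_n -> V -> W) x :
  (forall i, is_diff x (f i) (df i)) ->
  is_diff x (fun z => \sum_i f i z) (fun u => \sum_i df i u).
Proof.
move=> h.
suff : is_diff x (\sum_i f i) (\sum_i df i).
  by move=> /is_diff_ext; apply=> z; rewrite fct_sumE.
elim/big_ind2 : _ => //; first exact: is_diff_cst.
by move=> ? ? ? ? ? ?; exact: is_diffD.
Qed.

End Differentials.

(** * Calculus of C^k maps on open sets *)

Section Smooth.
Variable R : realType.
Implicit Types U V W : normedModType R.

Lemma Ck_sub k V W (A B : set V) (f : V -> W) :
  B `<=` A -> Ck k A f -> Ck k B f.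
Proof.
elim: k f => [|k IH] f BA /=; first by move=> h x /BA /h.
by move=> [h1 h2]; split=> [x /BA /h1 //|v]; exact: IH.
Qed.

Lemma Ck_eq k V W (A : set V) (f g : V -> W) :
  open A -> (forall x, A x -> f x = g x) -> Ck k A f -> Ck k A g.
Proof.
move=> oA; elim: k f g => [|k IH] f g fg /=.
  move=> h x Ax; have := h x Ax; rewrite /prop_for /continuous_at -fg //.
  apply: cvg_trans; apply: near_eq_cvg.
  near=> y; apply: fg; near: y; exact: open_nbhs_nbhs.
have nearfg x : A x -> \forall y \near x, f y = g y.
  by move=> Ax; near=> y; apply: fg; near: y; exact: open_nbhs_nbhs.
move=> [h1 h2].
have dg x : A x -> is_diff x g ('d f x).
  by move=> Ax; apply: is_diff_near (nearfg _ Ax) _; apply: is_diffP; exact: h1.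
split=> [x /dg []//|v].
by apply: IH (h2 v) => x /dg h; exact: esym (is_diff_app v h).
Unshelve. all: by end_near. Qed.

Lemma CkW k V W (A : set V) (f : V -> W) : Ck k.+1 A f -> Ck k A f.
Proof.
elim: k f => [|k IH] f [h1 h2].
  by move=> x /h1 /differentiable_continuous.
by split=> // v; exact: IH.
Qed.

Lemma Ck_cst k V W (A : set V) (w : W) : Ck k A (fun _ : V => w).
Proof.
elim: k w => [|k IH] w /=; first by move=> x _; exact: cst_continuous.
split=> [x _|v]; first exact: differentiable_cst.
have -> : (fun x => 'd (fun=> w) x v) = fun _ => 0.
  by apply/funext => x; rewrite (_ : 'd _ x = 0 :> (_ -> _)) // diff_cst.
exact: IH.
Qed.

Lemma Ck_lin k V W (A : set V) (f : V -> W) :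
  linear f -> continuous f -> Ck k A f.
Proof.
case: k => [|k] fl fc; first by move=> x _; exact: fc.
have d x := is_diff_lin x fl fc.
split=> [x _|v]; first by have [] := d x.
have -> : (fun x => 'd f x v) = fun _ => f v.
  by apply/funext => x; have [_ ->] := d x.
exact: Ck_cst.
Qed.

Lemma CkD k V W (A : set V) (f g : V -> W) : open A ->
  Ck k A f -> Ck k A g -> Ck k A (fun x => f x + g x).
Proof.
move=> oA; elim: k f g => [|k IH] f g /=.
  by move=> hf hg x Ax; apply: cvgD; [exact: hf|exact: hg].
move=> [f1 f2] [g1 g2].
have d x : A x -> is_diff x (fun x => f x + g x) (fun v => 'd f x v + 'd g x v).
  by move=> Ax; apply: is_diffD; apply: is_diffP; [exact: f1|exact: g1].
split=> [x /d []//|v].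
by apply: (Ck_eq oA _ (IH _ _ (f2 v) (g2 v))) => x /d h; exact: esym (is_diff_app v h).
Qed.

Lemma Ck_scale k V W (A : set V) (a : V -> R^o) (f : V -> W) : open A ->
  Ck k A a -> Ck k A f -> Ck k A (fun x => (a x : R) *: f x).
Proof.
move=> oA; elim: k a f => [|k IH] a f /=.
  by move=> ha hf x Ax; apply: cvgZ; [exact: ha|exact: hf].
move=> ha hf; have [a1 a2] := ha; have [f1 f2] := hf.
have d x : A x -> is_diff x (fun x => (a x : R) *: f x)
    (fun u => (a x : R) *: 'd f x u + ('d a x u : R) *: f x).
  by move=> Ax; apply: is_diff_scale; apply: is_diffP; [exact: a1|exact: f1].
split=> [x /d []//|v].
apply: (Ck_eq (f := fun x => (a x : R) *: 'd f x v + ('d a x v : R) *: f x)) => //.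
  by move=> x /d h; exact: esym (is_diff_app v h).
by apply: CkD => //; apply: IH => //; exact: CkW.
Qed.

Lemma Ck_sum k V W n (A : set V) (f : 'I_n -> V -> W) : open A ->
  (forall i, Ck k A (f i)) -> Ck k A (fun x => \sum_i f i x).
Proof.
move=> oA h.
have -> : (fun x => \sum_i f i x) = \sum_i f i.
  by apply/funext => x; rewrite fct_sumE.
elim/big_ind : _ => //; first exact: Ck_cst.
by move=> ? ? ? ?; exact: CkD.
Qed.

(** Finite dimension is encoded by a family [e] with continuous linear coefficients [l], which is
    the form in which it serves to replace a varying direction by fixed ones. *)
Definition findim V := exists n (e : 'I_n -> V) (l : 'I_n -> V -> R^o),
  (forall i, linear (l i) /\ continuous (l i)) /\ forall x, x = \sum_i (l i x : R) *: e i.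

Lemma Ck_linl k V W W' (A : set V) (f : V -> W) (l : W -> W') :
  open A -> linear l -> continuous l -> Ck k A f -> Ck k A (fun x => l (f x)).
Proof.
move=> oA ll lc; elim: k f => [|k IH] f /=.
  by move=> hf x Ax; apply: cvg_comp (hf _ Ax) _; exact: lc.
move=> [f1 f2].
have d x : A x -> is_diff x (fun x => l (f x)) (fun v => l ('d f x v)).
  move=> Ax; apply: (is_diff_compf (is_diffP (f1 _ Ax)) erefl).
  exact: is_diff_lin.
split=> [x /d []//|v].
by apply: (Ck_eq oA _ (IH _ (f2 v))) => x /d h; exact: esym (is_diff_app v h).
Qed.

Lemma Ck_comp k U V W (A : set U) (B : set V) (f : U -> V) (g : V -> W) :
  findim V -> open A -> open B -> (forall x, A x -> B (f x)) ->
  Ck k A f -> Ck k B g -> Ck k A (fun x => g (f x)).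
Proof.
move=> [n [e [l [lP le]]]] oA oB AB.
elim: k f g AB => [|k IH] f g AB.
  by move=> hf hg x Ax; apply: cvg_comp (hf _ Ax) _; exact: hg (AB _ Ax).
move=> hf hg; have [f1 f2] := hf; have [g1 g2] := hg.
have d x : A x -> is_diff x (fun x => g (f x)) (fun v => 'd g (f x) ('d f x v)).
  move=> Ax; apply: (is_diff_compf (is_diffP (f1 _ Ax)) erefl).
  exact/is_diffP/g1/AB.
split=> [x /d []//|v].
(* The differential of [g] is applied to a vector that varies with [x]. Expanding this vector over
   [e] leaves derivatives of [g] in the fixed directions [e i], to which the induction hypothesis
   applies. *)
apply: (Ck_eq (f := fun x => \sum_i (l i ('d f x v) : R) *: 'd g (f x) (e i))) => //.
  move=> x /d h; rewrite (is_diff_app v h) [in RHS](le ('d f x v)) linear_sum /=.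
  by apply: eq_bigr => i _; rewrite linearZ.
apply: Ck_sum => // i; apply: Ck_scale => //.
  by have [ll lc] := lP i; exact: (Ck_linl oA ll lc (f2 v)).
exact: (IH f (fun y => 'd g y (e i)) AB (CkW hf) (g2 (e i))).
Qed.

Lemma Ck_pair k U V W (A : set U) (f : U -> V) (g : U -> W) : open A ->
  Ck k A f -> Ck k A g -> Ck k A (fun x => (f x, g x)).
Proof.
move=> oA; elim: k f g => [|k IH] f g /=.
  by move=> hf hg x Ax; apply: cvg_pair; [exact: hf|exact: hg].
move=> [f1 f2] [g1 g2].
have d x : A x -> is_diff x (fun x => (f x, g x)) (fun v => ('d f x v, 'd g x v)).
  by move=> Ax; apply: is_diff_pair; apply: is_diffP; [exact: f1|exact: g1].
split=> [x /d []//|v].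
by apply: (Ck_eq oA _ (IH _ _ (f2 v) (g2 v))) => x /d h; exact: esym (is_diff_app v h).
Qed.

Lemma smooth_comp U V W (A : set U) (B : set V) (f : U -> V) (g : V -> W) :
  findim V -> open A -> open B -> (forall x, A x -> B (f x)) ->
  smooth_on A f -> smooth_on B g -> smooth_on A (fun x => g (f x)).
Proof. by move=> fV oA oB AB hf hg k; exact: Ck_comp (hf k) (hg k). Qed.

Lemma smooth_pair U V W (A : set U) (f : U -> V) (g : U -> W) : open A ->
  smooth_on A f -> smooth_on A g -> smooth_on A (fun x => (f x, g x)).
Proof. by move=> oA hf hg k; exact: Ck_pair. Qed.

Lemma smooth_eq V W (A : set V) (f g : V -> W) :
  open A -> (forall x, A x -> f x = g x) -> smooth_on A f -> smooth_on A g.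
Proof. by move=> oA fg hf k; exact: Ck_eq (hf k). Qed.

Lemma smooth_sub V W (A B : set V) (f : V -> W) :
  B `<=` A -> smooth_on A f -> smooth_on B f.
Proof. by move=> BA hf k; exact: Ck_sub (hf k). Qed.

Lemma smooth_cst V W (A : set V) (w : W) : smooth_on A (fun _ : V => w).
Proof. by move=> k; exact: Ck_cst. Qed.

Lemma smooth_lin V W (A : set V) (f : V -> W) :
  linear f -> continuous f -> smooth_on A f.
Proof. by move=> fl fc k; exact: Ck_lin. Qed.

Lemma smooth_id V (A : set V) : smooth_on A (fun x : V => x).
Proof. by apply: smooth_lin => // x. Qed.

Lemma smooth_fst U V (A : set (U * V)) : smooth_on A (fst : U * V -> U).
Proof. by apply: smooth_lin => // z; exact: cvg_fst. Qed.

Lemma smooth_snd U V (A : set (U * V)) : smooth_on A (snd : U * V -> V).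
Proof. by apply: smooth_lin => // z; exact: cvg_snd. Qed.

Lemma smooth_diff V W (A : set V) (f : V -> W) x :
  smooth_on A f -> A x -> differentiable f x.
Proof. by move=> /(_ 1) [h _] /h. Qed.

Lemma smooth_d V W (A : set V) (f : V -> W) v :
  smooth_on A f -> smooth_on A (fun x => 'd f x v).
Proof. by move=> hf k; have [_] := hf k.+1; exact. Qed.

Lemma smooth_cont V W (A : set V) (f : V -> W) x :
  smooth_on A f -> A x -> {for x, continuous f}.
Proof. by move=> /(_ 0) h /h. Qed.

End Smooth.

Section FiniteDim.
Variable R : realType.

Lemma findim_mx m n : findim ('M[R]_(m, n)).
Proof.
pose I := ('I_m * 'I_n)%type.
exists #|{: I}|, (fun i => delta_mx (enum_val i).1 (enum_val i).2).
exists (fun i (N : 'M[R]_(m, n)) => N (enum_val i).1 (enum_val i).2); split.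
  by move=> i; split; [move=> k A B; rewrite !mxE|exact: coord_continuous].
move=> x; rewrite [LHS]matrix_sum_delta pair_big /=.
rewrite (reindex (@enum_val _ (mem {: I}))) //=; last first.
  by apply: onW_bij; exact: enum_val_bij.
Qed.

Lemma findim_prod (V W : normedModType R) :
  findim V -> findim W -> findim (V * W)%type.
Proof.
move=> [n [e [l [lP le]]]] [p [e' [l' [lP' le']]]].
pose L (i : 'I_(n + p)) (x : V * W) : R^o := match fintype.split i with
  | inl j => l j x.1 | inr j => l' j x.2 end.
exists (n + p)%N, (fun i => match fintype.split i with
  | inl j => (e j, 0) | inr j => (0, e' j) end), L; split.
  rewrite /L => i; case: (fintype.split i) => j.
    have [ll lc] := lP j; split=> [k u v|x]; first exact: ll.
    by apply: continuous_comp; [exact: cvg_fst|exact: lc].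
  have [ll lc] := lP' j; split=> [k u v|x]; first exact: ll.
  by apply: continuous_comp; [exact: cvg_snd|exact: lc].
move=> [v w]; rewrite big_split_ord /= /L.
under eq_bigr do rewrite (unsplitK (inl _)) /=.
under [X in _ = _ + X]eq_bigr do rewrite (unsplitK (inr _)) /=.
have sl q (c : 'I_q -> R) (g : 'I_q -> V) :
    \sum_i c i *: (g i, 0 : W) = (\sum_i c i *: g i, 0).
  elim/big_rec2 : _ => // i y1 y2 _ ->.
  by congr (_, _); rewrite /= scaler0 addr0.
have sr q (c : 'I_q -> R) (g : 'I_q -> W) :
    \sum_i c i *: (0 : V, g i) = (0, \sum_i c i *: g i).
  elim/big_rec2 : _ => // i y1 y2 _ ->.
  by congr (_, _); rewrite /= scaler0 addr0.
rewrite sl sr -(le v) -(le' w).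
by congr (_, _); rewrite /= ?addr0 ?add0r.
Qed.

Lemma findim_reg : findim R^o.
Proof.
exists 1, (fun=> 1), (fun=> id); split; first by move=> i; split=> // x.
by move=> x; rewrite big_ord1 /= /GRing.scale /= mulr1.
Qed.

End FiniteDim.
#[global] Hint Resolve findim_mx findim_prod findim_reg : core.

(** * Symmetry of second derivatives *)

Section SecondDerivative.
Variable R : realType.
Implicit Types U V W : normedModType R.

Lemma is_diff_derive V W (f : V -> W) x df v :
  is_diff x f df -> is_derive x v f (df v).
Proof.
by move=> [d <-]; split; [exact: diff_derivable|exact: deriveE].
Qed.

Lemma is_diff_line V (x u : V) (s : R^o) :
  is_diff s (fun t : R^o => x + (t : R) *: u) (fun t => (t : R) *: u).
Proof.
have h1 : is_diff s (fun t : R^o => (t : R) *: u) (fun t => (t : R) *: u).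
  apply: is_diff_lin; last exact: scalel_continuous.
  by move=> k a b; rewrite scalerDl scalerA.
apply: is_diff_ext (is_diffD (is_diff_cst x s) h1) _ _ => //.
by move=> t; rewrite /= add0r.
Qed.

(** The mean value theorem is applied along [u] only. The two values of [F] that it produces are
    both expanded to first order at [x], and the increment along [v] is what survives in their
    difference. *)
Lemma schwarz_increment V (f : V -> R^o) (A : set V) x u v (e : R) :
  open A -> A x -> (forall y, A y -> differentiable f y) ->
  differentiable (fun y => 'd f y u : R^o) x -> 0 < e ->
  exists2 d : R, 0 < d & forall h : R, 0 < h -> h < d ->
    `|f (x + h *: u + h *: v) - f (x + h *: u) - f (x + h *: v) + f x
      - h ^+ 2 * 'd (fun y => 'd f y u : R^o) x v| <= e * h ^+ 2.
Proof.
move=> oA Ax dfA dF e0; set F := fun y => 'd f y u.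
pose K : R := `|u| + `|v| + 1.
have K0 : 0 < K by rewrite /K ltr_wpDl // addr_ge0.
have uK : `|u| <= K by rewrite /K -addrA lerDl addr_ge0.
have uvK : `|u| + `|v| <= K by rewrite /K lerDl.
(* Two expansion errors of size [eta * h * K] get multiplied by [h]; this choice makes their total
   equal to [e * h ^+ 2]. *)
pose eta := e / (2 * K).
have eta0 : 0 < eta by rewrite divr_gt0 // mulr_gt0.
have FE := diff_locally dF.
have /nbhs_normP[r /= r0 rA] : nbhs x A by exact: open_nbhs_nbhs.
have : \forall w \near (0 : V), `|F (w + x) - F x - 'd F x w| <= eta * `|w|.
  move/eqaddoP: FE => /(_ eta eta0); apply: filterS => w.
  by rewrite /= !fctE /= opprD addrA.
move=> /nbhs_normP[q /= q0 Fq].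
have {}Fq w : `|w| < q -> `|F (w + x) - F x - 'd F x w| <= eta * `|w|.
  by move=> wq; apply: Fq => /=; rewrite sub0r normrN.
have {}rA w : `|w| < r -> A (w + x).
  by move=> wr; apply: rA => /=; rewrite opprD addrCA subrr addr0 normrN.
(* Since [K] dominates [|u| + |v|], the parallelogram of sides [h *: u] and [h *: v] stays within
   [h * K] of [x], hence inside [A] (radius [r]) and inside the range of the expansion (radius
   [q]). *)
exists (Num.min q r / K); first by rewrite divr_gt0 // lt_min q0.
move=> h h0; rewrite ltr_pdivlMr // lt_min => /andP[hq hr].
have bnd1 s : 0 <= s -> s <= h -> `|s *: u + h *: v| <= h * K.
  move=> s0 sh; apply: (le_trans (ler_normD _ _)); rewrite !normrZ.
  rewrite (ger0_norm s0) (gtr0_norm h0).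
  apply: le_trans (_ : h * (`|u| + `|v|) <= _); last by rewrite ler_pM2l.
  by rewrite mulrDr lerD2r ler_wpM2r.
have bnd2 s : 0 <= s -> s <= h -> `|s *: u| <= h * K.
  move=> s0 sh; rewrite normrZ (ger0_norm s0).
  by apply: ler_pM.
(* The second difference is [phi h - phi 0], so the mean value theorem turns it into [h] times a
   difference of values of [F]. *)
pose phi (s : R) : R := f (x + h *: v + s *: u) - f (x + s *: u).
have dphi s : 0 <= s -> s <= h ->
    is_derive s (1 : R) phi (F (x + h *: v + s *: u) - F (x + s *: u)).
  move=> s0 sh.
  have d1 : is_diff (s : R^o) (fun t : R^o => f (x + h *: v + (t : R) *: u))
      (fun t => 'd f (x + h *: v + s *: u) ((t : R) *: u)).
    apply: is_diff_compf (is_diff_line _ _ _) erefl _.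
    apply/is_diffP/dfA; rewrite -addrA addrC; apply: rA.
    by rewrite addrC; apply: le_lt_trans hr; exact: bnd1.
  have d2 : is_diff (s : R^o) (fun t : R^o => f (x + (t : R) *: u))
      (fun t => 'd f (x + s *: u) ((t : R) *: u)).
    apply: is_diff_compf (is_diff_line _ _ _) erefl _.
    apply/is_diffP/dfA; rewrite addrC; apply: rA.
    by apply: le_lt_trans hr; exact: bnd2.
  have := is_diff_derive (1 : R^o) (is_diffB d1 d2).
  move=> H.
  have {}H : is_derive s (1 : R) phi
    ('d f (x + h *: v + s *: u) ((1 : R) *: u) - 'd f (x + s *: u) ((1 : R) *: u)).
    exact H.
  by rewrite scale1r in H.
have [c] : exists2 c, c \in `]0, h[%R & phi h - phi 0 =
    (F (x + h *: v + c *: u) - F (x + c *: u)) * (h - 0).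
  apply: (@MVT R phi (fun s => F (x + h *: v + s *: u) - F (x + s *: u))).
  - exact: h0.
  - move=> s; rewrite in_itv /= => /andP[s0 sh]; apply: dphi; exact: ltW.
  - apply: derivable_within_continuous => s; rewrite in_itv /= => /andP[s0 sh].
    by case: (dphi s s0 sh).
rewrite in_itv /= => /andP[/ltW c0 /ltW ch].
rewrite subr0 /phi scale0r !addr0 => E.
have -> : f (x + h *: u + h *: v) - f (x + h *: u) - f (x + h *: v) + f x
   = (F (x + h *: v + c *: u) - F (x + c *: u)) * h.
  rewrite -E [x + h *: u + _]addrAC.
  by move: (f _) (f _) (f _) (f _) => a1 a2 a3 a4; rewrite opprB -addrA [- _ + _]addrC.
have E1 : `|F ((c *: u + h *: v) + x) - F x - 'd F x (c *: u + h *: v)|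
   <= eta * (h * K).
  apply: le_trans (Fq _ _) _; first by apply: le_lt_trans hq; exact: bnd1.
  by rewrite ler_pM2l //; exact: bnd1.
have E2 : `|F (c *: u + x) - F x - 'd F x (c *: u)| <= eta * (h * K).
  apply: le_trans (Fq _ _) _; first by apply: le_lt_trans hq; exact: bnd2.
  by rewrite ler_pM2l //; exact: bnd2.
have -> : (F (x + h *: v + c *: u) - F (x + c *: u)) * h - h ^+ 2 * 'd F x v =
   h * ((F ((c *: u + h *: v) + x) - F x - 'd F x (c *: u + h *: v))
     - (F (c *: u + x) - F x - 'd F x (c *: u))).
  have -> : x + h *: v + c *: u = c *: u + h *: v + x.
    by rewrite -addrA addrC [h *: v + _]addrC.
  have -> : 'd F x (c *: u + h *: v) = 'd F x (c *: u) + h * 'd F x v :> R.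
    by rewrite linearD; congr (_ + _); rewrite linearZ.
  rewrite [x + c *: u]addrC.
  move: (F _ : R) (F x : R) (F _ : R) ('d F x _ : R) ('d F x _ : R).
  move=> a1 a2 a3 a4 a5; ring.
rewrite normrM (gtr0_norm h0) expr2 mulrA [e * h]mulrC -mulrA ler_pM2l //.
apply: (le_trans (ler_normB _ _)).
apply: le_trans (lerD E1 E2) _.
rewrite -mulrDl /eta le_eqVlt; apply/orP; left; apply/eqP.
by field; rewrite gt_eqF.
Qed.

End SecondDerivative.

Section SecondDerivativeSymmetric.
Variable R : realType.
Implicit Types U V W : normedModType R.

(** The second difference is symmetric in [u] and [v] and agrees with [h ^+ 2] times either mixed
    derivative up to [e / 2 * h ^+ 2]; the two derivatives thus differ by at most any positive
    [e]. *)
Lemma schwarz_scalar V (f : V -> R^o) (A : set V) x u v :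
  open A -> A x -> (forall y, A y -> differentiable f y) ->
  differentiable (fun y => 'd f y u : R^o) x ->
  differentiable (fun y => 'd f y v : R^o) x ->
  'd (fun y => 'd f y u : R^o) x v = 'd (fun y => 'd f y v : R^o) x u :> R.
Proof.
move=> oA Ax dfA du dv.
pose a : R := 'd (fun y => 'd f y u : R^o) x v.
pose b : R := 'd (fun y => 'd f y v : R^o) x u.
change (a = b).
apply/eqP; rewrite -subr_eq0 -normr_le0; apply/ler_addgt0Pr => e e0.
have e20 : 0 < e / 2 by rewrite divr_gt0.
have [d1 d10 h1] := schwarz_increment v oA Ax dfA du e20.
have [d2 d20 h2] := schwarz_increment u oA Ax dfA dv e20.
pose h := Num.min d1 d2 / 2.
have m0 : 0 < Num.min d1 d2 by rewrite lt_min d10.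
have h0 : 0 < h by rewrite divr_gt0.
have hm : h < Num.min d1 d2 by rewrite ltr_pdivrMr // mulr_natr mulr2n ltrDr.
have [hd1 hd2] : h < d1 /\ h < d2 by move: hm; rewrite lt_min => /andP[].
pose D (p q : V) : R := f (x + h *: p + h *: q) - f (x + h *: p) - f (x + h *: q) + f x.
have E1 : `|D u v - h ^+ 2 * a| <= e / 2 * h ^+ 2 := h1 _ h0 hd1.
have E2 : `|D v u - h ^+ 2 * b| <= e / 2 * h ^+ 2 := h2 _ h0 hd2.
have DE : D v u = D u v.
  rewrite /D [x + h *: v + _]addrAC.
  by move: (f _ : R) (f _ : R) (f _ : R) (f _ : R) => a1 a2 a3 a4; ring.
rewrite DE in E2.
have h20 : 0 < h ^+ 2 by rewrite exprn_gt0.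
rewrite -(ler_pM2l h20) add0r.
rewrite -[X in X * _ <= _](gtr0_norm h20) -normrM.
have -> : h ^+ 2 * (a - b) = (D u v - h ^+ 2 * b) - (D u v - h ^+ 2 * a) by ring.
apply: (le_trans (ler_normB _ _)); apply: (le_trans (lerD E2 E1)).
by rewrite -mulrDl -splitr mulrC.
Qed.

Definition d2 V W (f : V -> W) (x u v : V) : W := 'd (fun y => 'd f y u) x v.

Lemma d2_sym V W (f : V -> W) (A : set V) x u v : findim W ->
  open A -> A x -> smooth_on A f -> d2 f x u v = d2 f x v u.
Proof.
move=> [n [e [l [lP le]]]] oA Ax sf.
rewrite [LHS]le [RHS]le; apply: eq_bigr => i _; congr (_ *: _).
have [ll lc] := lP i.
have dl y w : A y -> 'd (fun z => l i (f z)) y w = l i ('d f y w).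
  move=> Ay; apply: (is_diff_app (df := fun w => l i ('d f y w))).
  apply: is_diff_compf (is_diffP (smooth_diff sf Ay)) erefl _.
  exact: is_diff_lin.
have ddl w : is_diff x (fun y => 'd (fun z => l i (f z)) y w : R^o)
    (fun w' => l i (d2 f x w w')).
  apply: (@is_diff_near _ _ _ (fun y => l i ('d f y w))).
    near=> y; rewrite dl //; near: y; exact: open_nbhs_nbhs.
  apply: is_diff_compf (is_diffP (smooth_diff (smooth_d w sf) Ax)) erefl _.
  exact: is_diff_lin.
rewrite -(is_diff_app v (ddl u)) -(is_diff_app u (ddl v)).
apply: (schwarz_scalar oA Ax) => [y Ay||].
- suff : is_diff y (fun z => l i (f z)) (fun w => l i ('d f y w)) by case.
  apply: is_diff_compf (is_diffP (smooth_diff sf Ay)) erefl _.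
  exact: is_diff_lin.
- by have [] := ddl u.
- by have [] := ddl v.
Unshelve. all: by end_near. Qed.

Lemma d2Dr V W (f : V -> W) x u v w : d2 f x u (v + w) = d2 f x u v + d2 f x u w.
Proof. exact: linearD. Qed.

Lemma d2Zr V W (f : V -> W) x u k v : d2 f x u (k *: v) = k *: d2 f x u v.
Proof. exact: linearZ. Qed.

Lemma is_diff_applin U V W (L : U -> V -> W) (y dy : U -> V) x : findim V ->
  (forall v, differentiable (fun z => L z v) x) ->
  (forall z, linear (L z)) -> is_diff x y dy ->
  is_diff x (fun z => L z (y z))
    (fun u => 'd (fun z => L z (y x)) x u + L x (dy u)).
Proof.
move=> [n [e [l [lP le]]]] dL linL hy.
have LE z v : L z v = \sum_i (l i v : R) *: L z (e i).
  pose M := GRing.isLinear.Build _ _ _ _ _ (linL z).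
  pose L' : {linear V -> W} := HB.pack (L z) M.
  rewrite {1}(le v) -[L z]/(L' : _ -> _) linear_sum.
  by apply: eq_bigr => i _; rewrite linearZ.
have d1 v : is_diff x (fun z => L z v)
    (fun u => \sum_i (l i v : R) *: 'd (fun z => L z (e i)) x u).
  apply: (@is_diff_near _ _ _ (fun z => \sum_i (l i v : R) *: L z (e i))).
    by near=> z; rewrite -LE.
  apply: is_diff_sum => i; have := is_diffP (dL (e i)) => h.
  exact: (is_diffZ (l i v)).
apply: is_diff_ext (_ : is_diff x (fun z => \sum_i (l i (y z) : R) *: L z (e i))
  (fun u => \sum_i ((l i (y x) : R) *: 'd (fun z => L z (e i)) x u
     + (l i (dy u) : R) *: L x (e i)))) _ _.
- apply: is_diff_sum => i; apply: (is_diff_scale (a := fun z => l i (y z))).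
    have [ll lc] := lP i.
    by apply: is_diff_compf hy erefl _; exact: is_diff_lin.
  exact: is_diffP.
- by move=> z; rewrite -LE.
- move=> u /=; rewrite big_split /= -LE; congr (_ + _).
  by rewrite (is_diff_app _ (d1 _)).
Unshelve. all: by end_near. Qed.

Lemma is_derive_lipschitz (f df : R -> R) (M a b : R) :
  (forall t, Num.min a b <= t <= Num.max a b ->
    is_derive t (1 : R) f (df t) /\ `|df t| <= M) ->
  `|f b - f a| <= M * `|b - a|.
Proof.
wlog ab : a b / a <= b.
  move=> H; case/orP: (le_total a b) => ba; first exact: H.
  move=> h; rewrite distrC [`|b - a|]distrC; apply: H => // t.
  by rewrite minC maxC; exact: h.
rewrite min_l // max_r // => h.
have [||c cab ->] := @MVT_segment R f df a b ab.
- by move=> t; rewrite in_itv /= => /andP[/ltW ta /ltW tb]; apply: (h _ _).1; rewrite ta.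
- apply: derivable_within_continuous => t; rewrite in_itv /= => tab.
  by case: (h t tab).1.
rewrite normrM ler_wpM2r //; apply: (h _ _).2.
by rewrite in_itv /= in cab.
Qed.

End SecondDerivativeSymmetric.

Lemma open_preimage_on (T S : topologicalType) (A : set T) (B : set S) (f : T -> S) :
  open A -> open B -> (forall x, A x -> {for x, continuous f}) ->
  open (A `&` f @^-1` B).
Proof.
move=> oA oB fc; rewrite openE => x [Ax Bx].
apply: filterI; first exact: open_nbhs_nbhs.
by apply: fc => //; exact: open_nbhs_nbhs.
Qed.

(** * Smooth maps read in arbitrary charts *)

Section Charts.
Variable R : realType.
Implicit Types V W : normedModType R.

(** Same as [local_rep], except that the target chart is a free parameter rather than the one
    indexed by [f x]. Charts can then be matched in composites, and one chart can serve along a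
    whole curve. *)
Definition rep V W (M : charted V) (N : charted W) (x : M) (y : N) (f : M -> N)
  : V -> W := chart_at y \o f \o of_model (chart_at x).

Definition D V W (M : charted V) (N : charted W) (x : M) (y : N) (f : M -> N)
  (p : M) : V -> W := 'd (rep x y f) (chart_at x p).

Definition smooth_at V W (M : charted V) (N : charted W) (x : M) (y : N)
  (f : M -> N) (p : M) : Prop := exists U : set V,
  [/\ open U, U (chart_at x p),
      U `<=` chart_at x @` source (chart_at x),
      forall z, U z -> source (chart_at y) (f (of_model (chart_at x) z)) &
      smooth_on U (rep x y f)].

Section OneManifold.
Variables (V : normedModType R) (M : charted V).
Hypothesis mM : smooth_manifold M.
Let Ms : forall x : M, source (chart_at x) x. Proof. by case: mM. Qed.

Lemma chartK (x y : M) : source (chart_at x) y -> of_model (chart_at x) (chart_at x y) = y.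
Proof. by case: mM => _ + _; apply. Qed.

Lemma source_chart_at (x : M) : source (chart_at x) x.
Proof. exact: Ms. Qed.

Lemma of_modelK (x : M) z : (chart_at x @` source (chart_at x)) z ->
  chart_at x (of_model (chart_at x) z) = z.
Proof. by move=> [y sy <-]; rewrite chartK. Qed.

Lemma source_of_model (x : M) z : (chart_at x @` source (chart_at x)) z ->
  source (chart_at x) (of_model (chart_at x) z).
Proof. by move=> [y sy <-]; rewrite chartK. Qed.

Lemma open_image (x : M) : open (chart_at x @` source (chart_at x)).
Proof. by case: mM => _ _ /(_ x x)[]; rewrite setIid. Qed.

Lemma image_chart (x y : M) : source (chart_at x) y ->
  (chart_at x @` source (chart_at x)) (chart_at x y).
Proof. by move=> h; exists y. Qed.

Lemma smooth_trans (x y : M) :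
  open (chart_at x @` (source (chart_at x) `&` source (chart_at y))) /\
  smooth_on (chart_at x @` (source (chart_at x) `&` source (chart_at y)))
    (chart_at y \o of_model (chart_at x)).
Proof. by case: mM => _ _ /(_ x y). Qed.

Lemma near_source (x y : M) : source (chart_at x) y ->
  \forall z \near chart_at x y, (chart_at x @` source (chart_at x)) z.
Proof.
move=> h; apply: open_nbhs_nbhs; split; [exact: open_image|exact: image_chart].
Qed.

End OneManifold.

(** Near [p] the new representative is the old one placed between two transition maps; [U] is the
    set on which this composite is defined. *)
Lemma smooth_at_charts V W (M : charted V) (N : charted W) (f : M -> N) (p : M) x0 y0 x y :
  findim V -> findim W -> smooth_manifold M -> smooth_manifold N ->
  source (chart_at x0) p -> source (chart_at y0) (f p) ->
  source (chart_at x) p -> source (chart_at y) (f p) ->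
  smooth_at x0 y0 f p -> smooth_at x y f p.
Proof.
move=> fV fW mM mN x0p y0p xp yp [U0 [oU0 U0p U0s U0f sf]].
have [oX sT] := smooth_trans mM x x0; have [oY sS] := smooth_trans mN y0 y.
set T := _ \o _ in sT; set S := _ \o _ in sS.
set X := _ @` _ in oX sT; set Y := _ @` _ in oY sS.
pose U1 := U0 `&` rep x0 y0 f @^-1` Y.
have oU1 : open U1.
  by apply: open_preimage_on => // z Uz; exact: smooth_cont sf Uz.
pose U := X `&` T @^-1` U1.
have oU : open U.
  by apply: open_preimage_on => // z Uz; exact: smooth_cont sT Uz.
(* A point of [U] is the coordinate of some [q] in both source charts whose image lies in both
   target charts, so every chart occurring below can be undone at [q]. *)
have key z : U z -> exists q, [/\ z = chart_at x q, source (chart_at x) q,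
    source (chart_at x0) q, source (chart_at y0) (f q) & source (chart_at y) (f q)].
  move=> [[q [xq x0q] <-]]; rewrite /T /= (chartK mM xq) => -[U0q].
  have y0q : source (chart_at y0) (f q) by have := U0f _ U0q; rewrite (chartK mM x0q).
  rewrite /rep /= (chartK mM x0q) => Yq; have [n' [h1 h2] h3] := Yq.
  exists q; split=> //.
  by rewrite -(chartK mN y0q) -h3 (chartK mN h1).
exists U; split=> //.
- split; first by exists p.
  rewrite /= /T /= (chartK mM xp); split=> //.
  by rewrite /rep /= (chartK mM x0p); exists (f p).
- by move=> z [[q [xq _] <-] _]; exists q.
- by move=> z /key[q [-> xq _ _ yq]]; rewrite (chartK mM xq).
- apply: (smooth_eq (f := fun z => S (rep x0 y0 f (T z)))) => //.
    move=> z /key[q [-> xq x0q y0q yq]].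
    by rewrite /S /T /rep /= (chartK mM xq) (chartK mM x0q) (chartK mN y0q).
  apply: (smooth_comp (B := Y) (f := fun z => rep x0 y0 f (T z)) fW) => //.
    by move=> z [_ []].
  apply: (smooth_comp (B := U0) fV) => //; first by move=> z [_ []].
  by apply: smooth_sub sT => z [].
Qed.

Section Chain.
Variables (V W : normedModType R) (M : charted V) (N : charted W).
Hypotheses (mM : smooth_manifold M) (mN : smooth_manifold N).
Implicit Types (f : M -> N) (p x : M) (y : N).

Lemma smooth_at_source x y f p : source (chart_at x) p -> smooth_at x y f p ->
  source (chart_at y) (f p).
Proof. by move=> xp [U [_ Up _ h _]]; have := h _ Up; rewrite (chartK mM xp). Qed.

Lemma smooth_at_diff x y f p : smooth_at x y f p -> is_diff (chart_at x p) (rep x y f) (D x y f p).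
Proof. by move=> [U [_ Up _ _ sf]]; apply/is_diffP/(smooth_diff sf Up). Qed.

Lemma smooth_at_eq x y f g p : source (chart_at x) p ->
  (\forall z \near chart_at x p, f (of_model (chart_at x) z) = g (of_model (chart_at x) z)) ->
  smooth_at x y f p -> smooth_at x y g p.
Proof.
move=> xp fg [U [oU Up Us Uf sf]].
have : nbhs (chart_at x p)
  [set z | f (of_model (chart_at x) z) = g (of_model (chart_at x) z)] := fg.
rewrite nbhsE => -[B [oB Bp] Bfg].
exists (U `&` B); split=> //; first exact: openI.
- by move=> z [/Us].
- by move=> z [Uz /Bfg /= <-]; exact: Uf.
- apply: smooth_eq (smooth_sub _ sf); first exact: openI.
    by move=> z [_ /Bfg /= E]; rewrite /rep /= E.
  by move=> z [].
Qed.

Lemma D_eq x y f g p :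
  (\forall z \near chart_at x p, f (of_model (chart_at x) z) = g (of_model (chart_at x) z)) ->
  smooth_at x y f p -> D x y g p =1 D x y f p.
Proof.
move=> fg sf v; apply: is_diff_app; apply: is_diff_near (smooth_at_diff sf).
by apply: filterS fg => z /= E; rewrite /rep /= E.
Qed.

End Chain.

Section Compose.
Variables (U V W : normedModType R) (L : charted U) (M : charted V) (N : charted W).
Hypotheses (mL : smooth_manifold L) (mM : smooth_manifold M).
Hypothesis (fV : findim V).
Implicit Types (f : L -> M) (g : M -> N) (x p : L) (y : M) (z : N).

Lemma rep_comp x y z f g p : smooth_at x y f p ->
  \forall q \near chart_at x p, rep x z (g \o f) q = rep y z g (rep x y f q).
Proof.
move=> [A [oA Ap As Af sf]]; near=> q.
have Aq : A q by near: q; exact: open_nbhs_nbhs.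
by rewrite /rep /= (chartK mM) //; exact: Af.
Unshelve. all: by end_near. Qed.

Lemma smooth_at_comp x y z f g p : source (chart_at x) p ->
  smooth_at x y f p -> smooth_at y z g (f p) -> smooth_at x z (g \o f) p.
Proof.
move=> xp sf' [B [oB Bp Bs Bf sg]]; have [A [oA Ap As Af sf]] := sf'.
pose C := A `&` rep x y f @^-1` B.
have oC : open C.
  by apply: open_preimage_on => // q Aq; exact: smooth_cont sf Aq.
have E q : C q -> rep x z (g \o f) q = rep y z g (rep x y f q).
  by move=> [Aq _]; rewrite /rep /= (chartK mM) //; exact: Af.
exists C; split=> //.
- by split=> //; rewrite /= /rep /= (chartK mL xp).
- by move=> q [/As].
- by move=> q [Aq /= /Bf]; rewrite /rep /= (chartK mM) //; exact: Af.
- apply: (smooth_eq (f := fun q => rep y z g (rep x y f q))) => //.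
    by move=> q /E.
  apply: (smooth_comp fV oC oB) => //; first by move=> q [].
  by apply: smooth_sub sf => q [].
Qed.

Lemma D_comp x y z f g p v : source (chart_at x) p ->
  smooth_at x y f p -> smooth_at y z g (f p) ->
  D x z (g \o f) p v = D y z g (f p) (D x y f p v).
Proof.
move=> xp sf sg.
apply: (is_diff_app (df := fun v => D y z g (f p) (D x y f p v))).
apply: (@is_diff_near _ _ _ (fun q => rep y z g (rep x y f q))).
  by apply: filterS (rep_comp z g sf) => q ->.
apply: is_diff_compf (smooth_at_diff sf) _ (smooth_at_diff sg).
by rewrite /rep /= (chartK mL xp).
Qed.

End Compose.

Section Instances.
Variables (V W : normedModType R).

Lemma smooth_manifold_vec : smooth_manifold (vec V).
Proof.
split=> //= x y; rewrite setIT image_id; split; first exact: openT.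
exact: smooth_id.
Qed.

Lemma smooth_at_id (M : charted V) (x y p : M) : smooth_manifold M ->
  source (chart_at x) p -> source (chart_at y) p -> smooth_at x y (fun q => q) p.
Proof.
move=> mM xp yp; have [oX sT] := smooth_trans mM x y.
exists (chart_at x @` (source (chart_at x) `&` source (chart_at y))); split=> //.
- by exists p.
- by move=> z [q [xq _] <-]; exists q.
- by move=> z [q [xq yq] <-]; rewrite (chartK mM xq).
Qed.

Lemma D_id (M : charted V) (x p : M) v : smooth_manifold M ->
  source (chart_at x) p -> D x x (fun q => q) p v = v.
Proof.
move=> mM xp; apply: (is_diff_app (df := id)).
apply: (is_diff_near _ (is_diff_id _)).
near=> z; rewrite /rep /= (of_modelK mM) //; near: z; exact: near_source.
Unshelve. all: by end_near. Qed.

Lemma smooth_at_cst (M : charted V) (N : charted W) (x p : M) (y q : N) :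
  smooth_manifold M -> source (chart_at x) p -> source (chart_at y) q ->
  smooth_at x y (fun=> q) p.
Proof.
move=> mM xp yq; exists (chart_at x @` source (chart_at x)); split=> //.
- exact: open_image.
- exact: smooth_cst.
Qed.

Lemma D_cst (M : charted V) (N : charted W) (x p : M) (y q : N) v :
  D x y (fun=> q) p v = 0.
Proof.
by apply: (is_diff_app (df := fun=> 0)); exact: is_diff_cst.
Qed.

Lemma smooth_at_of_model (M : charted V) (x y p : M) : smooth_manifold M ->
  source (chart_at x) p -> source (chart_at y) p ->
  @smooth_at _ _ (vec V) M 0 y (of_model (chart_at x)) (chart_at x p).
Proof.
move=> mM xp yp; have [U [oU Up Us Uf sf]] := smooth_at_id mM xp yp.
by exists U; split=> //= z _; exists z.
Qed.

Variables (M : charted V) (N : charted W).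
Hypotheses (mM : smooth_manifold M) (mN : smooth_manifold N).

Lemma image_setX (A : set V) (B : set W) : open A -> open B -> open (A `*` B).
Proof.
move=> oA oB; rewrite openE => -[a b] [/= Aa Bb]; exists (A, B) => //=.
by split; exact: open_nbhs_nbhs.
Qed.

Lemma smooth_manifold_prod : findim V -> findim W -> smooth_manifold (prodM M N).
Proof.
move=> fV fW; split=> [x|x y [s1 s2]|x y].
- by split=> /=; exact: source_chart_at.
- by case: y s1 s2 => a b /= s1 s2; rewrite (chartK mM s1) (chartK mN s2).
- have [op1 t1] := smooth_trans mM x.1 y.1.
  have [op2 t2] := smooth_trans mN x.2 y.2.
  move=> /=.
  set U := _ @` _.
  have -> : U = (chart_at x.1 @` (source (chart_at x.1) `&` source (chart_at y.1))) `*`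
     (chart_at x.2 @` (source (chart_at x.2) `&` source (chart_at y.2))).
    apply/seteqP; split=> [_ [[a b] [[/= h1 h2] [h3 h4]] <-]|[_ _] [[a [h1 h3] /= <-] [b [h2 h4] /= <-]]].
      by split=> /=; [exists a|exists b].
    by exists (a, b).
  have oU := image_setX op1 op2.
  split=> //; apply: smooth_pair => //.
    apply: (smooth_comp (f := fst) fV oU op1 _ _ t1); first by move=> z [].
    exact: smooth_fst.
  apply: (smooth_comp (f := snd) fW oU op2 _ _ t2); first by move=> z [].
  exact: smooth_snd.
Qed.

End Instances.

Lemma smooth_at_pair (U V W : normedModType R) (L : charted U) (M : charted V)
  (N : charted W) (f : L -> M) (g : L -> N) x y z p :
  smooth_at x y f p -> smooth_at x z g p ->
  @smooth_at _ _ L (prodM M N) x (y, z) (fun q => (f q, g q)) p.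
Proof.
move=> [A [oA Ap As Af sf]] [B [oB Bp Bs Bg sg]].
have oI := openI oA oB.
exists (A `&` B); split=> //.
- by move=> q [/As].
- by move=> q [/Af h /Bg h']; split.
- by apply: smooth_pair => //; [apply: smooth_sub sf|apply: smooth_sub sg] => q [].
Qed.

Lemma D_pair (U V W : normedModType R) (L : charted U) (M : charted V)
  (N : charted W) (f : L -> M) (g : L -> N) x y z p v :
  smooth_at x y f p -> smooth_at x z g p ->
  @D _ _ L (prodM M N) x (y, z) (fun q => (f q, g q)) p v = (D x y f p v, D x z g p v).
Proof.
move=> sf sg; apply: (is_diff_app (df := fun v => (D x y f p v, D x z g p v))).
exact: is_diff_pair (smooth_at_diff sf) (smooth_at_diff sg).
Qed.

End Charts.

(** * Curves with zero velocity are constant *)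

Section LocallyConstant.
Variable R : realType.

Lemma derive0_cst (f : R -> R) (a b : R) :
  (forall t, Num.min a b <= t <= Num.max a b -> is_derive t (1 : R) f 0) ->
  f a = f b.
Proof.
move=> h; apply/esym/eqP; rewrite -subr_eq0 -normr_le0.
have := @is_derive_lipschitz R f (fun=> 0) 0 a b.
by rewrite mul0r; apply=> t /h; rewrite normr0.
Qed.

(** Near each time the curve stays in one chart, where its coordinates have zero derivative; it is
    therefore locally constant, and local constancy propagates along the segment. *)
Lemma D0_constant n (M : charted 'rV[R]_n) (k : vec R^o -> M) (I : set R) (a b : R) :
  smooth_manifold M -> open I ->
  (forall t, Num.min a b <= t <= Num.max a b -> I t) ->
  (forall t, I t -> smooth_at (0 : vec R^o) (k t) k t) ->
  (forall t, I t -> D (0 : vec R^o) (k t) k t 1 = 0) ->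
  k a = k b.
Proof.
move=> mM oI abI sk dk.
have mR : smooth_manifold (vec R^o) by exact: smooth_manifold_vec.
have fR : findim ('rV[R]_n) by [].
have loc t : I t -> \forall s \near t, k s = k t.
  move=> It; have [U [oU Ut _ Us sU]] := sk t It.
  have /nbhs_ballP[r /= r0 rUI] : nbhs t (U `&` I).
    by apply: open_nbhs_nbhs; split; [exact: openI|].
  have dU s : ball t r s -> is_diff (s : R^o) (rep (0 : vec R^o) (k t) k) (fun=> 0).
    move=> /rUI[Us1 Is].
    have ss : smooth_at (0 : vec R^o) (k t) k s by exists U; split=> //= z _; exists z.
    have skt : source (chart_at (k t)) (k s) := Us _ Us1.
    apply: is_diff_ext (smooth_at_diff ss) _ _ => // v.
    (* The hypothesis at [s] is stated in the chart around [k s]. The transition to the chart around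
       [k t] has a linear differential, which sends 0 to 0. *)
    have E : D (0 : vec R^o) (k t) k s 1 = 0.
      have sid : smooth_at (k s) (k t) (fun q => q) (k s).
        by apply: smooth_at_id => //; exact: source_chart_at.
      have E : D (0 : vec R^o) (k t) k s 1 =
          D (k s) (k t) (fun q => q) (k s) (D (0 : vec R^o) (k s) k s 1).
        exact: (D_comp mR mM 1 Logic.I (sk s Is) sid).
      by rewrite E dk // [LHS]linear0.
    have -> : v = (v : R) *: (1 : R^o) by rewrite /GRing.scale /= mulr1.
    rewrite /D in E *; rewrite linearZ /=.
    by move: E => /= ->; rewrite scaler0.
  apply/nbhs_ballP; exists r => //= s ts.
  have skt : source (chart_at (k t)) (k s) := Us _ (rUI _ ts).1.
  rewrite -[LHS](chartK mM skt) -[RHS](chartK mM (source_chart_at mM (k t))).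
  congr (of_model (chart_at (k t)) _); apply/rowP => j.
  apply/esym; apply: (@derive0_cst (fun s => chart_at (k t) (k s) 0 j) t s) => u.
  move=> /andP[u1 u2].
  have tu : ball t r u.
    rewrite -ball_normE /= in ts *.
    move: u1 u2; case: (leP t s) => h h1 h2.
      rewrite distrC ger0_norm ?subr_ge0 //; rewrite distrC ger0_norm ?subr_ge0 // in ts.
      by apply: le_lt_trans ts; rewrite lerB.
    rewrite ger0_norm ?subr_ge0 //; rewrite ger0_norm ?subr_ge0 ?(ltW h) // in ts.
    by apply: le_lt_trans ts; rewrite lerB.
  pose cj (N : 'rV[R]_n) : R^o := N 0 j.
  have lj : linear cj by move=> c A B; rewrite /cj !mxE.
  have dj N : is_diff N cj cj by apply: is_diff_lin => //; exact: coord_continuous.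
  have := is_diff_derive (1 : R^o) (is_diff_compf (dU u tu) erefl (dj _)).
  by rewrite /cj mxE; exact.
(* The indicator of the times at which [k] takes the value [k a] is locally constant, so it has
   derivative 0 along the segment: connectedness of the interval is obtained from the mean value
   theorem. *)
pose g (t : R) : R := `[< k t = k a >]%:R.
have gab : g a = g b.
  apply: derive0_cst => t /abI It.
  have H : \forall s \near t, cst (g t) s = g s.
    by apply: filterS (loc t It) => s; rewrite /g /= => ->.
  exact: near_eq_is_derive H (is_derive_cst (g t) t 1).
move: gab; rewrite /g asboolT //.
by case: asboolP => // _ /eqP; rewrite oner_eq0.
Qed.

End LocallyConstant.

(** * Smoothness and differentials of products and inverses *)

Section GroupWords.
Variables (R : realType) (n : nat) (G : lieGroup R n).
Notation M := (mfd G).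
Notation g := 'rV[R]_n.

Lemma mfdP : smooth_manifold M. Proof. exact: lie_manifold. Qed.
Let mM := mfdP.
Let fV : findim g. Proof. by []. Qed.
Let mMM : smooth_manifold (prodM M M).
Proof. exact: smooth_manifold_prod. Qed.

Section Words.
Variables (U : normedModType R) (L : charted U).
Hypotheses (mL : smooth_manifold L).
Implicit Types (f h : L -> M) (p x : L).

Lemma smooth_at_mul (a b c : M) (p : M * M) :
  source (chart_at a) p.1 -> source (chart_at b) p.2 ->
  source (chart_at c) (p.1 * p.2)%g ->
  @smooth_at _ _ _ (prodM M M) M (a, b) c (fun q => q.1 * q.2)%g p.
Proof.
move=> ap bp cp; have sm := @lie_mul_smooth R n G p.
apply: (@smooth_at_charts R _ _ (prodM M M) M _ p p _ (a, b) c _ _ mMM mM _ _ _ _ sm) => //;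
  try exact: source_chart_at.
exact: findim_prod.
Qed.

Lemma smooth_atM f h x (a b c : M) p : source (chart_at x) p ->
  smooth_at x a f p -> smooth_at x b h p -> source (chart_at c) (f p * h p)%g ->
  smooth_at x c (fun q => f q * h q)%g p.
Proof.
move=> xp sf sh cp.
have ss := smooth_at_pair sf sh.
have sm : @smooth_at _ _ _ (prodM M M) M (a, b) c (fun q => q.1 * q.2)%g (f p, h p).
  apply: smooth_at_mul => //.
    exact: smooth_at_source sf.
  exact: smooth_at_source sh.
exact: (smooth_at_comp mL mMM (findim_prod fV fV) xp ss sm).
Qed.

Lemma smooth_atV f x (a c : M) p : source (chart_at x) p ->
  smooth_at x a f p -> source (chart_at c) (f p)^-1%g ->
  smooth_at x c (fun q => (f q)^-1)%g p.
Proof.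
move=> xp sf cp; have sm := @lie_inv_smooth R n G (f p).
apply: (smooth_at_comp mL mM fV xp sf).
apply: smooth_at_charts sm => //; try exact: source_chart_at.
exact: smooth_at_source sf.
Qed.

Lemma src1 : source (chart_at (1%g : M)) (1%g : M).
Proof. exact: source_chart_at. Qed.

(** By linearity it is enough to treat [(u, 0)] and [(0, w)], along which the multiplication
    restricts to [q * 1] and [1 * q]. *)
Lemma D_mul1 (u w : g) :
  @D _ _ _ (prodM M M) M (1%g, 1%g) 1%g (fun q => q.1 * q.2)%g (1%g, 1%g) (u, w) = u + w.
Proof.
have sm : @smooth_at _ _ _ (prodM M M) M (1%g, 1%g) 1%g (fun q => q.1 * q.2)%g (1%g, 1%g).
  by apply: smooth_at_mul; rewrite /= ?mulg1; exact: src1.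
have si : smooth_at (1%g : M) (1%g : M) (fun q => q) 1%g.
  by apply: smooth_at_id => //; exact: src1.
have sc : smooth_at (1%g : M) (1%g : M) (fun=> 1%g) 1%g.
  by apply: smooth_at_cst => //; exact: src1.
have -> : (u, w) = (u, 0) + (0, w) :> g * g by congr (_, _); rewrite /= ?addr0 ?add0r.
rewrite [LHS]linearD; congr (_ + _).
- have E := @D_comp _ _ _ _ M (prodM M M) M mM mMM _ _ _ _ _ _ u src1 (smooth_at_pair si sc) sm.
  rewrite D_pair // (D_id _ mM src1) D_cst in E.
  apply: etrans (esym E) _; rewrite (_ : _ \o _ = fun q => q) ?(D_id _ mM src1) //.
  by apply/funext => q /=; rewrite mulg1.
- have E := @D_comp _ _ _ _ M (prodM M M) M mM mMM _ _ _ _ _ _ w src1 (smooth_at_pair sc si) sm.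
  rewrite D_pair // (D_id _ mM src1) D_cst in E.
  apply: etrans (esym E) _; rewrite (_ : _ \o _ = fun q => q) ?(D_id _ mM src1) //.
  by apply/funext => q /=; rewrite mul1g.
Qed.

Lemma DM1 f h x p v : source (chart_at x) p ->
  smooth_at x (1%g : M) f p -> smooth_at x (1%g : M) h p -> f p = 1%g -> h p = 1%g ->
  D x (1%g : M) (fun q => f q * h q)%g p v =
  D x (1%g : M) f p v + D x (1%g : M) h p v.
Proof.
move=> xp sf sh f1 h1.
have sm : @smooth_at _ _ _ (prodM M M) M (1%g, 1%g) 1%g (fun q => q.1 * q.2)%g (f p, h p).
  by rewrite f1 h1; apply: smooth_at_mul; rewrite /= ?mulg1; exact: src1.
have E := @D_comp _ _ _ _ L (prodM M M) M mL mMM _ _ _ _ _ _ v xp (smooth_at_pair sf sh) sm.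
by rewrite D_pair // f1 h1 D_mul1 in E.
Qed.

(** This is [DM1] applied to the constant product of [f q] and its inverse. *)
Lemma DV1 f x p v : source (chart_at x) p ->
  smooth_at x (1%g : M) f p -> f p = 1%g ->
  D x (1%g : M) (fun q => (f q)^-1)%g p v = - D x (1%g : M) f p v.
Proof.
move=> xp sf f1.
have sV : smooth_at x (1%g : M) (fun q => (f q)^-1)%g p.
  by apply: smooth_atV xp sf _; rewrite f1 invg1; exact: src1.
have := DM1 v xp sf sV f1 _; rewrite f1 invg1 => /(_ erefl) E.
apply/eqP; rewrite -addr_eq0 addrC -E; apply/eqP.
rewrite (_ : (fun q => _) = fun=> 1%g) ?D_cst //.
by apply/funext => q; rewrite mulgV.
Qed.

End Words.

(* c1 and c2 have the same right logarithmic derivative xi at t0: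
   c1^-1 c2 = c1(t0)^-1 (e1^-1 e2) c2(t0) with ei(t) = ci(t) ci(t0)^-1. *)
Lemma D_quotient_curves (c1 c2 : vec R^o -> M) (t0 : R^o) (xi : g) :
  smooth_at (0 : vec R^o) (c1 t0) c1 t0 -> smooth_at (0 : vec R^o) (c2 t0) c2 t0 ->
  D (0 : vec R^o) (1%g : M) (fun t => c1 t * (c1 t0)^-1)%g t0 1 = xi ->
  D (0 : vec R^o) (1%g : M) (fun t => c2 t * (c2 t0)^-1)%g t0 1 = xi ->
  let k := (fun t => (c1 t)^-1 * c2 t)%g : vec R^o -> M in
  smooth_at (0 : vec R^o) (k t0) k t0 /\ D (0 : vec R^o) (k t0) k t0 1 = 0.
Proof.
move=> s1 s2 d1 d2 k.
have mR : smooth_manifold (vec R^o) by exact: smooth_manifold_vec.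
have t0s : source (chart_at (0 : vec R^o)) t0 by [].
have sc (q : M) : smooth_at (0 : vec R^o) q (fun=> q) t0.
  by apply: smooth_at_cst => //; exact: source_chart_at.
have se (c : vec R^o -> M) : smooth_at (0 : vec R^o) (c t0) c t0 ->
   smooth_at (0 : vec R^o) (1%g : M) (fun t => c t * (c t0)^-1)%g t0.
  by move=> s; apply: smooth_atM mR _ _ _ _ _ _ _ t0s s (sc _) _; rewrite mulgV; exact: src1.
pose e1 t : M := (c1 t * (c1 t0)^-1)%g; pose e2 t : M := (c2 t * (c2 t0)^-1)%g.
pose w t : M := ((e1 t)^-1 * e2 t)%g.
have se1 : smooth_at (0 : vec R^o) (1%g : M) (fun t => (e1 t)^-1)%g t0.
  by apply: smooth_atV mR _ _ _ _ _ t0s (se _ s1) _; rewrite mulgV invg1; exact: src1.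
have sw : smooth_at (0 : vec R^o) (1%g : M) w t0.
  apply: smooth_atM mR _ _ _ _ _ _ _ t0s se1 (se _ s2) _.
  by rewrite /e1 !mulgV invg1 mulg1; exact: src1.
have dw : D (0 : vec R^o) (1%g : M) w t0 1 = 0.
  rewrite DM1 //; last 3 first.
  - exact: se.
  - by rewrite /e1 mulgV invg1.
  - by rewrite /e2 mulgV.
  by rewrite DV1 // ?d1 ?d2 ?addNr //; [exact: se|rewrite /e1 mulgV].
have w1 : w t0 = 1%g by rewrite /w /e1 /e2 !mulgV invg1 mulg1.
pose T (q : M) : M := ((c1 t0)^-1 * q * c2 t0)%g.
have kE : k = T \o w.
  apply/funext => t; rewrite /k /T /w /e1 /e2 /= invgM invgK.
  by rewrite !mulgA mulVg mul1g -!mulgA mulVg mulg1.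
have sT : smooth_at (1%g : M) (k t0) T (w t0).
  have -> : k t0 = ((c1 t0)^-1 * 1 * c2 t0)%g by rewrite mulg1.
  rewrite w1 /T; have s1M : source (chart_at (1%g : M)) (1%g : M) by exact: src1.
  apply: (smooth_atM mM (a := ((c1 t0)^-1 * 1)%g) (b := c2 t0)) => //.
  - apply: (smooth_atM mM (a := (c1 t0)^-1%g) (b := 1%g)) => //.
    + by apply: smooth_at_cst => //; exact: source_chart_at.
    + exact: smooth_at_id.
    + exact: source_chart_at.
  - by apply: smooth_at_cst => //; exact: source_chart_at.
  - exact: source_chart_at.
split; first by rewrite {2}kE; exact: (smooth_at_comp mR mM fV t0s sw sT).
by rewrite {2}kE (D_comp mR mM 1 t0s sw sT) dw [LHS]linear0.
Qed.

End GroupWords.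

(** * Local flows *)

Section Clamp.
Variable R : realType.
Implicit Types d s t : R.

Definition clamp d t : R := Num.max (- d) (Num.min t d).

Lemma clamp_bound d t : 0 <= d -> `|clamp d t| <= d.
Proof.
move=> d0; rewrite ler_norml /clamp le_max lexx /= ge_max ge_min lexx orbT andbT.
by rewrite (le_trans _ d0) // oppr_le0.
Qed.

Lemma clamp_id d t : `|t| <= d -> clamp d t = t.
Proof.
by rewrite ler_norml => /andP[h1 h2]; rewrite /clamp min_l // max_r.
Qed.

Lemma clamp_lip d s t : `|clamp d s - clamp d t| <= `|s - t|.
Proof.
wlog st : s t / s <= t.
  move=> H; case/orP: (le_total s t) => h; first exact: H.
  by rewrite distrC [leRHS]distrC; exact: H.
have h : clamp d s <= clamp d t.
  by rewrite /clamp ge_max le_max lexx /= le_max orbC le_min !ge_min st lexx /= orbT.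
rewrite ler0_norm ?subr_le0 // ler0_norm ?subr_le0 // !opprB /clamp.
case: (leP t d) => td; first rewrite (min_l (le_trans st td)).
  case: (leP (- d) s) => sd; case: (leP (- d) t) => td'; lra.
case: (leP s d) => sd.
  case: (leP (- d) s) => sd'; case: (leP (- d) d) => dd; lra.
by rewrite subrr subr_ge0.
Qed.

Lemma clamp_cont d : continuous (clamp d).
Proof.
move=> t; apply/cvgrPdist_le => e e0; near=> s.
apply: le_trans (clamp_lip d t s) _.
by near: s; apply: cvgr_dist_le => //; exact: cvg_id.
Unshelve. all: by end_near. Qed.

End Clamp.

Section Primitive.
Variables (R : realType) (d : R).
Hypotheses (d0 : 0 < d) (d1 : d < 1).
Implicit Types f g : R -> R.

(** The integral starts at -1, so that the times of absolute value at most [d < 1], including 0, lie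
    inside the range of the fundamental theorem of calculus; [primitive] subtracts the value at
    0. *)
Let F f x : R := (\int[@lebesgue_measure R]_(t in `[-1, x]) f t)%R.

(* Clamping the argument makes the primitive continuous and its estimates
   valid on the whole line. *)
Definition primitive f t : R := F f (clamp d t) - F f 0.

Lemma F_derive f t : continuous f -> `|t| < 1 -> is_derive t (1 : R) (F f) (f t).
Proof.
move=> fc; rewrite ltr_norml => /andP[t1 t2].
have [|h1 h2] := @continuous_FTC1_closed R f (-1) t 1 t2 _ t1 (fc t).
- apply: continuous_compact_integrable; first exact: segment_compact.
  exact: continuous_subspaceT.
- by split; [exact: h1|rewrite -derive1E; exact: h2].
Qed.

Lemma primitive0 f : primitive f 0 = 0.
Proof. by rewrite /primitive clamp_id ?normr0 ?subrr // ltW. Qed.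

Lemma primitive_derive f t : continuous f -> `|t| < d ->
  is_derive t (1 : R) (primitive f) (f t).
Proof.
move=> fc td.
have H : \forall s \near t, (F f + cst (- F f 0)) s = primitive f s.
  near=> s; rewrite /primitive clamp_id //; apply: ltW.
  near: s; apply: (@cvgr_norm_lt _ R^o _ _ _ id t) => //.
apply: near_eq_is_derive H _.
have h := is_deriveD (F_derive fc (lt_trans td d1)) (is_derive_cst (- F f 0) t 1).
by rewrite addr0 in h.
Unshelve. all: by end_near. Qed.

Lemma primitive_cont f : continuous f -> continuous (primitive f).
Proof.
move=> fc t; apply: cvgB; last exact: cvg_cst.
apply: (@continuous_comp _ _ _ (clamp d) (F f)); first exact: clamp_cont.
apply/differentiable_continuous/derivable1_diffP.
have /F_derive : continuous f by [].
move=> /(_ (clamp d t)) []//.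
by apply: le_lt_trans d1; exact/clamp_bound/ltW.
Qed.

Lemma F_lip (h dh : R -> R) e t : 0 <= e ->
  (forall s, `|s| < 1 -> is_derive s (1 : R) h (dh s)) ->
  (forall s, `|dh s| <= e) -> `|h (clamp d t) - h 0| <= d * e.
Proof.
move=> e0 hd hb; have ct := clamp_bound t (ltW d0).
apply: le_trans (_ : e * `|clamp d t - 0| <= _); last by rewrite subr0 mulrC ler_wpM2r.
apply: (@is_derive_lipschitz R h dh) => s /andP[s1 s2]; split=> //; apply: hd.
apply: le_lt_trans d1; move: ct; rewrite !ler_norml => /andP[c1 c2].
move: s1 s2; rewrite ge_min le_max => /orP s1 /orP s2.
by apply/andP; split; [case: s1|case: s2] => h'; lra.
Qed.

Lemma primitive_bound f e t : continuous f ->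
  (forall s, `|f s| <= e) -> `|primitive f t| <= d * e.
Proof.
move=> fc fe; apply: (@F_lip _ f) => //; first exact: le_trans (fe 0).
by move=> s; exact: F_derive.
Qed.

Lemma primitive_dist f g e t : continuous f -> continuous g ->
  (forall s, `|f s - g s| <= e) -> `|primitive f t - primitive g t| <= d * e.
Proof.
move=> fc gc fg.
have -> : primitive f t - primitive g t =
  (F f (clamp d t) - F g (clamp d t)) - (F f 0 - F g 0).
  by rewrite /primitive; ring.
apply: (@F_lip (fun x => F f x - F g x) (fun x => f x - g x)) => //.
  exact: le_trans (fg 0).
by move=> s s1; exact: (is_deriveB (F_derive fc s1) (F_derive gc s1)).
Qed.

End Primitive.

Section Matrices.
Variables (R : realType) (m n : nat).

Lemma norm_coord (x : 'M[R]_(m, n)) i j : `|x i j| <= `|x|.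
Proof.
rewrite [leRHS]/Num.Def.normr /= mx_normrE.
exact: (le_bigmax _ (fun ij : 'I_m * 'I_n => `|x ij.1 ij.2|) (i, j)).
Qed.

Lemma norm_le_coord (x : 'M[R]_(m, n)) (e : R) : 0 <= e ->
  (forall i j, `|x i j| <= e) -> `|x| <= e.
Proof.
move=> e0 h; rewrite [leLHS]/Num.Def.normr /= mx_normrE.
by apply: bigmax_le => // -[i j] _; exact: h.
Qed.

Lemma is_derive_mx (V : normedModType R) (f : V -> 'M[R]_(m, n)) (df : 'M[R]_(m, n)) x v :
  (forall i j, is_derive x v (fun y => f y i j) (df i j)) -> is_derive x v f df.
Proof.
move=> h; have d : derivable f x v by apply/derivable_mxP => i j; case: (h i j).
split=> //; rewrite derive_mx //; apply/matrixP => i j; rewrite mxE.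
by case: (h i j).
Qed.

Lemma cont_mx (T : topologicalType) (f : T -> 'M[R]_(m, n)) x :
  (forall i j, {for x, continuous (fun y => f y i j)}) -> {for x, continuous f}.
Proof.
move=> h; apply/cvgrPdist_le => e e0.
have : \forall y \near x, forall ij : 'I_m * 'I_n, `|f x ij.1 ij.2 - f y ij.1 ij.2| <= e.
  by apply: filter_forall => -[i j]; move/cvgrPdist_le : (h i j); exact.
apply: filterS => y H; apply: norm_le_coord; first exact: ltW.
by move=> i j; have := H (i, j); rewrite !mxE.
Qed.

End Matrices.

(* u - e is nondecreasing and u + e nonincreasing, for e k = 2 K / 2 ^ k. *)
Lemma geometric_limit (R : realType) (u : nat -> R) (K : R) :
  0 <= K -> (forall k, `|u k.+1 - u k| <= K / 2 ^+ k) ->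
  exists l, forall k, `|l - u k| <= 2 * K / 2 ^+ k.
Proof.
move=> K0 h.
pose e k : R := 2 * K / 2 ^+ k.
have eS k : e k.+1 = K / 2 ^+ k.
  by rewrite /e exprS; field; rewrite expf_neq0.
have eD k : e k = e k.+1 + K / 2 ^+ k by rewrite eS /e; ring.
have e0 k : 0 <= e k by rewrite divr_ge0 ?mulr_ge0 // exprn_ge0.
have aS k : u k - e k <= u k.+1 - e k.+1.
  have := h k; rewrite ler_norml (eD k).
  by move: (K / _) => q /andP[h1 h2]; lra.
have bS k : u k.+1 + e k.+1 <= u k + e k.
  have := h k; rewrite ler_norml (eD k).
  by move: (K / _) => q /andP[h1 h2]; lra.
have a_mono k j : u k - e k <= u (j + k)%N - e (j + k)%N.
  by elim: j => //= j IH; apply: le_trans IH _; exact: aS.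
have b_mono k j : u (j + k)%N + e (j + k)%N <= u k + e k.
  by elim: j => //= j IH; apply: le_trans IH; exact: bS.
have ab k j : u k - e k <= u j + e j.
  apply: le_trans (a_mono k j) _; rewrite addnC; apply: le_trans (b_mono j k).
  by have := e0 (k + j)%N; move: (e _) (u _) => p q h1; lra.
pose A := [set u k - e k | k in setT].
have A0 : A !=set0 by exists (u 0%N - e 0%N), 0%N.
have Aub : has_ubound A by exists (u 0%N + e 0%N) => _ [k _ <-]; exact: ab.
exists (sup A) => k; rewrite -/(e k) ler_norml; apply/andP; split.
  have : u k - e k <= sup A by apply: ub_le_sup => //; exists k.
  by move: (sup A) (u k) (e k) => p q r h1; lra.
have : sup A <= u k + e k by apply: ge_sup => // _ [j _ <-]; exact: ab.
by move: (sup A) (u k) (e k) => p q r h1; lra.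
Qed.

Lemma lipschitz_cont (R : realType) (V W : normedModType R) (f : V -> W) (L : R) :
  0 <= L -> (forall a b, `|f a - f b| <= L * `|a - b|) -> continuous f.
Proof.
move=> L0 fL a; have L1 : 0 < L + 1 by rewrite ltr_wpDl.
apply/cvgrPdist_lt => e e0; near=> b.
apply: le_lt_trans (fL a b) _.
(* [L] may be 0, hence the division by [L + 1]. *)
apply: le_lt_trans (_ : (L + 1) * `|a - b| < _); first by rewrite ler_wpM2r // lerDl.
rewrite -ltr_pdivlMl // mulrC; near: b; apply/nbhs_normP.
exists (e / (L + 1)); first by rewrite /= divr_gt0.
by move=> b.
Unshelve. all: by end_near. Qed.

(** * Picard iteration for a globally Lipschitz field *)

Section Picard.
Variables (R : realType) (n : nat).
Notation E := 'rV[R]_n.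

Lemma picard_lipschitz (X : E -> E) (L : R) (x0 : E) : 0 <= L ->
  (forall a b, `|X a - X b| <= L * `|a - b|) ->
  exists2 d : R, 0 < d & exists2 c : R -> E, c 0 = x0 &
    forall t, `|t| < d -> is_derive t (1 : R) c (X (c t)).
Proof.
(* This radius gives [d * L <= 1/2], so that a Picard step halves uniform distances, and [d < 1], as
   required by [primitive]. *)
move=> L0 XL; pose d : R := (2 * (L + 1))^-1.
have L1 : 0 < L + 1 by rewrite ltr_wpDl.
have d0 : 0 < d by rewrite invr_gt0 mulr_gt0.
have d1 : d < 1 by rewrite invf_lt1 ?mulr_gt0 //; lra.
have dL : d * L <= 2^-1.
  by rewrite /d invfM -mulrA ler_piMr // mulrC ler_pdivrMr // mul1r; lra.
have Xc : continuous X := lipschitz_cont L0 XL.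
have Xi (c : R -> E) i : continuous c -> continuous (fun s => X (c s) 0 i).
  move=> cc t; apply: (@continuous_comp _ _ _ (X \o c) (fun N : E => N 0 i)).
    by apply: continuous_comp; [exact: cc|exact: Xc].
  exact: coord_continuous.
pose step (c : R -> E) t : E := x0 + \row_i primitive d (fun s => X (c s) 0 i) t.
have step_cont c : continuous c -> continuous (step c).
  move=> cc t; apply: cont_mx => i j.
  rewrite (_ : (fun y => _) = fun y => x0 i j + primitive d (fun s => X (c s) 0 j) y).
    apply: (@cvgD _ R^o); first exact: cvg_cst.
    by apply: primitive_cont => //; exact: Xi.
  by apply/funext => y; rewrite !mxE.
have step_dist c c' e : continuous c -> continuous c' ->
    (forall s, `|c s - c' s| <= e) -> forall t, `|step c t - step c' t| <= e / 2.
  move=> cc cc' h t; have e0 : 0 <= e by apply: le_trans (h 0).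
  apply: norm_le_coord => [|i j]; first by rewrite divr_ge0.
  rewrite !ord1 /step !mxE opprD addrACA subrr add0r.
  apply: le_trans (_ : d * (L * e) <= _); last first.
    by rewrite mulrA mulrC ler_wpM2l.
  apply: primitive_dist => //; try exact: Xi.
  move=> s; apply: le_trans (_ : `|X (c s) - X (c' s)| <= _).
    by apply: le_trans (norm_coord _ 0 j); rewrite !mxE.
  by apply: le_trans (XL _ _) _; rewrite ler_wpM2l.
pose c_ k := iter k step (fun=> x0).
have c_cont k : continuous (c_ k).
  by elim: k => [|k IH] /=; [move=> t; exact: cst_continuous|exact: step_cont].
pose K := `|X x0|.
have K0 : 0 <= K by exact: normr_ge0.
have c_succ k t : `|c_ k.+1 t - c_ k t| <= K / 2 ^+ k.
  elim: k t => [|k IH] t.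
    rewrite expr0 divr1 /= /step addrC addKr.
    apply: norm_le_coord => // i j; rewrite mxE.
    apply: le_trans (_ : d * K <= _); last by rewrite ler_piMl // ltW.
    apply: primitive_bound => //; first by apply: Xi => ?; exact: cst_continuous.
    by move=> s; exact: norm_coord.
  have -> : K / 2 ^+ k.+1 = K / 2 ^+ k / 2 by rewrite exprS invfM; ring.
  by apply: (step_dist (c_ k.+1) (c_ k)).
(* Each coordinate converges at each time, with an error bound independent of the time; this
   uniformity makes the limit continuous and lets it pass through [step]. *)
have c_lim t : exists l : E, forall k, `|l - c_ k t| <= 2 * K / 2 ^+ k.
  have /choice[l hl] : forall i, exists l, forall k, `|l - c_ k t 0 i| <= 2 * K / 2 ^+ k.
    move=> i; apply: geometric_limit => // k.
    by apply: le_trans (c_succ k t); apply: le_trans (norm_coord _ 0 i); rewrite !mxE.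
  exists (\row_i l i) => k; apply: norm_le_coord.
    by rewrite divr_ge0 ?mulr_ge0 // exprn_ge0.
  by move=> i j; rewrite ord1 !mxE; exact: hl.
have [c hc] := choice c_lim.
have small e : 0 < e -> exists k, 2 * K / 2 ^+ k <= e.
  move=> e0; exists (Num.bound (e^-1 * (2 * K))).
  rewrite ler_pdivrMr ?exprn_gt0 // -ler_pdivrMl //.
  exact/ltW/(upper_nthrootP (leqnn _)).
have cc : continuous c.
  move=> t; apply/cvgrPdist_le => e e0.
  have e3 : 0 < e / 3 by rewrite divr_gt0.
  have [k hk] := small _ e3; near=> s.
  have -> : c t - c s = (c t - c_ k t) + (c_ k t - c_ k s) - (c s - c_ k s).
    by rewrite addrA subrK opprB addrA subrK.
  apply: le_trans (ler_normB _ _) _.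
  have h1 := le_trans (hc t k) hk; have h2 := le_trans (hc s k) hk.
  have h3 : `|c_ k t - c_ k s| <= e / 3.
    by near: s; apply: cvgr_dist_le => //; exact: c_cont.
  have h4 := le_trans (ler_normD (c t - c_ k t) (c_ k t - c_ k s)) (lerD h1 h3).
  by apply: le_trans (lerD h4 h2) _; lra.
(* Both sides are compared with the iterate [c_ k.+1], which is [step] applied to [c_ k]. *)
have fixed t : c t = step c t.
  apply/eqP; rewrite -subr_eq0 -normr_le0; apply/ler_addgt0Pr => e e0.
  have e2 : 0 < e / 2 by rewrite divr_gt0.
  have [k hk] := small _ e2.
  have h1 := le_trans (hc t k.+1) (_ : _ <= 2 * K / 2 ^+ k).
  have h2 : `|step c t - step (c_ k) t| <= 2 * K / 2 ^+ k / 2.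
    by apply: step_dist => // s.
  have -> : c t - step c t = (c t - c_ k.+1 t) - (step c t - step (c_ k) t).
    by rewrite opprB addrA subrK.
  apply: le_trans (ler_normB _ _) _; rewrite add0r.
  have q0 : 0 <= 2 * K / 2 ^+ k by rewrite divr_ge0 ?mulr_ge0 // exprn_ge0.
  apply: le_trans (lerD (h1 _) h2) _; last by move: (2 * K / _) hk q0 => q *; lra.
  by rewrite ler_wpM2l ?mulr_ge0 // lef_pV2 ?posrE ?exprn_gt0 // ler_eXn2l // ltr1n.
exists d => //; exists c.
  by rewrite fixed /step; apply/rowP => i; rewrite !mxE primitive0 // addr0.
move=> t td; apply: is_derive_mx => i j; rewrite ord1.
have -> : (fun y => c y 0 j) = cst (x0 0 j) + primitive d (fun s => X (c s) 0 j).
  by apply/funext => s; rewrite fixed /step !mxE.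
have h := is_deriveD (is_derive_cst (x0 0 j) t 1)
  (primitive_derive d1 (Xi c j cc) td).
by rewrite add0r in h.
Unshelve. all: by end_near. Qed.

End Picard.

Section DiffLinear.
Variables (R : realType) (V W : normedModType R) (f : V -> W) (x : V).

Lemma d0 : 'd f x 0 = 0. Proof. exact: linear0. Qed.

Lemma dD u v : 'd f x (u + v) = 'd f x u + 'd f x v. Proof. exact: linearD. Qed.

Lemma dZ k u : 'd f x (k *: u) = k *: 'd f x u. Proof. exact: linearZ. Qed.

Lemma dsum n (u : 'I_n -> V) : 'd f x (\sum_i u i) = \sum_i 'd f x (u i).
Proof. exact: linear_sum. Qed.

End DiffLinear.

Lemma near_and_forall (R : realType) (V : normedModType R) n (x : V) (A : set V)
    (P : 'I_n -> V -> Prop) : open A -> A x ->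
  (forall i, \forall y \near x, P i y) ->
  \forall y \near x, A y /\ forall i, P i y.
Proof.
move=> oA Ax h; apply: filterI; first exact: open_nbhs_nbhs.
exact: filter_forall.
Qed.

Lemma near_norm_le (R : realType) (V W : normedModType R) (F : V -> W) x :
  {for x, continuous F} -> \forall y \near x, `|F y| <= `|F x| + 1.
Proof.
move=> Fc; near=> y; rewrite -lerBlDl; apply: le_trans (lerB_dist _ _) _.
by near: y; have /cvgr_distC_le := Fc; exact.
Unshelve. all: by end_near. Qed.

(** * Local flow of a smooth vector field *)

Section LocalFlow.
Variables (R : realType) (n : nat).
Notation E := 'rV[R]_n.

(** The finitely many partial derivatives at [x0] are continuous, so near [x0] each is bounded by
    its norm there plus 1, and [L] is the sum of these bounds. The mean value inequality is then
    applied coordinatewise along segments, which stay in the ball. *)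
Lemma smooth_locally_lipschitz (A : set E) (X : E -> E) (x0 : E) :
  open A -> A x0 -> smooth_on A X ->
  exists2 r : R, 0 < r & exists2 L : R, 0 <= L &
    forall a b, `|a - x0| < r -> `|b - x0| < r ->
      A a /\ `|X a - X b| <= L * `|a - b|.
Proof.
move=> oA Ax0 sX.
pose e (i : 'I_n) : E := delta_mx 0 i.
pose L : R := \sum_i (`|'d X x0 (e i)| + 1).
have L0 : 0 <= L by apply: sumr_ge0 => i _; rewrite addr_ge0.
have : \forall y \near x0, A y /\ forall i, `|'d X y (e i)| <= `|'d X x0 (e i)| + 1.
  apply: near_and_forall => // i.
  exact: near_norm_le (smooth_cont (smooth_d (e i) sX) Ax0).
move=> /nbhs_normP[r /= r0 rP]; exists r => //; exists L => //.
have {}rP y : `|y - x0| < r -> A y /\ forall i, `|'d X y (e i)| <= `|'d X x0 (e i)| + 1.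
  by rewrite distrC => /rP.
have dL y v : `|y - x0| < r -> `|'d X y v| <= L * `|v|.
  move=> /rP[_ h]; rewrite {1}(row_sum_delta v) dsum mulr_suml.
  apply: le_trans (ler_norm_sum _ _ _) _; apply: ler_sum => i _.
  have -> : `|'d X y (v 0 i *: e i)| = `|'d X y (e i)| * `|v 0 i|.
    by rewrite dZ normrZ mulrC.
  apply: ler_pM.
  - exact: normr_ge0.
  - exact: normr_ge0.
  - exact: h.
  - exact: norm_coord.
move=> a b ar br; split; first by have [] := rP _ ar.
apply: norm_le_coord => [|i j]; first by rewrite mulr_ge0.
rewrite (ord1 i) !mxE.
pose f (s : R) : R := X (b + s *: (a - b)) 0 j.
have -> : X a 0 j - X b 0 j = f 1 - f 0.
  by rewrite /f scale1r scale0r addr0 [b + _]addrC subrK.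
apply: le_trans (_ : L * `|a - b| * `|1 - 0| <= _); last by rewrite subr0 normr1 mulr1.
apply: (@is_derive_lipschitz R f (fun s => 'd X (b + s *: (a - b)) (a - b) 0 j)).
move=> s; rewrite min_l ?ler01 // max_r ?ler01 // => /andP[s0 s1].
have sr : `|b + s *: (a - b) - x0| < r.
  have -> : b + s *: (a - b) - x0 = s *: (a - x0) + (1 - s) *: (b - x0).
    by rewrite scalerBl scale1r addrCA -scalerBr opprB addrA subrK addrAC.
  apply: le_lt_trans (ler_normD _ _) _; rewrite !normrZ (ger0_norm s0).
  rewrite ger0_norm ?subr_ge0 //.
  have h1 : s * `|a - x0| <= s * Num.max `|a - x0| `|b - x0|.
    by rewrite ler_wpM2l // le_max lexx.
  have h2 : (1 - s) * `|b - x0| <= (1 - s) * Num.max `|a - x0| `|b - x0|.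
    by rewrite ler_wpM2l ?subr_ge0 // le_max lexx orbT.
  have h3 : Num.max `|a - x0| `|b - x0| < r by rewrite gt_max ar.
  by apply: le_lt_trans (lerD h1 h2) _; rewrite -mulrDl addrC subrK mul1r.
split; last by apply: le_trans (norm_coord _ 0 j) _; exact: dL.
pose cj (N : E) : R^o := N 0 j.
have lj : linear cj by move=> k u v; rewrite /cj !mxE.
have dj N : is_diff N cj cj by apply: is_diff_lin => //; exact: coord_continuous.
have dX := is_diffP (smooth_diff sX (rP _ sr).1).
have h := is_diff_derive (1 : R^o) (is_diff_compf (is_diff_compf (is_diff_line b (a - b) s) erefl dX) erefl (dj _)).
by rewrite scale1r in h.
Qed.

Lemma local_flow (A : set E) (X : E -> E) (x0 : E) :
  open A -> A x0 -> smooth_on A X ->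
  exists2 d : R, 0 < d & exists c : R^o -> E,
    [/\ c 0 = x0, forall t : R, `|t| < d -> A (c t),
      forall t : R, `|t| < d -> is_diff (t : R^o) c (fun v => (v : R) *: X (c t)) &
      smooth_on [set t : R^o | `|t| < d] c].
Proof.
move=> oA Ax0 sX.
have [r r0 [L L0 XL]] := smooth_locally_lipschitz oA Ax0 sX.
have r20 : 0 < r / 2 by rewrite divr_gt0.
(* X is precomposed with a 1-Lipschitz projection onto a small cube, which makes
   it globally Lipschitz. *)
pose P (a : E) : E := x0 + \row_i clamp (r / 2) ((a - x0) 0 i).
have Pr a : `|P a - x0| < r.
  apply: (@le_lt_trans _ _ (r / 2)); last by rewrite ltr_pdivrMr // mulr_natr mulr2n ltrDr.
  apply: norm_le_coord => [|i j]; first exact: ltW.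
  by rewrite /P addrC addKr mxE; apply: clamp_bound; exact: ltW.
have PL a b : `|P a - P b| <= `|a - b|.
  apply: norm_le_coord => // i j; rewrite ord1 /P opprD addrACA subrr add0r !mxE.
  apply: le_trans (clamp_lip _ _ _) _; rewrite opprB addrA subrK.
  by apply: le_trans (norm_coord _ 0 j); rewrite !mxE.
have Pid a : `|a - x0| <= r / 2 -> P a = a.
  move=> h; apply/rowP => i; rewrite !mxE clamp_id; first by rewrite addrC subrK.
  by apply: le_trans h; apply: le_trans (norm_coord _ 0 i); rewrite !mxE.
have [|d1 d10 [c c0 dc]] := @picard_lipschitz R n (X \o P) L x0 L0.
  move=> a b; apply: le_trans (XL _ _ (Pr a) (Pr b)).2 _.
  by rewrite ler_wpM2l.
have cc : {for 0, continuous c}.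
  by apply/differentiable_continuous/derivable1_diffP; case: (dc 0); rewrite // normr0.
(* As long as the curve is within [r / 2] of [x0] the projection [P] is the identity there, so the
   curve solves the equation of [X] itself. *)
have : \forall t \near (0 : R), `|t| < d1 /\ `|c t - x0| <= r / 2.
  apply: filterI; first by apply/nbhs_normP; exists d1; [exact: d10|move=> t /=; rewrite sub0r normrN].
  by rewrite -c0; move/cvgr_distC_le : cc => /(_ _ r20).
move=> /nbhs_normP[d /= d0 dP]; exists d => //.
have {}dP t : `|t| < d -> `|t| < d1 /\ `|c t - x0| <= r / 2.
  by move=> td; apply: dP; rewrite /= sub0r normrN.
have cA t : `|t| < d -> A (c t).
  move=> /dP[_ h]; apply: (XL _ x0 _ _).1; last by rewrite subrr normr0.
  by apply: le_lt_trans h _; rewrite ltr_pdivrMr // mulr_natr mulr2n ltrDr.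
have cd (t : R) : `|t| < d -> is_diff (t : R^o) c (fun v => (v : R) *: X (c t)).
  move=> /dP[td1 h]; have [der E] := dc t td1.
  split; first by apply/derivable1_diffP.
  by rewrite deriv1E //; apply/funext => v; rewrite derive1E E /= Pid.
exists c; split=> //.
have oI : open [set t : R^o | `|t| < d].
  rewrite (_ : mkset _ = ball (0 : R^o) d); first exact: ball_open.
  by apply/seteqP; split=> t; rewrite -ball_normE /= sub0r normrN.
(* Bootstrapping: the derivative of [c] is [X] along [c], which is of class C^k as soon as [c]
   is. *)
elim=> [|k IH]; first by move=> t /cd[/differentiable_continuous].
split=> [t /cd[]//|v].
apply: (Ck_eq (f := fun t => (v : R) *: X (c t)) oI).
  by move=> t /cd h; exact: esym (is_diff_app v h).
apply: (Ck_scale (a := fun=> v)) => //; first exact: Ck_cst.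
exact: (Ck_comp (findim_mx R 1 n) oI oA cA IH (sX k)).
Qed.

End LocalFlow.

(** * The bracket and the Maurer-Cartan equation *)

Section FiniteDimLinear.
Variables (R : realType) (V W : normedModType R).

Lemma findim_linear_cont (f : V -> W) : findim V -> linear f -> continuous f.
Proof.
move=> [n [e [l [lP le]]]] fl x.
pose F (y : V) : W := \sum_i (l i y : R) *: f (e i).
have fE y : f y = F y.
  pose M := GRing.isLinear.Build _ _ _ _ _ fl.
  pose f' : {linear V -> W} := HB.pack f M.
  rewrite {1}(le y) -[f]/(f' : _ -> _) linear_sum.
  by apply: eq_bigr => i _; rewrite linearZ.
have -> : f = F by apply/funext.
apply: differentiable_continuous.
have h : is_diff x F (fun u => \sum_i (l i u : R) *: f (e i)); last by case: h.
apply: is_diff_sum => i; have [ll lc] := lP i.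
have := is_diff_scale (is_diff_lin x ll lc) (is_diff_cst (f (e i)) x).
by move=> /is_diff_ext; apply=> u //=; rewrite scaler0 add0r.
Qed.

Lemma is_diff_inl (a : V) (b : W) : is_diff a (fun x => (x, b)) (fun u => (u, 0)).
Proof. exact: is_diff_pair (is_diff_id a) (is_diff_cst b a). Qed.

Lemma is_diff_inr (a : V) (b : W) : is_diff b (fun x => (a, x)) (fun u => (0, u)).
Proof. exact: is_diff_pair (is_diff_cst a b) (is_diff_id b). Qed.

Lemma is_diff_diag (a : V) : is_diff a (fun x => (x, x)) (fun u => (u, u)).
Proof. exact: is_diff_pair (is_diff_id a) (is_diff_id a). Qed.

Lemma is_diff_d2 (U : normedModType R) (A : set V) (f : V -> W) (h dh : U -> V) x z v :
  smooth_on A f -> A z -> is_diff x h dh -> h x = z ->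
  is_diff x (fun y => 'd f (h y) v) (fun u => d2 f z v (dh u)).
Proof.
move=> sf Az dhx hx.
exact: is_diff_compf dhx hx (is_diffP (smooth_diff (smooth_d v sf) Az)).
Qed.

Lemma near_comp (x : V) (h : V -> W) (A : set W) : {for x, continuous h} ->
  open A -> A (h x) -> \forall y \near x, A (h y).
Proof. by move=> hc oA Ahx; apply: hc; exact: open_nbhs_nbhs. Qed.

End FiniteDimLinear.

Section Projections.
Variables (R : realType) (V W : normedModType R) (M : charted V) (N : charted W).
Hypotheses (mM : smooth_manifold M) (mN : smooth_manifold N).

Lemma smooth_at_fst (p : prodM M N) : smooth_at p p.1 (fst : prodM M N -> M) p.
Proof.
have oI := image_setX (open_image mM p.1) (open_image mN p.2).
exists ((chart_at p.1 @` source (chart_at p.1)) `*` (chart_at p.2 @` source (chart_at p.2))).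
split=> //.
- by split; [exists p.1|exists p.2] => //; exact: source_chart_at.
- by move=> [_ _] [[a sa /= <-] [b sb /= <-]]; exists (a, b).
- by move=> [y1 y2] [[a sa /= <-] _]; rewrite /= (chartK mM sa).
- apply: smooth_eq (@smooth_fst _ _ _ _) => //.
  by move=> [y1 y2] [[a sa /= <-] _]; rewrite /rep /= (chartK mM sa).
Qed.

Lemma smooth_at_snd (p : prodM M N) : smooth_at p p.2 (snd : prodM M N -> N) p.
Proof.
have oI := image_setX (open_image mM p.1) (open_image mN p.2).
exists ((chart_at p.1 @` source (chart_at p.1)) `*` (chart_at p.2 @` source (chart_at p.2))).
split=> //.
- by split; [exists p.1|exists p.2] => //; exact: source_chart_at.
- by move=> [_ _] [[a sa /= <-] [b sb /= <-]]; exists (a, b).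
- by move=> [y1 y2] [_ [a sa /= <-]]; rewrite /= (chartK mN sa).
- apply: smooth_eq (@smooth_snd _ _ _ _) => //.
  by move=> [y1 y2] [_ [a sa /= <-]]; rewrite /rep /= (chartK mN sa).
Qed.

End Projections.

Section Bracket.
Variables (R : realType) (n : nat) (G : lieGroup R n).
Notation M := (mfd G).
Notation g := 'rV[R]_n.
Notation one := (1%g : M).
Let e : g := chart_at one one.
Let mM : smooth_manifold M := mfdP G.
Let fV : findim g := findim_mx R 1 n.
Let mMM : smooth_manifold (prodM M M) := smooth_manifold_prod mM mM fV fV.

Definition mulc (z : g * g) : g :=
  chart_at one (of_model (chart_at one) z.1 * of_model (chart_at one) z.2)%g.

(** Division carries a neighbourhood of [(x, x)] into the chart around the identity. Right
    trivialization at all points near [x] is thereby read off a single smooth map between fixed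
    charts. *)
Definition quo (x : M) (z : g * g) : g :=
  chart_at one (of_model (chart_at x) z.1 * (of_model (chart_at x) z.2)^-1)%g.

Lemma mulc_smooth : exists U : set (g * g), [/\ open U, U (e, e),
  forall z, U z -> source (chart_at one) (of_model (chart_at one) z.1 * of_model (chart_at one) z.2)%g,
  forall z, U z -> (chart_at one @` source (chart_at one)) z.1 /\
    (chart_at one @` source (chart_at one)) z.2
  & smooth_on U mulc].
Proof.
have [|||U [h1 h2 h3 h4 h5]] := @smooth_at_mul R n G one one one (one, one).
- exact: src1.
- exact: src1.
- by rewrite /= mulg1; exact: src1.
exists U; split=> // z /h3[[p q] [/= s1 s2] <-] /=.
by split; [exists p|exists q].
Qed.

Lemma quo_smooth (x : M) : let q := chart_at x x in
  exists U : set (g * g), [/\ open U, U (q, q),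
  forall z, U z -> source (chart_at one) (of_model (chart_at x) z.1 * (of_model (chart_at x) z.2)^-1)%g,
  forall z, U z -> (chart_at x @` source (chart_at x)) z.1 /\
    (chart_at x @` source (chart_at x)) z.2
  & smooth_on U (quo x)].
Proof.
move=> q; have sx : source (chart_at x) x by exact: source_chart_at.
have sxx : source (chart_at ((x, x) : prodM M M)) ((x, x) : prodM M M) by split.
have s2 := smooth_at_snd mM mM (x, x).
have s1 := smooth_at_fst mM mM (x, x).
have s3 : @smooth_at _ _ _ (prodM M M) M (x, x) (x^-1)%g (fun p => p.2^-1)%g (x, x).
  by apply: (smooth_atV mMM sxx s2); exact: source_chart_at.
have [|U [h1 h2 h3 h4 h5]] := smooth_atM mMM (c := one) sxx s1 s3.
  by rewrite /= mulgV; exact: src1.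
exists U; split=> // z /h3[[a b] [/= sa sb] <-] /=.
by split; [exists a|exists b].
Qed.

Lemma near_image (x : M) : \forall a \near chart_at x x,
  (chart_at x @` source (chart_at x)) a.
Proof. by apply: near_source => //; exact: source_chart_at. Qed.

Lemma ofe : of_model (chart_at one) e = one.
Proof. by rewrite (chartK mM) //; exact: src1. Qed.

Lemma ofq (x : M) : of_model (chart_at x) (chart_at x x) = x.
Proof. by rewrite (chartK mM) //; exact: source_chart_at. Qed.

Lemma mulc_e1 a : (chart_at one @` source (chart_at one)) a -> mulc (a, e) = a.
Proof. by move=> ha; rewrite /mulc /= ofe mulg1 (of_modelK mM). Qed.

Lemma mulc_1e a : (chart_at one @` source (chart_at one)) a -> mulc (e, a) = a.
Proof. by move=> ha; rewrite /mulc /= ofe mul1g (of_modelK mM). Qed.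

Lemma quo_diag (x : M) a : quo x (a, a) = e.
Proof. by rewrite /quo /= mulgV. Qed.

Lemma quo_e a : (chart_at one @` source (chart_at one)) a -> quo one (a, e) = a.
Proof. by move=> ha; rewrite /quo /= ofe invg1 mulg1 (of_modelK mM). Qed.

(* In the chart around x, the right trivialization v |-> T R_{h^-1} v at the
   point h of coordinate q. *)
Definition rtriv (x : M) (q : g) (v : g) : g := 'd (quo x) (q, q) (v, 0).

Lemma quo_smooth_diff (x : M) : differentiable (quo x) (chart_at x x, chart_at x x).
Proof. by have [U [_ Uq _ _ sU]] := quo_smooth x; exact: smooth_diff sU Uq. Qed.

(** [quo x] is constant on the diagonal, hence its two partial differentials there are opposite. *)
Lemma d_quo_snd (x : M) u (q := chart_at x x) :
  'd (quo x) (q, q) (0, u) = - rtriv x q u.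
Proof.
have h : is_diff q (fun a => quo x (a, a)) (fun u => 'd (quo x) (q, q) (u, u)).
  exact: is_diff_compf (is_diff_diag q) erefl (is_diffP (quo_smooth_diff x)).
have h0 : is_diff q (fun a => quo x (a, a)) (fun u => 0).
  apply: is_diff_ext (is_diff_cst e q) _ _ => // a.
  by rewrite quo_diag.
have E : 'd (quo x) (q, q) (u, u) = 0.
  exact: etrans (esym (is_diff_app u h)) (is_diff_app u h0).
apply/eqP; rewrite -addr_eq0 /rtriv -dD; apply/eqP.
by rewrite (_ : (0, u) + (u, 0) = (u, u)) //; congr (_, _); rewrite /= ?addr0 ?add0r.
Qed.

Lemma rtriv1 v : rtriv one e v = v.
Proof.
have h : is_diff e (fun a => quo one (a, e)) (fun u => 'd (quo one) (e, e) (u, 0)).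
  exact: is_diff_compf (is_diff_inl e e) erefl (is_diffP (quo_smooth_diff one)).
apply: etrans (esym (is_diff_app v h)) _; apply: (is_diff_app (df := id)).
by apply: is_diff_near _ (is_diff_id e); apply: filterS (near_image one) => a /quo_e.
Qed.

(* The bilinear part of the multiplication in the chart around the identity;
   the bracket is its antisymmetrization. *)
Definition beta (u v : g) : g := d2 mulc (e, e) (u, 0) (0, v).

Definition br (u v : g) : g := beta u v - beta v u.

Lemma beta_sym u v : d2 mulc (e, e) (0, v) (u, 0) = beta u v.
Proof.
have [U [oU Ue _ _ sU]] := mulc_smooth.
exact: (d2_sym _ _ fV oU Ue sU).
Qed.

Lemma brN u v : br u v = - br v u.
Proof. by rewrite /br opprB. Qed.

Lemma beta_linr u : linear (beta u).
Proof.
move=> k a b; rewrite /beta.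
have -> : (0, k *: a + b) = k *: (0 : g, a) + (0 : g, b).
  by congr (_, _); rewrite /= scaler0 addr0.
by rewrite d2Dr d2Zr.
Qed.

(** [d2] is linear in its last direction by construction; the first argument of [beta] is brought to
    that place by the symmetry [beta_sym]. *)
Lemma beta_linl v : linear (beta ^~ v).
Proof.
move=> k a b; rewrite -!beta_sym.
have -> : (k *: a + b, 0) = k *: (a, 0 : g) + (b, 0 : g).
  by congr (_, _); rewrite /= scaler0 addr0.
by rewrite d2Dr d2Zr.
Qed.

Lemma br_linr u : linear (br u).
Proof.
move=> k a b; rewrite /br.
have -> : beta u (k *: a + b) = k *: beta u a + beta u b := beta_linr u k a b.
have -> : beta (k *: a + b) u = k *: beta a u + beta b u := beta_linl u k a b.
by rewrite opprD addrACA scalerBr.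
Qed.

Lemma br_linl v : linear (br ^~ v).
Proof.
move=> k a b; rewrite /= (brN _ v) (brN a) (brN b).
have -> : br v (k *: a + b) = k *: br v a + br v b := br_linr v k a b.
by rewrite opprD scalerN.
Qed.

(* Right invariance: quo x (a, b) = mulc (quo x (a, q), quo x (q, b)). *)
Lemma d2_quo_mixed (x : M) u v (q := chart_at x x) :
  d2 (quo x) (q, q) (v, 0) (0, u) = - beta (rtriv x q v) (rtriv x q u).
Proof.
have [U [oU Uq Us Ui sU]] := quo_smooth x.
have [A [oA Ae As Ai sA]] := mulc_smooth.
have dquo := is_diff_compf (is_diff_inr q q) erefl (is_diffP (smooth_diff sU Uq)).
have nearU : \forall b \near q, U (q, b).
  apply: (near_comp _ oU Uq); apply: differentiable_continuous.
  by case: (is_diff_inr q q).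
have nearA : \forall b \near q, A (e, quo x (q, b)).
  apply: (near_comp (h := fun b => (e, quo x (q, b))) _ oA); last by rewrite quo_diag.
  apply: differentiable_continuous.
  by case: (is_diff_pair (is_diff_cst e q) dquo).
have key : \forall b \near q,
    'd mulc (e, quo x (q, b)) (rtriv x q v, 0) = 'd (quo x) (q, b) (v, 0).
  near=> b.
  have Ub : U (q, b) by near: b.
  have Ab : A (e, quo x (q, b)) by near: b.
  have h1 : is_diff q (fun a => quo x (a, b)) (fun u => 'd (quo x) (q, b) (u, 0)).
    exact: is_diff_compf (is_diff_inl q b) erefl (is_diffP (smooth_diff sU Ub)).
  have h2 : is_diff q (fun a => quo x (a, q)) (rtriv x q).
    exact: is_diff_compf (is_diff_inl q q) erefl (is_diffP (smooth_diff sU Uq)).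
  have h3 : is_diff q (fun a => mulc (quo x (a, q), quo x (q, b)))
      (fun u => 'd mulc (e, quo x (q, b)) (rtriv x q u, 0)).
    apply: is_diff_compf (is_diff_pair h2 (is_diff_cst (quo x (q, b)) q)) _
      (is_diffP (smooth_diff sA Ab)).
    by rewrite quo_diag.
  apply: etrans (esym (is_diff_app v h3)) _; apply: etrans _ (is_diff_app v h1).
  apply: is_diff_app; apply: is_diff_near _ (is_diffP _); last by case: h1.
  have : \forall a \near q, U (a, q).
    apply: (near_comp _ oU Uq); apply: differentiable_continuous.
    by case: (is_diff_inl q q).
  apply: filterS => a Ua; rewrite /mulc /=.
  rewrite {2}/quo (chartK mM (Us _ Ua)) {2}/quo (chartK mM (Us _ Ub)) /= !ofq.
  by rewrite /quo /= mulgA mulgVK.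
rewrite /d2.
have h : is_diff q (fun b => 'd (quo x) (q, b) (v, 0)) (fun u => d2 (quo x) (q, q) (v, 0) (0, u)).
  exact: is_diff_d2 sU Uq (is_diff_inr q q) erefl.
have h' : is_diff q (fun b => 'd mulc (e, quo x (q, b)) (rtriv x q v, 0))
   (fun u => d2 mulc (e, e) (rtriv x q v, 0) (0, - rtriv x q u)).
  have hq : is_diff q (fun b => quo x (q, b)) (fun u => - rtriv x q u).
    apply: is_diff_ext dquo _ _ => //.
    by move=> w; rewrite d_quo_snd.
  have hp := is_diff_pair (is_diff_cst e q) hq.
  by apply: is_diff_d2 sA Ae hp _; rewrite quo_diag.
apply: etrans (esym (is_diff_app u h)) _.
apply: etrans (is_diff_app u (is_diff_near key h')) _.
have -> : (0, - rtriv x q u) = (-1) *: (0 : g, rtriv x q u).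
  by congr (_, _); rewrite /= ?scaler0 // scaleN1r.
by rewrite d2Zr scaleN1r.
Unshelve. all: by end_near. Qed.

Lemma is_diff_rtriv (x : M) v (q := chart_at x x) :
  is_diff q (fun b => rtriv x b v) (fun u => d2 (quo x) (q, q) (v, 0) (u, u)).
Proof.
have [U [oU Uq Us Ui sU]] := quo_smooth x.
exact: is_diff_d2 sU Uq (is_diff_diag q) erefl.
Qed.

Lemma d2_quo_diag (x : M) v u (q := chart_at x x) :
  d2 (quo x) (q, q) (v, 0) (u, u) =
  d2 (quo x) (q, q) (v, 0) (u, 0) - beta (rtriv x q v) (rtriv x q u).
Proof.
rewrite -d2_quo_mixed -d2Dr; congr d2.
by congr (_, _); rewrite /= ?addr0 ?add0r.
Qed.

(** By [d2_quo_diag] each derivative is a pure second derivative of [quo x] in its first variable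
    minus a value of [beta]. The pure parts are symmetric and cancel, leaving the antisymmetrization
    of [beta]. *)
Lemma maurer_cartan (x : M) u v (q := chart_at x x) :
  'd (fun b => rtriv x b v) q u - 'd (fun b => rtriv x b u) q v =
  br (rtriv x q u) (rtriv x q v).
Proof.
have [U [oU Uq Us Ui sU]] := quo_smooth x.
have dE w z : 'd (fun b => rtriv x b w) q z =
    d2 (quo x) (q, q) (w, 0) (z, 0) - beta (rtriv x q w) (rtriv x q z).
  exact: etrans (is_diff_app z (is_diff_rtriv x w)) (d2_quo_diag x w z).
have sym := d2_sym (u, 0) (v, 0) fV oU Uq sU.
have E2 := etrans (dE u v) (congr1 (fun z => z - beta (rtriv x q u) (rtriv x q v)) sym).
have alg (a b c : g) : (a - b) - (a - c) = c - b.
  by rewrite opprB addrC addrA subrK.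
exact: etrans (congr2 (fun a b : g => a - b) (dE v u) E2) (alg _ _ _).
Qed.

End Bracket.

(** * Derivative of the adjoint action and the Jacobi identity *)

Section AdjointAction.
Variables (R : realType) (n : nat) (G : lieGroup R n).
Notation M := (mfd G).
Notation g := 'rV[R]_n.
Notation one := (1%g : M).
Let e : g := chart_at one one.
Let mM : smooth_manifold M := mfdP G.
Let fV : findim g := findim_mx R 1 n.
Let s1 : source (chart_at one) one := @src1 R n G.

Definition conjm (x h : M) : M := (x * h * x^-1)%g.

Lemma smooth_at_conj (x p : M) (a c : M) :
  source (chart_at a) p -> source (chart_at c) (conjm x p) ->
  smooth_at a c (conjm x) p.
Proof.
move=> ap cp.
have sx : smooth_at a x (fun=> x) p by apply: smooth_at_cst => //; exact: source_chart_at.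
have si : smooth_at a a (fun q => q) p by exact: smooth_at_id.
have sxp : smooth_at a ((x * p)%g : M) (fun q => x * q)%g p.
  by apply: (smooth_atM mM ap sx si); exact: (source_chart_at mM).
have sxi : smooth_at a ((x^-1)%g : M) (fun=> (x^-1)%g) p.
  by apply: smooth_at_cst => //; exact: source_chart_at.
exact: (smooth_atM mM ap sxp sxi).
Qed.

Lemma conj1 (x : M) : conjm x one = one.
Proof. by rewrite /conjm mulg1 mulgV. Qed.

Lemma smooth_at_conj1 (x : M) : smooth_at one one (conjm x) one.
Proof. by apply: smooth_at_conj; rewrite ?conj1. Qed.

Lemma AdE (x : M) v : Ad x v = D one one (conjm x) one v.
Proof.
have -> : Ad x v = D one (conjm x one) (conjm x) one v by [].
by rewrite conj1.
Qed.

Lemma AdM (x y : M) v : @Ad R n G (x * y)%g v = @Ad R n G x (@Ad R n G y v).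
Proof.
rewrite !AdE; have sx := smooth_at_conj1 x; have sy := smooth_at_conj1 y.
have sx' : smooth_at one one (conjm x) (conjm y one) by rewrite conj1.
have E := D_comp mM mM v s1 sy sx'.
rewrite conj1 in E; apply: etrans _ E.
congr (D one one _ one v); apply/funext => h.
by rewrite /conjm /= invgM !mulgA.
Qed.

Lemma Ad_linear (x : M) : linear (@Ad R n G x).
Proof.
move=> k u v.
have := AdE x (k *: u + v); rewrite (AdE x u) (AdE x v) => ->.
by rewrite /D dD dZ.
Qed.

Lemma is_diff_mulc_inr (v : g) : 'd (@mulc R n G) (e, e) (0, v) = v.
Proof.
have [A [oA Ae As Ai sA]] := mulc_smooth G.
have h : is_diff e (fun a => mulc G (e, a)) (fun u => 'd (mulc G) (e, e) (0, u)).
  exact: is_diff_compf (is_diff_inr e e) erefl (is_diffP (smooth_diff sA Ae)).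
apply: etrans (esym (is_diff_app v h)) _; apply: (is_diff_app (df := id)).
apply: is_diff_near _ (is_diff_id e).
by apply: filterS (near_image one) => a /mulc_1e.
Qed.

Definition Adc (b v : g) : g := @Ad R n G (of_model (chart_at one) b) v.

(* k h k^-1 = quo one (k h, k) *)
Lemma near_Adc v : \forall b \near e,
  rtriv (one : M) b ('d (mulc G) (b, e) (0, v)) = Adc b v.
Proof.
have [U [oU Uq Us Ui sU]] := quo_smooth (one : M).
have [A [oA Ae As Ai sA]] := mulc_smooth G.
have nA : \forall b \near e, A (b, e).
  apply: (near_comp _ oA Ae); apply: differentiable_continuous.
  by case: (is_diff_inl e e).
have nU : \forall b \near e, U (b, b).
  apply: (near_comp _ oU Uq); apply: differentiable_continuous.
  by case: (is_diff_diag e).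
have nI := near_image (one : M).
near=> b.
have Ab : A (b, e) by near: b.
have Ub : U (b, b) by near: b.
have Ib : (chart_at one @` source (chart_at one)) b by near: b.
have dm : is_diff e (fun a => mulc G (b, a)) (fun u => 'd (mulc G) (b, e) (0, u)).
  exact: is_diff_compf (is_diff_inr b e) erefl (is_diffP (smooth_diff sA Ab)).
have h : is_diff e (fun a => quo one (mulc G (b, a), b))
    (fun u => rtriv one b ('d (mulc G) (b, e) (0, u))).
  apply: is_diff_compf (is_diff_pair dm (is_diff_cst b e)) _
    (is_diffP (smooth_diff sU Ub)).
  by rewrite mulc_e1.
rewrite /Adc AdE /D.
apply: esym; apply: etrans _ (is_diff_app v h).
have [dh _] := h.
apply: is_diff_app; apply: is_diff_near _ (is_diffP dh).
have : \forall a \near e, A (b, a).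
  apply: (near_comp _ oA Ab); apply: differentiable_continuous.
  by case: (is_diff_inr b e).
apply: filterS => a Aa; rewrite /rep /quo /conjm /=.
by rewrite /mulc (chartK mM (As _ Aa)).
Unshelve. all: by end_near. Qed.

(** By [near_Adc] this map is [rtriv one b] evaluated at ['d mulc (b, e) (0, v)]. In the product
    rule the variation of the argument gives [beta u v] and that of [rtriv] gives [- beta v u]. *)
Lemma is_diff_Adc v : is_diff e (fun b => Adc b v) (fun u => br G u v).
Proof.
have [U [oU Uq Us Ui sU]] := quo_smooth (one : M).
have [A [oA Ae As Ai sA]] := mulc_smooth G.
apply: is_diff_near (near_Adc v) _.
have dy : is_diff e (fun b => 'd (mulc G) (b, e) (0, v))
   (fun u => d2 (mulc G) (e, e) (0, v) (u, 0)).
  exact: is_diff_d2 sA Ae (is_diff_inl e e) erefl.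
have h := is_diff_applin (L := rtriv (one : M)) fV _ _ dy.
apply: is_diff_ext (h _ _) _ _ => //.
- by move=> w; case: (is_diff_rtriv (one : M) w).
- move=> z k a b; rewrite /rtriv.
  have -> : (k *: a + b, 0) = k *: (a, 0 : g) + (b, 0 : g).
    by congr (_, _); rewrite /= scaler0 addr0.
  by rewrite dD dZ.
move=> u /=.
(* [quo one (a, e)] equals [a] near the identity, so its second derivative vanishes and only the
   mixed term of [d2_quo_diag] remains. *)
have E00 : d2 (quo (one : M)) (e, e) (v, 0) (u, 0) = 0.
  have h1 : is_diff e (fun b => 'd (quo (one : M)) (b, e) (v, 0))
     (fun u => d2 (quo (one : M)) (e, e) (v, 0) (u, 0)).
    exact: is_diff_d2 sU Uq (is_diff_inl e e) erefl.
  apply: etrans (esym (is_diff_app u h1)) _.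
  apply: (is_diff_app (df := fun=> 0)).
  apply: is_diff_near _ (is_diff_cst v e).
  have nU : \forall b \near e, U (b, e).
    apply: (near_comp _ oU Uq); apply: differentiable_continuous.
    by case: (is_diff_inl e e).
  (* To differentiate the equality [quo one (a, e) = a] at [b], it must hold on a neighbourhood of
     each [b] close to [e]. *)
  have nU2 : \forall b \near e, nbhs b [set a | (chart_at one @` source (chart_at one)) a].
    by apply: open_nbhs_nbhs; split; [apply: open_interior|]; exact: near_image.
  near=> b.
  have Ub : U (b, e) by near: b.
  have h2 : is_diff b (fun a => quo (one : M) (a, e)) (fun u => 'd (quo (one : M)) (b, e) (u, 0)).
    exact: is_diff_compf (is_diff_inl b e) erefl (is_diffP (smooth_diff sU Ub)).
  apply: esym; apply: etrans (esym (is_diff_app v h2)) _.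
  apply: (is_diff_app (df := id)); apply: is_diff_near _ (is_diff_id b).
  have : nbhs b [set a | (chart_at one @` source (chart_at one)) a] by near: b.
  by apply: filterS => a /quo_e.
have E1 : 'd (fun b => rtriv (one : M) b v) e u = - beta G v u.
  apply: etrans (is_diff_app u (is_diff_rtriv (one : M) v)) _.
  apply: etrans (d2_quo_diag (one : M) v u) _.
  exact: etrans (congr2 (fun a b : g => a - b) E00
    (congr2 (beta G) (rtriv1 G v) (rtriv1 G u))) (sub0r _).
have E0 : 'd (mulc G) (e, e) (0, v) = v := is_diff_mulc_inr v.
have E2 : rtriv (one : M) e (d2 (mulc G) (e, e) (0, v) (u, 0)) = beta G u v.
  exact: etrans (rtriv1 G _) (beta_sym G _ _).
have E3 : 'd (fun z => rtriv (one : M) z ('d (mulc G) (e, e) (0, v))) e u = - beta G v u.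
  exact: etrans (congr1 (fun w => 'd (fun z => rtriv (one : M) z w) e u) E0) E1.
apply: etrans (congr2 (fun a b : g => a + b) E3 E2) _.
by rewrite /br addrC.
Unshelve. all: by end_near. Qed.

Opaque br.

Lemma is_diff_curve_Ad (c : R^o -> M) u v :
  smooth_at (0 : vec R^o) one (c : vec R^o -> M) 0 -> c 0 = one ->
  D (0 : vec R^o) one (c : vec R^o -> M) 0 1 = u ->
  derive1 (fun t : R => @Ad R n G (c t) v) 0 = br G u v.
Proof.
move=> sc c0 dc.
have h : is_diff (0 : R^o) (fun t => Adc (chart_at one (c t)) v)
   (fun k => br G (D (0 : vec R^o) one (c : vec R^o -> M) 0 k) v).
  by apply: is_diff_compf (smooth_at_diff sc) _ (is_diff_Adc v); rewrite /rep /= c0.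
have h' : is_diff (0 : R^o) (fun t => @Ad R n G (c t) v)
   (fun k => br G (D (0 : vec R^o) one (c : vec R^o -> M) 0 k) v).
  apply: is_diff_near _ h.
  have [U [oU U0 _ Us _]] := sc.
  have : \forall t \near (0 : R^o), U t by exact: open_nbhs_nbhs.
  by apply: filterS => t Ut; rewrite /Adc (chartK mM (Us _ Ut)).
rewrite derive1E; have [_ ->] := is_diff_derive (1 : R^o) h'.
by rewrite dc.
Qed.

(* Differentiate Ad_{x k x^-1} Ad_x v = Ad_x Ad_k v in k at the identity. *)
Lemma br_Ad (x : M) u v : @Ad R n G x (br G u v) = br G (@Ad R n G x u) (@Ad R n G x v).
Proof.
have sx := smooth_at_conj1 x.
have cx : rep one one (conjm x) e = e.
  by rewrite /rep /= (chartK mM s1) conj1.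
have h1 : is_diff e (fun b => Adc (rep one one (conjm x) b) (@Ad R n G x v))
   (fun u => br G (D one one (conjm x) one u) (@Ad R n G x v)).
  exact: is_diff_compf (smooth_at_diff sx) cx (is_diff_Adc _).
have dA z : is_diff z (@Ad R n G x) (@Ad R n G x).
  by apply: is_diff_lin; [exact: Ad_linear|apply: findim_linear_cont => //; exact: Ad_linear].
have h2 : is_diff e (fun b => @Ad R n G x (Adc b v)) (fun u => @Ad R n G x (br G u v)).
  exact: is_diff_compf (is_diff_Adc v) erefl (dA _).
have h3 : is_diff e (fun b => Adc (rep one one (conjm x) b) (@Ad R n G x v))
   (fun u => br G (@Ad R n G x u) (@Ad R n G x v)).
  apply: (is_diff_ext h1 (fun=> erefl)) => w.
  rewrite /=; exact: (congr1 (fun z => br G z (@Ad R n G x v)) (esym (AdE x w))).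
suff h4 : is_diff e (fun b => @Ad R n G x (Adc b v))
    (fun u => br G (@Ad R n G x u) (@Ad R n G x v)).
  exact: etrans (esym (is_diff_app u h2)) (is_diff_app u h4).
apply: is_diff_near _ h3.
have [U [oU U0 _ Us _]] := sx.
have : \forall b \near e, U b by exact: open_nbhs_nbhs.
apply: filterS => b Ub; rewrite /Adc /rep /= (chartK mM (Us _ Ub)) -!AdM.
by rewrite /conjm mulgVK.
Qed.

Lemma Adc_e v : Adc e v = v.
Proof.
rewrite /Adc (ofe G) AdE.
apply: etrans (_ : D one one (fun q => q) one v = v); last exact: D_id.
by congr (D one one _ one v); apply/funext => h; rewrite /conjm mul1g invg1 mulg1.
Qed.

(** [br_Ad] says that Ad_k preserves the bracket; differentiating this in [k] at the identity along
    [u], with the product rule on the right, gives the identity. *)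
Lemma br_jacobi u v w : br G u (br G v w) = br G (br G u v) w + br G v (br G u w).
Proof.
have h1 := is_diff_Adc (br G v w).
have dbr1 z x : is_diff z (fun y => br G y x) (fun y => br G y x).
  apply: is_diff_lin; first exact: br_linl.
  by apply: findim_linear_cont => //; exact: br_linl.
have dL x : is_diff e (fun b => br G (Adc b v) x) (fun u => br G (br G u v) x).
  exact: is_diff_compf (is_diff_Adc v) erefl (dbr1 _ _).
have h2 := is_diff_applin (L := fun b x => br G (Adc b v) x) fV
  (fun x => let: DiffDef d _ := dL x in d) (fun z => br_linr _ (Adc z v)) (is_diff_Adc w).
apply: etrans (esym (is_diff_app u h1)) _.
have h3 : is_diff e (fun b => Adc b (br G v w)) (fun u =>
   'd (fun z => br G (Adc z v) (Adc e w)) e u + br G (Adc e v) (br G u w)).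
  apply: (is_diff_ext h2 _ (fun=> erefl)) => b.
  exact: esym (br_Ad _ v w).
apply: etrans (is_diff_app u h3) _.
have E1 := etrans (is_diff_app u (dL (Adc e w))) (congr1 (br G (br G u v)) (Adc_e w)).
have E2 := congr1 (fun z => br G z (br G u w)) (Adc_e v).
have E3 := congr2 (fun a b : g => a + b) E1 E2.
exact E3.
Qed.

End AdjointAction.

(** * One-parameter subgroups *)

Section OneParameter.
Variables (R : realType) (n : nat) (G : lieGroup R n).
Notation M := (mfd G).
Notation g := 'rV[R]_n.
Notation one := (1%g : M).
Notation T := (vec R^o).
Notation o := (0 : T).
Let e : g := chart_at one one.
Let mM : smooth_manifold M := mfdP G.
Let mR : smooth_manifold T := smooth_manifold_vec R^o.
Let fV : findim g := findim_mx R 1 n.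
Let s1 : source (chart_at one) one := @src1 R n G.

Lemma smooth_at_affine (a b t : R^o) :
  @smooth_at _ _ _ T T o o (fun s : T => (a : R) *: s + b) t.
Proof.
exists setT; split=> //; first exact: openT.
  by move=> z _; exists z.
move=> k; apply: CkD; [exact: openT| |exact: Ck_cst].
by apply: Ck_lin; [move=> c u v; rewrite scalerDr !scalerA mulrC|exact: scaler_continuous].
Qed.

Lemma D_affine (a b t v : R^o) :
  @D _ _ _ T T o o (fun s : T => (a : R) *: s + b) t v = (a : R) *: v.
Proof.
apply: (is_diff_app (df := fun v => (a : R) *: v)).
have h := is_diffD (is_diff_scaler (a : R) t) (is_diff_cst b t).
by apply: (is_diff_ext h) => // w; rewrite /= addr0.
Qed.

Lemma smooth_at_reparam (c : T -> M) (y : M) (a b t : R^o) :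
  smooth_at o y c ((a : R) *: t + b) -> smooth_at o y (fun s => c ((a : R) *: s + b)) t.
Proof.
by move=> sc; exact: (smooth_at_comp mR mR (findim_reg R) _ (smooth_at_affine a b t) sc).
Qed.

Lemma D_reparam (c : T -> M) (y : M) (a b t v : R^o) :
  smooth_at o y c ((a : R) *: t + b) ->
  D o y (fun s => c ((a : R) *: s + b)) t v = (a : R) *: D o y c ((a : R) *: t + b) v.
Proof.
move=> sc; have := D_comp mR mR v _ (smooth_at_affine a b t) sc.
by rewrite D_affine [in RHS]/D dZ; exact.
Qed.

Lemma one_param0 xi (c : R^o -> G) : one_param xi c -> c 0 = 1%g.
Proof.
move=> [_ cM _]; have := cM 0 0; rewrite addr0 => h.
by apply: (@mulgI G (c 0)); rewrite mulg1 -h.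
Qed.

(** The homomorphism property turns [c t * (c t0)^-1] into [c (t - t0)], so the right logarithmic
    derivative is the velocity at 0. *)
Lemma one_param_velocity xi (c : R^o -> G) (t0 : R^o) : one_param xi c ->
  D o one (fun t => (c t * (c t0)^-1)%g : M) t0 1 = xi.
Proof.
move=> oc; have c0 := one_param0 oc; have [sc cM dc] := oc.
have -> : (fun t => (c t * (c t0)^-1)%g : M) = fun t => c ((1 : R) *: t + - t0) : M.
  apply/funext => t; rewrite scale1r cM; congr (_ * _)%g.
  by apply: (@mulgI G (c t0)); rewrite mulgV -cM subrr.
have sc0 := sc (0 : R^o); rewrite /= in sc0.
have E0 : (1 : R) *: t0 + - t0 = 0 by rewrite scale1r subrr.
have s0 : smooth_at o one (c : T -> M) ((1 : R) *: t0 + - t0).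
  by rewrite E0 -[one]c0; exact: sc0.
by rewrite (D_reparam _ s0) E0 scale1r -[one]c0.
Qed.

(** Both curves have right logarithmic derivative [xi] at all times, so the quotient of one by the
    other has zero velocity by [D_quotient_curves] and keeps its value at time 0. *)
Lemma one_param_unique xi (c1 c2 : R^o -> G) t :
  one_param xi c1 -> one_param xi c2 -> c1 t = c2 t.
Proof.
move=> o1' o2'; pose k t : M := ((c1 t)^-1 * c2 t)%g.
have H u := D_quotient_curves ((let: And3 s _ _ := o1' in s) u)
  ((let: And3 s _ _ := o2' in s) u) (one_param_velocity u o1') (one_param_velocity u o2').
have : k 0 = k t.
  apply: (@D0_constant R n M k setT 0 t mM openT) => // u _.
    by have [] := H u.
  by have [] := H u.
rewrite /k (one_param0 o1') (one_param0 o2') invg1 mulg1 => E.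
by apply: (@mulgI G (c1 t)^-1%g); rewrite -E mulVg.
Qed.

Section Existence.
Variable xi : g.

Lemma local_one_param : exists2 d : R, 0 < d & exists c : T -> M,
  [/\ c 0 = one,
    forall t : R, `|t| < d -> smooth_at o (c t) c t,
    smooth_at o one c 0 &
    forall t0 : R, `|t0| < d ->
      D o one (fun t => (c t * (c t0)^-1)%g : M) t0 1 = xi].
Proof.
have [A [oA Ae As Ai sA]] := mulc_smooth G.
pose B := [set b : g | A (e, b)].
have inr_cont b : {for b, continuous (fun b : g => (e, b))}.
  by apply: differentiable_continuous; case: (is_diff_inr e b).
have oB : open B.
  have := @open_preimage_on _ _ setT A (fun b : g => (e, b)) openT oA (fun b _ => inr_cont b).
  by rewrite setTI.
(* The right invariant field with value [xi] at the identity, written in the chart: its value at [b]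
   is the differential of right translation by [b] applied to [xi]. *)
pose X (b : g) : g := 'd (mulc G) (e, b) (xi, 0).
have sX : smooth_on B X.
  have s2 : smooth_on B (fun b => (e, b)).
    by apply: smooth_pair => //; [exact: smooth_cst|exact: smooth_id].
  exact: (smooth_comp (findim_prod fV fV) oB oA (fun x Bx => Bx) s2 (smooth_d (xi, 0) sA)).
have [d d0 [c [c0 cB dc sc]]] := local_flow oB Ae sX.
exists d => //; pose gam (t : T) : M := of_model (chart_at one) (c t).
have im t : `|t| < d -> (chart_at one @` source (chart_at one)) (c t).
  by move=> td; have [] := Ai _ (cB _ td).
have sgam t y : `|t| < d -> source (chart_at y) (gam t) -> smooth_at o y gam t.
  move=> td ys; have [p sp pE] := im t td.
  have scv : @smooth_at _ _ _ T (vec g) o (0 : vec g) c t.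
    exists [set t : R^o | `|t| < d]; split=> //; last by move=> z _; exists z.
    rewrite (_ : mkset _ = ball (0 : R^o) d); first exact: ball_open.
    by apply/seteqP; split=> u; rewrite -ball_normE /= sub0r normrN.
  have so : @smooth_at _ _ _ (vec g) M (0 : vec g) y (of_model (chart_at one)) (c t).
    rewrite -pE; apply: smooth_at_of_model => //.
    by move: ys; rewrite /gam -pE (chartK mM sp).
  exact: (smooth_at_comp mR (smooth_manifold_vec g) fV Logic.I scv so).
have gam0 : gam 0 = one by rewrite /gam c0 ofe.
exists gam; split=> //.
- by move=> t td; apply: sgam => //; exact: source_chart_at.
- by apply: sgam; rewrite ?normr0 // gam0.
move=> t0 t0d.
pose rt (h : M) : M := (h * (gam t0)^-1)%g.
have sgt : source (chart_at one) (gam t0) by apply: (source_of_model mM); exact: im.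
have cgt : chart_at one (gam t0) = c t0 by rewrite (of_modelK mM) //; exact: im.
have srt : smooth_at one one rt (gam t0).
  have sid : smooth_at one one (fun q => q) (gam t0) by exact: smooth_at_id.
  have scs : smooth_at one ((gam t0)^-1%g : M) (fun=> (gam t0)^-1%g) (gam t0).
    by apply: smooth_at_cst => //; exact: source_chart_at.
  by apply: (smooth_atM mM sgt sid scs); rewrite mulgV.
have h1 : is_diff (t0 : R^o) (fun t => rep one one rt (c t))
    (fun v => D one one rt (gam t0) ((v : R) *: X (c t0))).
  by apply: is_diff_compf (dc _ t0d) _ (smooth_at_diff srt).
(* Translating [mulc (a, c t0)] back by the inverse of [gam t0] returns [a], so the differential of
   [rt] undoes the one that defines [X]. *)
have E1 : D one one rt (gam t0) (X (c t0)) = xi.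
  have At : A (e, c t0) by exact: cB.
  have me : mulc G (e, c t0) = c t0 by apply: mulc_1e; exact: im.
  have h2 : is_diff e (fun a => rep one one rt (mulc G (a, c t0)))
      (fun u => D one one rt (gam t0) ('d (mulc G) (e, c t0) (u, 0))).
    apply: is_diff_compf (is_diff_compf (is_diff_inl e (c t0)) erefl (is_diffP (smooth_diff sA At))) _ (smooth_at_diff srt).
    by rewrite me cgt.
  apply: etrans (esym (is_diff_app xi h2)) _; apply: (is_diff_app (df := id)).
  apply: is_diff_near _ (is_diff_id e).
  have nA : \forall a \near e, A (a, c t0).
    apply: (near_comp _ oA At); apply: differentiable_continuous.
    by case: (is_diff_inl e (c t0)).
  have nI := near_image one.
  near=> a.
  have Aa : A (a, c t0) by near: a.
  have Ia : (chart_at one @` source (chart_at one)) a by near: a.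
  rewrite /rep /mulc /= (chartK mM (As _ Aa)) /rt /= mulgK.
  by rewrite (of_modelK mM).
apply: etrans (is_diff_app (1 : R^o) h1) _.
by rewrite scale1r.
Unshelve. all: by end_near. Qed.

Lemma local_homomorphism : exists2 d : R, 0 < d & exists c : T -> M,
  [/\ c 0 = one,
    forall s t : R, `|s| < d -> `|t| < d -> c (s + t) = (c s * c t)%g,
    smooth_at o one c 0 & D o one c 0 1 = xi].
Proof.
have [d d0 [c [c0 sc sc0 dc]]] := local_one_param.
have d20 : 0 < d / 2 by rewrite divr_gt0.
have d2d : d / 2 < d by rewrite ltr_pdivrMr // mulr_natr mulr2n ltrDr.
exists (d / 2) => //; exists c; split=> //; last first.
  have := dc 0; rewrite normr0 => /(_ d0) <-.
  congr (D o one _ 0 1); apply/funext => t.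
  by rewrite c0 invg1 mulg1.
(* The curve and its translate by [s] have the same right logarithmic derivative [xi], so [k] is
   constant, equal to its value [c s] at 0. Halving the radius keeps [u + s] in the domain of the
   local curve. *)
move=> t s td sd; pose k u : M := ((c u)^-1 * c ((1 : R) *: u + (s : R^o)))%g.
pose I := [set u : R | `|u| < d / 2].
have oI : open I.
  rewrite (_ : I = ball (0 : R) (d / 2)); first exact: ball_open.
  by apply/seteqP; split=> u; rewrite /I -ball_normE /= sub0r normrN.
have key u : I u -> smooth_at o (k u) k u /\ D o (k u) k u 1 = 0.
  move=> Iu.
  have ud : `|u| < d by exact: lt_trans Iu d2d.
  have usd : `|(1 : R) *: u + s| < d.
    rewrite scale1r; apply: le_lt_trans (ler_normD _ _) _.
    by rewrite (splitr d) ltrD.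
  apply: (D_quotient_curves (xi := xi)) => //; first exact: sc.
  - by apply: smooth_at_reparam; exact: (sc _ usd).
  - exact: dc.
  - have E := @D_reparam (fun v => (c v * (c ((1 : R) *: u + s))^-1)%g : M) one 1 s u 1.
    apply: etrans (E _) (etrans (scale1r _) (dc _ usd)).
    set w := (1 : R) *: u + s.
    have scs : smooth_at o ((c w)^-1%g : M) (fun=> (c w)^-1%g) (w : R^o).
      by apply: smooth_at_cst => //; exact: source_chart_at.
    by apply: (smooth_atM mR Logic.I (sc _ usd) scs); rewrite mulgV.
have : k 0 = k t.
  apply: (@D0_constant R n M k I 0 t mM oI).
  - move=> u /andP[u1 u2]; apply: le_lt_trans td; rewrite ler_norml.
    move: u1 u2; rewrite ge_min le_max => /orP u1 /orP u2.
    have := ler_norm t; have := ler_norm (- t); rewrite normrN => h1 h2.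
    by apply/andP; split; [case: u1|case: u2] => h; have := normr_ge0 t; lra.
  - by move=> u /key[].
  - by move=> u /key[].
rewrite /k c0 invg1 mul1g scaler0 add0r scale1r => ->.
by rewrite mulVKg.
Qed.

Lemma one_param_exists : exists c : R^o -> G, one_param xi c.
Proof.
have [d d0 [c [c0 cM sc dc]]] := local_homomorphism.
have pow (x : R) m : `|m%:R * x| < d -> `|x| < d -> (c x ^+ m)%g = c (m%:R * x).
  move=> h xd; elim: m h => [|m IH] h; first by rewrite expg0 mul0r c0.
  have hm : `|m%:R * x| < d.
    by apply: le_lt_trans h; rewrite !normrM ler_wpM2r // !normr_nat ler_nat.
  by rewrite expgS IH // -cM // -natr1 mulrDl mul1r addrC.
have div_lt (t : R) m k : `|t| / m%:R < d -> (0 < m)%N -> (0 < k)%N -> `|t / (m * k)%:R| < d.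
  move=> h m0 k0; rewrite normrM normfV normr_nat natrM invfM mulrA.
  apply: le_lt_trans h; rewrite ler_piMr ?divr_ge0 //.
  by rewrite invf_le1 ?ltr0n // ler1n.
(* Both powers are compared with the subdivision into [m * k] pieces, on which [pow] regroups the
   factors. *)
have indep (t : R) m k : `|t| / m%:R < d -> `|t| / k%:R < d -> (0 < m)%N -> (0 < k)%N ->
    (c (t / m%:R)%R ^+ m)%g = (c (t / k%:R)%R ^+ k)%g.
  move=> hm hk m0 k0.
  have n0 p : (0 < p)%N -> p%:R != 0 :> R by move=> ?; rewrite pnatr_eq0 -lt0n.
  have E p q : (0 < p)%N -> (0 < q)%N -> `|t| / p%:R < d ->
      (c (t / p%:R)%R ^+ p)%g = (c (t / (p * q)%:R)%R ^+ (q * p)%N)%g.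
    move=> p0 q0 hp; rewrite expgnA (pow (t / (p * q)%:R) q).
    - congr (c _ ^+ _)%g; rewrite natrM; field; by rewrite !n0.
    - rewrite natrM (_ : _ * _ = t / p%:R); last by field; rewrite !n0.
      by rewrite normrM normfV normr_nat.
    - exact: div_lt.
  by rewrite (E m k) // (E k m) // mulnC.
(* For nonnegative [t], [Num.bound] exceeds [t / d], so each piece has length less than [d]; the
   successor makes the number of pieces positive. *)
pose N (t : R) : nat := (Num.bound (d^-1 * t)).+1.
have NP t r : 0 <= t -> t <= r -> t / (N r)%:R < d.
  move=> t0 tr; have r0 := le_trans t0 tr.
  rewrite ltr_pdivrMr ?ltr0n // -ltr_pdivrMl //.
  apply: le_lt_trans (_ : d^-1 * r < _).
    by rewrite ler_wpM2l // invr_ge0 ltW.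
  apply: lt_trans (archi_boundP _) _; first by rewrite mulr_ge0 // invr_ge0 ltW.
  by rewrite ltr_nat.
pose C (t : R^o) : M := (c ((t : R) / (N `|t|)%:R)%R ^+ N `|t|%R)%g.
have CE (t : R) m : `|t| / m%:R < d -> (0 < m)%N -> C t = (c (t / m%:R)%R ^+ m)%g.
  by move=> hm m0; apply: indep => //; exact: NP.
have CM s t : C (s + t) = (C s * C t)%g.
  (* One subdivision fine enough for [s], [t] and [s + t]. The factors at [s / m] and [t / m]
     commute, both products being [c] at the same sum, so the power of the product splits. *)
  pose r := `|s| + `|t|; pose m := N r.
  have hs : `|s| / m%:R < d by apply: NP => //; rewrite /r lerDl.
  have ht : `|t| / m%:R < d by apply: NP => //; rewrite /r lerDr.
  have hst : `|s + t| / m%:R < d by apply: NP => //; exact: ler_normD.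
  have hs' : `|s / m%:R| < d by rewrite normrM normfV normr_nat.
  have ht' : `|t / m%:R| < d by rewrite normrM normfV normr_nat.
  rewrite (CE _ m hst) // (CE _ m hs) // (CE _ m ht) // mulrDl cM //.
  by rewrite expgMn // /commute -!cM // addrC.
have Cc (t : R) : `|t| < d -> C t = c t.
  by move=> td; rewrite (CE t 1%N) ?divr1.
have C0 : C 0 = one by rewrite Cc ?normr0 // c0.
have nC : \forall z \near (0 : R^o), c z = C z.
  apply/nbhs_normP; exists d => // z /= zd; rewrite Cc //.
  by move: zd; rewrite sub0r normrN.
have sC0 : smooth_at o one (C : T -> M) 0 by exact: (@smooth_at_eq _ _ _ T M o one c C 0 Logic.I nC sc).
exists C; split; [move=> t0|exact: CM|].
(* Smoothness at 0, where [C] agrees with [c], is carried to [t0] by the translation formula. *)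
- have -> : C = fun t => (C ((1 : R) *: t + - t0)%R * C t0)%g.
    by apply/funext => t; rewrite -CM scale1r subrK.
  have s2 : smooth_at o one (fun t => C ((1 : R) *: t + - t0) : M) t0.
    by apply: smooth_at_reparam; rewrite scale1r subrr.
  have s3 : smooth_at o (C t0) (fun=> C t0) t0.
    by apply: smooth_at_cst => //; exact: source_chart_at.
  by apply: (smooth_atM mR Logic.I s2 s3); exact: (source_chart_at mM).
- have -> : @tangent R _ _ T M C 0 1 = D o (C 0) C 0 1 by [].
  by rewrite C0 -dc; exact: (@D_eq _ _ _ T M o one c C 0 nC sc 1).
Qed.

End Existence.

(** [lie_exp] selects the time-one value of some one-parameter subgroup. Rescaling time in [c] by
    [t] gives one with velocity [t *: xi], and uniqueness identifies it with the selected one. *)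
Lemma lie_expE xi (c : R^o -> G) (t : R) : one_param xi c -> lie_exp G (t *: xi) = c t.
Proof.
move=> oc; have [sc cM dc] := oc; have c0 := one_param0 oc.
have sc' y s : source (chart_at y) (c s : M) -> smooth_at o y (c : T -> M) s.
  move=> ys; apply: smooth_at_charts (sc s) => //; exact: source_chart_at.
have oct : one_param (t *: xi) (fun s => c ((t : R) *: s + 0)).
  split.
  - by move=> s; apply: smooth_at_reparam; apply: sc'; exact: source_chart_at.
  - by move=> s u; rewrite !addr0 scalerDr cM.
  - have -> : @tangent R _ _ T M (fun s => c ((t : R) *: s + 0)) 0 1 =
      D o (c ((t : R) *: (0 : R^o) + 0) : M) (fun s => c ((t : R) *: s + 0)) 0 1 by [].
    have E0 : (t : R) *: (0 : R^o) + 0 = 0 by rewrite addr0 scaler0.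
    rewrite D_reparam; last by apply: sc'; exact: source_chart_at.
    by rewrite E0 -dc.
rewrite /lie_exp.
have [c' oc' ->] := @xgetPex _ 1%g [set x | exists2 c, one_param (t *: xi) c & x = c 1]
  (ex_intro _ _ (ex_intro2 _ _ _ oct erefl)).
by rewrite (one_param_unique 1 oc' oct) addr0 /GRing.scale /= mulr1.
Qed.

(** The exponential curve in the definition is a one-parameter subgroup with velocity [u], and the
    derivative of Ad along a smooth curve through the identity depends only on its velocity. *)
Lemma lie_bracketE u v : lie_bracket G u v = br G u v.
Proof.
have [c oc] := one_param_exists u; have [sc cM dc] := oc; have c0 := one_param0 oc.
rewrite /lie_bracket (_ : (fun t => _) = fun t => @Ad R n G (c t) v); last first.
  by apply/funext => t; rewrite (lie_expE _ oc).
have sc0 := sc (0 : R^o); rewrite /= in sc0.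
have s0 : smooth_at o one (c : T -> M) 0 by rewrite -[one]c0; exact: sc0.
apply: (@is_diff_curve_Ad R n G c u v s0 c0).
by rewrite -[one]c0.
Qed.

End OneParameter.

(** * The canonical symplectic form *)

Section Pairing.
Variable R : realType.

Lemma pairingDl n (a b : 'cV[R]_n) v : pairing (a + b) v = pairing a v + pairing b v.
Proof. by rewrite /pairing mulmxDr mxE. Qed.

Lemma pairingDr n (a : 'cV[R]_n) u v : pairing a (u + v) = pairing a u + pairing a v.
Proof. by rewrite /pairing mulmxDl mxE. Qed.

Lemma pairingNl n (a : 'cV[R]_n) v : pairing (- a) v = - pairing a v.
Proof. by rewrite /pairing mulmxN mxE. Qed.

Lemma pairingNr n (a : 'cV[R]_n) v : pairing a (- v) = - pairing a v.
Proof. by rewrite /pairing mulNmx mxE. Qed.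

Lemma pairingZl n k (a : 'cV[R]_n) v : pairing (k *: a) v = k * pairing a v.
Proof. by rewrite /pairing -scalemxAr mxE. Qed.

Lemma pairing_ext n (a b : 'cV[R]_n) : (forall v, pairing a v = pairing b v) -> a = b.
Proof.
move=> h; apply/colP => i; have := h (delta_mx 0 i).
by rewrite /pairing -!rowE !mxE.
Qed.

Lemma pairing_dual m n (f : 'rV[R]_m -> 'rV[R]_n) a v : linear f ->
  pairing (dual_map f a) v = pairing a (f v).
Proof.
move=> fl; pose M := GRing.isLinear.Build _ _ _ _ _ fl.
pose f' : {linear 'rV[R]_m -> 'rV[R]_n} := HB.pack f M.
by rewrite /pairing /dual_map mulmxA (mul_rV_lin1 f').
Qed.

Lemma is_diff_dual_map (U : normedModType R) m n (L : U -> 'rV[R]_m -> 'rV[R]_n)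
  (p dp : U -> 'cV[R]_n) x :
  (forall v, differentiable (fun z => L z v) x) -> is_diff x p dp ->
  is_diff x (fun z => dual_map (L z) (p z))
    (fun u => dual_map (fun v => 'd (fun z => L z v) x u) (p x) + dual_map (L x) (dp u)).
Proof.
move=> dL dp'.
(* [lin1_mx] only reads a map on the basis vectors, so this expansion holds for every [f], linear or
   not. It can therefore be used for [L z] and for its derivative alike. *)
have mulE (f : 'rV[R]_m -> 'rV[R]_n) (a : 'cV[R]_n) : dual_map f a =
    \sum_i delta_mx i 0 *m (f (delta_mx 0 i) *m a).
  apply/colP => i; rewrite summxE (bigD1 i) //= big1 ?addr0.
    rewrite [RHS]mxE big_ord1 [X in _ = X * _]mxE !eqxx mul1r !mxE.
    by apply: eq_bigr => j _; rewrite mxE.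
  by move=> j ji; rewrite mxE big_ord1 [X in X * _]mxE eq_sym (negbTE ji) mul0r.
have ll (q : 'cV[R]_n) (i : 'I_m) : linear (fun r : 'rV[R]_n => (delta_mx i 0 : 'cV[R]_m) *m (r *m q)).
  by move=> k a b; rewrite mulmxDl mulmxDr -scalemxAl -scalemxAr.
have dmul q : is_diff x (fun z => dual_map (L z) q)
    (fun u => dual_map (fun v => 'd (fun z => L z v) x u) q).
  pose l i (r : 'rV[R]_n) : 'cV[R]_m := delta_mx i 0 *m (r *m q).
  have dl i r : is_diff r (l i) (l i).
    exact: is_diff_lin (ll q i) (findim_linear_cont (findim_mx R 1 n) (ll q i)).
  have h := is_diff_sum (fun i =>
    is_diff_compf (is_diffP (dL (delta_mx 0 i))) erefl (dl i (L x (delta_mx 0 i)))).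
  exact: (is_diff_ext h (fun z => esym (mulE (L z) q))
    (fun u => esym (mulE (fun v => 'd (fun z => L z v) x u) q))).
have lin z : linear (dual_map (L z)).
  by move=> k a b; rewrite /dual_map mulmxDr -scalemxAr.
have h := is_diff_applin (findim_mx R n 1) (fun q => let: DiffDef d _ := dmul q in d) lin dp'.
apply: (is_diff_ext h (fun=> erefl)) => u.
by congr (_ + _); exact: is_diff_app (dmul _).
Qed.

End Pairing.

Section CanonicalForm.
Variables (R : realType) (n : nat) (G : lieGroup R n).
Notation M := (mfd G).
Notation g := 'rV[R]_n.
Notation gd := 'cV[R]_n.
Notation E := ((g * gd) * (g * gd))%type.
Let mM : smooth_manifold M := mfdP G.
Let fV : findim g := findim_mx R 1 n.

Lemma coord_change_vec (x y z v : g) : @coord_change R g (vec g) x y z v = v.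
Proof. by apply: (is_diff_app (df := id)); exact: is_diff_id. Qed.

Lemma coord_change_linear (V : normedModType R) (N : charted V) (x y z : N) :
  linear (coord_change x y z).
Proof. by move=> k u v; rewrite /coord_change dD dZ. Qed.

Lemma coord_change_trans (x y z p : M) v : source (chart_at x) p ->
  source (chart_at y) p -> source (chart_at z) p ->
  coord_change y z p (coord_change x y p v) = coord_change x z p v.
Proof.
move=> xp yp zp; apply: esym.
exact: (D_comp mM mM v xp (smooth_at_id mM xp yp) (smooth_at_id mM yp zp)).
Qed.

Lemma coord_change_refl (x p : M) v : source (chart_at x) p -> coord_change x x p v = v.
Proof. by move=> xp; exact: D_id. Qed.

Lemma is_diff_proj11 (V1 V2 V3 : normedModType R) (y : V1 * V2 * V3) :
  is_diff y (fun w => w.1.1) (fun w => w.1.1).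
Proof. exact: is_diff_compf (is_diff_fst y) erefl (is_diff_fst _). Qed.

Lemma is_diff_proj12 (V1 V2 V3 : normedModType R) (y : V1 * V2 * V3) :
  is_diff y (fun w => w.1.2) (fun w => w.1.2).
Proof. exact: is_diff_compf (is_diff_fst y) erefl (is_diff_snd _). Qed.

Lemma is_diff_proj21 (V1 V2 V3 : normedModType R) (y : V1 * (V2 * V3)) :
  is_diff y (fun w => w.2.1) (fun w => w.2.1).
Proof. exact: is_diff_compf (is_diff_snd y) erefl (is_diff_fst _). Qed.

Lemma is_diff_proj22 (V1 V2 V3 : normedModType R) (y : V1 * (V2 * V3)) :
  is_diff y (fun w => w.2.2) (fun w => w.2.2).
Proof. exact: is_diff_compf (is_diff_snd y) erefl (is_diff_snd _). Qed.

Lemma near_TsTG_image (a : TsTG G) (z : M) : source (chart_at a.1.1) z ->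
  forall (p : gd) (w : g * gd), \forall y \near ((chart_at a.1.1 z, p), w),
  (chart_at a.1.1 @` source (chart_at a.1.1)) y.1.1.
Proof.
move=> az p w.
apply: (near_comp (h := fun y : E => y.1.1)); last 2 first.
- exact: (open_image mM).
- by exists z.
by apply: differentiable_continuous; case: (is_diff_proj11 ((chart_at a.1.1 z, p), w)).
Qed.

Lemma tangent_proj (z : TsTG G) (w : E) :
  @tangent R _ _ (TsTG G) (TG G) (@TsTG_proj R n G) z w = (w.1.1, w.2.1).
Proof.
apply: (is_diff_app (df := fun w : E => (w.1.1, w.2.1))).
have d := is_diff_pair (is_diff_proj11 (chart_at z z)) (is_diff_proj21 (chart_at z z)).
apply: is_diff_near _ d.
have sz : source (chart_at z.1.1) z.1.1 by exact: source_chart_at.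
have := near_TsTG_image sz (chart_at z z).1.2 (chart_at z z).2.
by apply: filterS => y hy; rewrite /local_rep /= (of_modelK mM hy).
Qed.

(* The fibre components of the transition map are irrelevant here, but its
   differential is a junk value unless they are differentiable too. *)
Lemma coord_change_proj (a : TsTG G) (y w : E)
  (z := of_model (chart_at a) y) :
  (chart_at a.1.1 @` source (chart_at a.1.1)) y.1.1 ->
  (coord_change a z z w).1.1 = coord_change a.1.1 z.1.1 z.1.1 w.1.1 /\
  (coord_change a z z w).2.1 = w.2.1.
Proof.
move=> hy; pose x : M := z.1.1; pose x0 : M := a.1.1.
have x0x : source (chart_at x0) x by exact: (source_of_model mM hy).
have xx : source (chart_at x) x by exact: source_chart_at.
have cz : (chart_at a z).1.1 = y.1.1 by exact: (of_modelK mM hy).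
pose tau : g -> g := rep x0 x (fun q => q).
have dtau : is_diff (y.1.1) tau (coord_change x0 x x).
  have h := smooth_at_diff (smooth_at_id mM x0x xx).
  by rewrite /x /z /= (of_modelK mM hy) in h; exact: h.
have [U [oU Up Us _ sU]] := smooth_at_id mM xx x0x.
pose L (y' : E) (v : g) : g := 'd (rep x x0 (fun q => q)) (tau y'.1.1) v.
have tauy : tau (chart_at a z).1.1 = chart_at x x by rewrite cz.
have dtau1 : is_diff (chart_at a z) (fun y' : E => tau y'.1.1)
    (fun w => coord_change x0 x x w.1.1).
  apply: is_diff_compf (is_diff_proj11 (chart_at a z)) _ dtau; exact: cz.
have dL v : differentiable (fun y' => L y' v) (chart_at a z).
  by case: (is_diff_d2 v sU Up dtau1 tauy).
have h2 := is_diff_dual_map dL (is_diff_proj12 (chart_at a z)).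
have hh := is_diff_pair (is_diff_pair dtau1 h2)
  (is_diff_pair (is_diff_proj21 (chart_at a z)) (is_diff_proj22 (chart_at a z))).
have key := is_diff_app w (is_diff_near (g := chart_at z \o of_model (chart_at a)) _ hh).
suff N : \forall y' \near chart_at a z,
  ((tau y'.1.1, dual_map (L y') y'.1.2), (y'.2.1, y'.2.2)) =
  (chart_at z \o of_model (chart_at a)) y'.
  by rewrite /coord_change (key N).
have n1 : \forall y' \near chart_at a z,
    (chart_at x0 @` (source (chart_at x0) `&` source (chart_at x))) y'.1.1.
  apply: (near_comp (h := fun y : E => y.1.1)).
  - by apply: differentiable_continuous; case: (is_diff_proj11 (chart_at a z)).
  - by case: (smooth_trans mM x0 x).
  - by rewrite cz; exists x => //; exact: (of_modelK mM hy).
apply: filterS n1 => y' [p [x0p xp] pE].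
have ofp : of_model (chart_at x0) y'.1.1 = p by rewrite -pE (chartK mM x0p).
have pp : source (chart_at p) p by exact: source_chart_at.
have tp : tau y'.1.1 = chart_at x p by rewrite /tau /rep /= ofp.
rewrite /= -/x -/x0 ofp; congr ((_, _), (_, _)) => //.
- apply: pairing_ext => v.
  rewrite !pairing_dual; try exact: coord_change_linear.
  by rewrite (coord_change_trans _ xp pp x0p) /L tp.
- apply: pairing_ext => v.
  rewrite !pairing_dual; try exact: coord_change_linear.
  by rewrite !coord_change_vec.
Qed.

Lemma canonical_formE (a : TsTG G) (u v : E) : canonical_form a u v =
  (pairing u.1.2 v.1.1 + pairing u.2.2 v.2.1)
  - (pairing v.1.2 u.1.1 + pairing v.2.2 u.2.1).
Proof.
have key (w u' : E) : 'D_u' (fun y : E => let z := of_model (chart_at a) y in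
    liouville z (coord_change a z z w) : R) (chart_at a a) =
    pairing u'.1.2 w.1.1 + pairing u'.2.2 w.2.1.
  pose F (y : E) : R^o := pairing y.1.2 w.1.1 + pairing y.2.2 w.2.1.
  have lF : linear F.
    move=> k b c; rewrite /F /= !pairingDl !pairingZl.
    by rewrite scalerDr /GRing.scale /= addrACA.
  have dF : is_diff (chart_at a a) F F.
    apply: is_diff_lin => //; apply: findim_linear_cont => //.
    by apply: findim_prod; apply: findim_prod; exact: findim_mx.
  have [_ dE] := is_diff_derive u' dF.
  apply: etrans _ dE; apply: near_eq_derive.
  have sa : source (chart_at a.1.1) a.1.1 by exact: source_chart_at.
  have := near_TsTG_image sa (chart_at a a).1.2 (chart_at a a).2.
  apply: filterS => y hy /=.
  have [E1 E2] := coord_change_proj w hy.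
  rewrite /liouville tangent_proj E1 E2.
  pose x : M := of_model (chart_at (a.1.1 : M)) y.1.1.
  change (pairing (dual_map (coord_change x a.1.1 x) y.1.2) (coord_change a.1.1 x x w.1.1)
    + pairing (dual_map (@coord_change R g (vec g) y.2.1 a.2.1 y.2.1) y.2.2) w.2.1 = F y).
  have x0x : source (chart_at a.1.1) x by exact: (source_of_model mM hy).
  have xx : source (chart_at x) x by exact: source_chart_at.
  (* The covector is transported from the chart around [a] to the one around [x] by a dual map,
     while the vector is pushed forward to the chart around [x]: the two coordinate changes cancel
     in the pairing. *)
  rewrite !pairing_dual; try exact: coord_change_linear.
  by rewrite (coord_change_trans _ x0x xx x0x) coord_change_refl // coord_change_vec.
by rewrite /canonical_form /ext_deriv !key.
Qed.

End CanonicalForm.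

Lemma d_inl_linear (R : realType) (V V' W : normedModType R) (f : V * V' -> W) x :
  linear (fun z : V => 'd f x (z, 0)).
Proof.
move=> k a b; have -> : (k *: a + b, 0) = k *: (a, 0 : V') + (b, 0 : V').
  by congr (_, _); rewrite /= scaler0 addr0.
by rewrite dD dZ.
Qed.

Lemma d2_inl_linear (R : realType) (V V' W : normedModType R) (f : V * V' -> W) x u :
  linear (fun z : V => d2 f x u (z, 0)).
Proof. exact: d_inl_linear. Qed.

(** * The trivialized symplectic form *)

Section Trivialization.
Variables (R : realType) (n : nat) (G : lieGroup R n).
Notation M := (mfd G).
Notation g := 'rV[R]_n.
Notation gd := 'cV[R]_n.
Notation one := (1%g : M).
Notation P := (g * (g * (gd * gd)))%type.
Let mM : smooth_manifold M := mfdP G.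
Let fV : findim g := findim_mx R 1 n.
Let s1 : source (chart_at one) one := @src1 R n G.

Let rmul (x h : M) : M := (h * x)%g.

Lemma smooth_at_rmul (x p a c : M) : source (chart_at a) p ->
  source (chart_at c) (rmul x p) -> smooth_at a c (rmul x) p.
Proof.
move=> ap cp.
have si : smooth_at a a (fun q => q) p by exact: smooth_at_id.
have sx : smooth_at a x (fun=> x) p by apply: smooth_at_cst => //; exact: source_chart_at.
exact: (smooth_atM mM ap si sx).
Qed.

Definition TRinv (x : M) : g -> g := D x one (rmul (x^-1)%g) x.

Lemma TRE (x : M) v : @TR R n G x v = D one x (rmul x) one v.
Proof.
have -> : @TR R n G x v = D one (rmul x one) (rmul x) one v by [].
by rewrite /rmul mul1g.
Qed.

Lemma TRinv_linear (x : M) : linear (TRinv x).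
Proof. by move=> k u v; rewrite /TRinv /D dD dZ. Qed.

Lemma TR_linear (x : M) : linear (@TR R n G x).
Proof.
move=> k u v; have E w := TRE x w.
by rewrite (E (k *: u + v)) (E u) (E v) /D dD dZ.
Qed.

Lemma TRK (x : M) v : TRinv x (@TR R n G x v) = v.
Proof.
rewrite TRE /TRinv.
have xx : source (chart_at x) x by exact: source_chart_at.
have h1 : smooth_at one x (rmul x) one by apply: smooth_at_rmul; rewrite /rmul ?mul1g.
have h2 : smooth_at x one (rmul (x^-1)%g) (rmul x one).
  by apply: smooth_at_rmul; rewrite /rmul mul1g ?mulgV.
have Ex : rmul x one = x by rewrite /rmul mul1g.
have := D_comp mM mM v s1 h1 h2; rewrite Ex => <-.
apply: etrans (D_id v mM s1); congr (D one one _ one v); apply/funext => h.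
by rewrite /rmul /= mulgK.
Qed.

Lemma TRinvK (x : M) v : @TR R n G x (TRinv x v) = v.
Proof.
rewrite TRE /TRinv.
have xx : source (chart_at x) x by exact: source_chart_at.
have h1 : smooth_at x one (rmul (x^-1)%g) x.
  by apply: smooth_at_rmul; rewrite /rmul ?mulgV.
have Ex : rmul (x^-1)%g x = one by rewrite /rmul mulgV.
have h2 : smooth_at one x (rmul x) (rmul (x^-1)%g x).
  by rewrite Ex; apply: smooth_at_rmul; rewrite /rmul ?mul1g.
have := D_comp mM mM v xx h1 h2; rewrite Ex => <-.
apply: etrans (D_id v mM xx); congr (D x x _ x v); apply/funext => h.
by rewrite /rmul /= mulgVK.
Qed.

(** [TRinv x] uses the chart around the moving point [x]. After the coordinate change it becomes
    [rtriv x0], written in the fixed chart around [x0], where it can be differentiated in the base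
    point. *)
Lemma rtrivE (x0 x : M) v : source (chart_at x0) x ->
  differentiable (quo x0) (chart_at x0 x, chart_at x0 x) ->
  TRinv x (coord_change x0 x x v) = rtriv x0 (chart_at x0 x) v.
Proof.
move=> x0x dq; have xx : source (chart_at x) x by exact: source_chart_at.
have h : smooth_at x one (rmul (x^-1)%g) x.
  by apply: smooth_at_rmul; rewrite /rmul ?mulgV.
have E := D_comp mM mM v x0x (smooth_at_id mM x0x xx) h.
apply: etrans (esym E) _.
have hq : is_diff (chart_at x0 x) (fun a => quo x0 (a, chart_at x0 x))
    (fun u => 'd (quo x0) (chart_at x0 x, chart_at x0 x) (u, 0)).
  exact: is_diff_compf (is_diff_inl _ _) erefl (is_diffP dq).
apply: etrans _ (is_diff_app v hq); rewrite /D.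
congr ('d _ (chart_at x0 x) v); apply/funext => a.
by rewrite /rep /quo /rmul /= (chartK mM x0x).
Qed.

Lemma rtriv_linear (x : M) (q : g) : linear (rtriv x q).
Proof. exact: d_inl_linear. Qed.

Definition triv_inv_fun (p : trivTsTG G) : TsTG G :=
  ((p.1, dual_map (TRinv p.1) (p.2.2.1 - ads G p.2.1 p.2.2.2)), (p.2.1, p.2.2.2)).

Lemma triv_invE (p : trivTsTG G) : triv_inv p = triv_inv_fun p.
Proof.
have K1 (q : trivTsTG G) : triv (triv_inv_fun q) = q.
  case: q => x [xi [mu nu]]; rewrite /triv /triv_inv_fun /=.
  congr (_, (_, (_, _))).
  rewrite -[RHS](subrK (ads G xi nu)); congr (_ + _).
  apply: pairing_ext => v; rewrite pairing_dual; last exact: TR_linear.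
  by rewrite pairing_dual ?TRK //; exact: TRinv_linear.
have K2 (a : TsTG G) : triv_inv_fun (triv a) = a.
  case: a => -[x ax] [xi axi]; rewrite /triv /triv_inv_fun /=.
  congr ((_, _), _); rewrite addrK.
  apply: pairing_ext => v; rewrite pairing_dual; last exact: TRinv_linear.
  by rewrite pairing_dual ?TRinvK //; exact: TR_linear.
rewrite -[LHS]K2; congr triv_inv_fun.
exact: (@xgetPex _ _ [set a | triv a = p] (ex_intro _ _ (K1 p))).
Qed.

Lemma adsE (xi : g) (nu : gd) : ads G xi nu = - dual_map (br G xi) nu.
Proof. by congr (- dual_map _ _); apply/funext => v; exact: lie_bracketE. Qed.

Lemma pairing_ads (xi eta : g) (mu : gd) :
  pairing (ads G xi mu) eta = - pairing mu (br G xi eta).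
Proof. by rewrite adsE pairingNl pairing_dual //; exact: br_linr. Qed.

Lemma is_diff_br_l (xi v : g) : is_diff xi (fun y => br G y v) (fun y => br G y v).
Proof.
exact: is_diff_lin (br_linl G v) (findim_linear_cont fV (br_linl G v)).
Qed.

Lemma is_diff_ads (U : normedModType R) (xi dxi : U -> g) (nu dnu : U -> gd) x :
  is_diff x xi dxi -> is_diff x nu dnu ->
  is_diff x (fun y => ads G (xi y) (nu y))
    (fun u => ads G (dxi u) (nu x) + ads G (xi x) (dnu u)).
Proof.
move=> hxi hnu.
have dL v : is_diff x (fun y => br G (xi y) v) (fun u => br G (dxi u) v).
  exact: is_diff_compf hxi erefl (is_diff_br_l _ v).
have h := is_diffN (is_diff_dual_map (L := fun y => br G (xi y))
   (fun v => let: DiffDef d _ := dL v in d) hnu).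
apply: (is_diff_ext h) => [y|u]; first by rewrite adsE.
rewrite !adsE -opprD; congr (- (dual_map _ _ + _)).
by apply/funext => v; exact: is_diff_app (dL v).
Qed.

(* T_e^*R_g alpha_g, recovered from mu = T_e^*R_g alpha_g + ad^*_xi nu. *)
Definition mom (p : trivTsTG G) : gd := p.2.2.1 - ads G p.2.1 p.2.2.2.

Definition dmom (p : trivTsTG G) (u : P) : gd :=
  u.2.2.1 - (ads G u.2.1 p.2.2.2 + ads G p.2.1 u.2.2.2).

(** In the charts around [p], the transition maps and [TRinv] combine by [rtrivE], and the covector
    component becomes [dual_map (rtriv p.1 y.1)] applied to the momentum. Its derivative has one
    term from the moving base point and one from the momentum. *)
Lemma tangent_triv_inv (p : trivTsTG G) (u : P) (q := chart_at p.1 p.1) :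
  @tangent R _ _ (trivTsTG G) (TsTG G) (@triv_inv R n G) p u =
  ((u.1, dual_map (fun v => 'd (fun b => rtriv p.1 b v) q u.1) (mom p)
         + dual_map (rtriv p.1 q) (dmom p u)), (u.2.1, u.2.2.2)).
Proof.
have -> : @triv_inv R n G = triv_inv_fun by apply/funext => a; exact: triv_invE.
pose x0 : M := p.1.
have x0x0 : source (chart_at x0) x0 by exact: source_chart_at.
pose y0 : P := chart_at p p.
have dxi : is_diff y0 (fun y : P => y.2.1) (fun y => y.2.1) := is_diff_proj21 y0.
have d22 : is_diff y0 (fun y : P => y.2.2) (fun y => y.2.2) := is_diff_proj22 y0.
have dmu : is_diff y0 (fun y : P => y.2.2.1) (fun y => y.2.2.1).
  exact: is_diff_compf d22 erefl (is_diff_fst _).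
have dnu : is_diff y0 (fun y : P => y.2.2.2) (fun y => y.2.2.2).
  exact: is_diff_compf d22 erefl (is_diff_snd _).
have dm : is_diff y0 (fun y : P => y.2.2.1 - ads G y.2.1 y.2.2.2) (dmom p).
  exact: is_diffB dmu (is_diff_ads dxi dnu).
have dL v : is_diff y0 (fun y : P => rtriv x0 y.1 v)
    (fun u => 'd (fun b => rtriv x0 b v) q u.1).
  have [d _] := is_diff_rtriv x0 v.
  exact: (is_diff_compf (is_diff_fst y0) erefl (is_diffP d)).
have h2 := is_diff_dual_map (L := fun y : P => rtriv x0 y.1)
  (fun v => let: DiffDef d _ := dL v in d) dm.
have hh := is_diff_pair (is_diff_pair (is_diff_fst y0) h2) (is_diff_pair dxi dnu).
pose F (y : P) : (g * gd) * (g * gd) :=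
  ((y.1, dual_map (rtriv x0 y.1) (y.2.2.1 - ads G y.2.1 y.2.2.2)), (y.2.1, y.2.2.2)).
have near1 : \forall y \near y0, (chart_at x0 @` source (chart_at x0)) y.1.
  apply: (near_comp (h := fun y : P => y.1)).
  - by apply: differentiable_continuous; case: (is_diff_fst y0).
  - exact: (open_image mM).
  - by exists x0.
have [U [oU Uq _ _ sU]] := quo_smooth x0.
have near2 : \forall y \near y0, U (y.1, y.1).
  apply: (near_comp (h := fun y : P => (y.1, y.1))) => //.
  apply: differentiable_continuous.
  by case: (is_diff_pair (is_diff_fst y0) (is_diff_fst y0)).
have N : \forall y \near y0,
    F y = @local_rep R _ _ (trivTsTG G) (TsTG G) triv_inv_fun p y.
  apply: filterS2 near1 near2 => y [x x0x xE] Uy.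
  have ofx : of_model (chart_at x0) y.1 = x by rewrite -xE (chartK mM x0x).
  have xx : source (chart_at x) x by exact: source_chart_at.
  rewrite /F /local_rep /= ofx -xE; congr ((_, _), (_, _)).
  - apply: pairing_ext => v.
    rewrite pairing_dual; last by move=> k b c; rewrite /rtriv; exact: rtriv_linear.
    rewrite pairing_dual; last exact: coord_change_linear.
    rewrite pairing_dual; last exact: TRinv_linear.
    by rewrite rtrivE // xE; exact: smooth_diff sU Uy.
  - apply: pairing_ext => v; rewrite pairing_dual; last exact: coord_change_linear.
    by rewrite coord_change_vec.
apply: etrans (is_diff_app u (is_diff_near N hh)) _.
congr ((_, dual_map _ _ + _), _).
by apply/funext => v; exact: is_diff_app (dL v).
Qed.

Lemma OmegaE (p : trivTsTG G) (u v : P) (B := rtriv p.1 (chart_at p.1 p.1)) :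
  Omega p u v = pairing (mom p) (br G (B u.1) (B v.1))
    + pairing (dmom p u) (B v.1) - pairing (dmom p v) (B u.1)
    + pairing u.2.2.2 v.2.1 - pairing v.2.2.2 u.2.1.
Proof.
rewrite /Omega canonical_formE !tangent_triv_inv /=.
set q := chart_at p.1 p.1.
have lB : linear B by move=> k a b; exact: rtriv_linear.
(* Linearity in the vector being trivialized is what allows [pairing_dual]; it comes from exchanging
   the two directions of the second derivative of [quo]. *)
have ldB w : linear (fun v => 'd (fun b => rtriv (p.1 : M) b v) q w).
  have -> : (fun v => 'd (fun b => rtriv (p.1 : M) b v) q w) =
      fun z => d2 (quo (p.1 : M)) (q, q) (w, w) (z, 0).
    apply/funext => z.
    apply: etrans (is_diff_app w (is_diff_rtriv (p.1 : M) z)) _.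
    by have [U [oU Uq _ _ sU]] := quo_smooth (p.1 : M); exact: (d2_sym _ _ fV oU Uq sU).
  exact: d2_inl_linear.
have mc := maurer_cartan (p.1 : M) u.1 v.1.
rewrite -/q -/B in mc.
move: (mom p) (dmom p u) (dmom p v) => m du dv.
rewrite !pairingDl !(pairing_dual _ _ (ldB _)) !(pairing_dual _ _ lB).
have -> : br G (B u.1) (B v.1) = 'd (fun b => rtriv (p.1 : M) b v.1) q u.1
   - 'd (fun b => rtriv (p.1 : M) b u.1) q v.1 := esym mc.
rewrite pairingDr pairingNr.
move: (pairing _ _) (pairing _ _) (pairing _ _) (pairing _ _) (pairing _ _) (pairing _ _).
by move=> a1 a2 a3 a4 a5 a6; ring.
Qed.

End Trivialization.

(** One solution [Y] suffices for the choice made by [ham] to be a solution, rather than the default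
    value 0. *)
Lemma hamP (R : realType) (V : normedModType R) (M : charted V)
    (omega : M -> V -> V -> R) (H : M -> R^o) (x : M) (Y : V) :
  (forall v, omega x Y v = - dfun H x v) ->
  forall v, omega x (ham omega H x) v = - dfun H x v.
Proof.
move=> hY; exact: (@xgetPex _ 0 [set X | forall v, omega x X v = - dfun H x v]
  (ex_intro _ Y hY)).
Qed.

(** * The reduced bracket *)

Section Reduction.
Variables (R : realType) (n : nat) (G : lieGroup R n).
Notation M := (mfd G).
Notation g := 'rV[R]_n.
Notation gd := 'cV[R]_n.
Notation one := (1%g : M).
Notation Q := (g * (gd * gd))%type.
Notation P := (g * Q)%type.
Let mM : smooth_manifold M := mfdP G.
Let fV : findim g := findim_mx R 1 n.
Let fQ : findim Q := findim_prod fV (findim_prod (findim_mx R n 1) (findim_mx R n 1)).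

Lemma smooth_funE (H : reduced R n -> R^o) : smooth_fun H <->
  forall r : Q, exists U, [/\ open U, U r & smooth_on U (H : Q -> R^o)].
Proof.
split=> sH r; have [U] := sH r.
  by move=> [oU Ur _ _ sU]; exists U.
by move=> [oU Ur sU]; exists U; split=> // z _; exists z.
Qed.

Lemma smooth_fun_diff (H : reduced R n -> R^o) (r : Q) :
  smooth_fun H -> is_diff r (H : Q -> R^o) ('d (H : Q -> R^o) r).
Proof.
by move=> /smooth_funE/(_ r)[U [_ Ur sU]]; exact: is_diffP (smooth_diff sU Ur).
Qed.

Lemma smooth_pullback (H : reduced R n -> R^o) :
  smooth_fun H -> smooth_fun (H \o @red R n G).
Proof.
move=> /smooth_funE sH p; have [U [oU Up sU]] := sH p.2.
have oI := open_image mM p.1.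
have oX := image_setX oI oU.
exists ((chart_at (p.1 : M) @` source (chart_at (p.1 : M))) `*` U); split=> //.
- by split=> //=; exists p.1 => //; exact: source_chart_at.
- by move=> [y w] [[x /= sx <-] _]; exists (x, w) => //; split.
- apply: (smooth_comp (f := snd) fQ oX oU _ (@smooth_snd _ _ _ _) sU).
  by move=> z [].
Qed.

(** The restriction to the slice over the identity is the function on the quotient from which an
    invariant [F] is recovered. *)
Lemma smooth_section (F : trivTsTG G -> R^o) :
  smooth_fun F -> smooth_fun (fun r : reduced R n => F (1%g, r)).
Proof.
move=> sF; apply/smooth_funE => r.
have [U [oU Up _ _ sU]] := sF ((one, r) : trivTsTG G).
pose e : g := chart_at one one.
have dinr (w : Q) := is_diff_inr e w.
pose B := [set w : Q | U (e, w)].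
have oB : open B.
  have ic (w : Q) : setT w -> {for w, continuous (fun w : Q => (e, w))}.
    by move=> _; apply: differentiable_continuous; case: (dinr w).
  by have := open_preimage_on openT oU ic; rewrite setTI.
exists B; split=> //.
have s2 : smooth_on B (fun w : Q => (e, w)).
  by apply: smooth_pair => //; [exact: smooth_cst|exact: smooth_id].
apply: smooth_eq (smooth_comp (findim_prod fV fQ) oB oU (fun w Bw => Bw) s2 sU) => // w _.
by rewrite /local_rep /= (chartK mM (@src1 R n G)).
Qed.

Lemma dfun_pullback (H : reduced R n -> R^o) (p : trivTsTG G) (v : P) :
  smooth_fun H -> dfun (H \o @red R n G) p v = 'd (H : Q -> R^o) (p.2) (v.2).
Proof.
move=> sH; apply: (is_diff_app (df := fun v : P => 'd (H : Q -> R^o) (p.2) (v.2))).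
exact: is_diff_compf (is_diff_snd (chart_at p p)) erefl (smooth_fun_diff p.2 sH).
Qed.

Lemma pairing_col (f : g -> R^o) v : linear f ->
  pairing (\col_i f (delta_mx 0 i)) v = f v.
Proof.
move=> fl; pose m := GRing.isLinear.Build _ _ _ _ _ fl.
pose f' : {linear g -> R^o} := HB.pack f m.
rewrite {2}(row_sum_delta v) -[f]/(f' : _ -> _) linear_sum /pairing mxE.
by apply: eq_bigr => i _; rewrite linearZ mxE.
Qed.

Lemma pairing_row (f : gd -> R^o) a : linear f ->
  pairing a (\row_i f (delta_mx i 0)) = f a.
Proof.
move=> fl; pose m := GRing.isLinear.Build _ _ _ _ _ fl.
pose f' : {linear gd -> R^o} := HB.pack f m.
have -> : f a = \sum_i a i 0 *: f' (delta_mx i 0).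
  have E : a = \sum_i a i 0 *: delta_mx i 0.
    by rewrite {1}(matrix_sum_delta a); apply: eq_bigr => i _; rewrite big_ord1.
  rewrite -[f]/(f' : _ -> _) {1}E linear_sum.
  by apply: eq_bigr => i _; rewrite linearZ.
rewrite /pairing mxE.
by apply: eq_bigr => i _; rewrite !mxE mulrC.
Qed.

Lemma d_functional_derivatives (H : reduced R n -> R^o) (r : Q) (v : Q) :
  smooth_fun H -> 'd (H : Q -> R^o) r v =
  pairing (dxi H r) v.1 + pairing v.2.1 (dmu H r) + pairing v.2.2 (dnu H r) :> R.
Proof.
move=> sH; have dH := smooth_fun_diff r sH.
pose F1 (x : g) : R^o := 'd (H : Q -> R^o) r (x, 0).
pose F2 (x : gd) : R^o := 'd (H : Q -> R^o) r (0, (x, 0)).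
pose F3 (x : gd) : R^o := 'd (H : Q -> R^o) r (0, (0, x)).
have l1 : linear F1 by exact: d_inl_linear.
have l2 : linear F2.
  move=> k a b; rewrite /F2 -dZ -dD; congr ('d _ r _).
  by congr (_, (_, _)); rewrite /= ?scaler0 ?addr0.
have l3 : linear F3.
  move=> k a b; rewrite /F3 -dZ -dD; congr ('d _ r _).
  by congr (_, (_, _)); rewrite /= ?scaler0 ?addr0.
have E1 : dxi H r = \col_i F1 (delta_mx 0 i).
  apply/colP => i; rewrite !mxE.
  have h : is_diff (r.1) (fun x : g => (x, r.2)) (fun u => (u, 0)) := is_diff_inl r.1 r.2.
  have rE : (r.1, r.2) = r by case: (r).
  by have [_] := is_diff_derive (delta_mx 0 i) (is_diff_compf h rE dH).
have E2 : dmu H r = \row_i F2 (delta_mx i 0).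
  apply/rowP => i; rewrite !mxE.
  have h : is_diff (r.2.1) (fun x : gd => (r.1, (x, r.2.2))) (fun u => (0, (u, 0))).
    exact: is_diff_pair (is_diff_cst r.1 r.2.1) (is_diff_inl r.2.1 r.2.2).
  have rE : (r.1, (r.2.1, r.2.2)) = r by case: (r) => ? [].
  by have [_] := is_diff_derive (delta_mx i 0) (is_diff_compf h rE dH).
have E3 : dnu H r = \row_i F3 (delta_mx i 0).
  apply/rowP => i; rewrite !mxE.
  have h : is_diff (r.2.2) (fun x : gd => (r.1, (r.2.1, x))) (fun u => (0, (0, u))).
    exact: is_diff_pair (is_diff_cst r.1 r.2.2) (is_diff_inr r.2.1 r.2.2).
  have rE : (r.1, (r.2.1, r.2.2)) = r by case: (r) => ? [].
  by have [_] := is_diff_derive (delta_mx i 0) (is_diff_compf h rE dH).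
rewrite E1 E2 E3 pairing_col // !pairing_row // /F1 /F2 /F3 -!dD.
case: v => a [b c]; congr ('d _ r _).
by congr (_, (_, _)); rewrite /= ?addr0 ?add0r.
Qed.

Lemma rtriv_TR (x : M) v : rtriv x (chart_at x x) (@TR R n G x v) = v.
Proof.
have xx : source (chart_at x) x by exact: source_chart_at.
have := rtrivE (@TR R n G x v) xx (quo_smooth_diff x).
by rewrite coord_change_refl // TRK => <-.
Qed.

(* The Hamiltonian vector field of the pull-back of a function whose functional
   derivatives in xi, mu and nu are a, b and c, solved for from OmegaE. *)
Definition hamiltonian_field (a : gd) (b c : g) (p : trivTsTG G) : P :=
  (@TR R n G p.1 b, (c - br G p.2.1 b,
    (ads G b (mom p) + (ads G (c - br G p.2.1 b) p.2.2.2
                        + ads G p.2.1 (ads G b p.2.2.2 - a)),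
     ads G b p.2.2.2 - a))).

(** The [mu] component of the field adds back exactly the variation of ad^*_xi nu that [dmom]
    subtracts. *)
Lemma dmom_hamiltonian_field a b c (p : trivTsTG G) :
  dmom p (hamiltonian_field a b c p) = ads G b (mom p).
Proof. exact: addrK. Qed.

Lemma pairing_dmom (p : trivTsTG G) (v : P) w : pairing (dmom p v) w =
  pairing v.2.2.1 w + pairing p.2.2.2 (br G v.2.1 w) + pairing v.2.2.2 (br G p.2.1 w).
Proof.
rewrite /dmom; move: (v.2.2.1) (v.2.2.2) (p.2.2.2) => mu nu' nu.
have E1 := pairing_ads G v.2.1 w nu; have E2 := pairing_ads G p.2.1 w nu'.
move: (ads _ _ _) (ads _ _ _) E1 E2 => s t E1 E2.
by rewrite pairingDl pairingNl pairingDl E1 E2 opprD !opprK addrA.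
Qed.

(** The momentum variation [ads G b (mom p)] cancels the bracket term of [OmegaE]. In the pairing of
    [dmom p v] with [b], the term in the [nu] part of [v] is cancelled by [- br G p.2.1 b], and the
    term in its [xi] part by [ads G b p.2.2.2]. *)
Lemma Omega_hamiltonian_field a b c (p : trivTsTG G) (v : P) :
  Omega p (hamiltonian_field a b c p) v =
  - (pairing a v.2.1 + pairing v.2.2.1 b + pairing v.2.2.2 c).
Proof.
rewrite OmegaE dmom_hamiltonian_field pairing_dmom rtriv_TR.
rewrite pairing_ads; move: (pairing (mom p) _) => x.
have -> : pairing (hamiltonian_field a b c p).2.2.2 v.2.1 =
    - pairing p.2.2.2 (br G b v.2.1) - pairing a v.2.1.
  rewrite /=; have E := pairing_ads G b v.2.1 p.2.2.2.
  by move: (ads _ _ _) E => s E; rewrite pairingDl pairingNl E.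
have -> : pairing v.2.2.2 (hamiltonian_field a b c p).2.1 =
    pairing v.2.2.2 c - pairing v.2.2.2 (br G p.2.1 b).
  by rewrite /=; move: (br _ _ _) => s; rewrite pairingDr pairingNr.
rewrite (brN G v.2.1 b) pairingNr.
move: (pairing _ _) (pairing _ _) (pairing _ _) (pairing _ _) (pairing _ _).
by move=> a1 a2 a3 a4 a5; ring.
Qed.

Lemma hamiltonian_fieldP (H : reduced R n -> R^o) (p : trivTsTG G) (v : P) :
  smooth_fun H ->
  Omega p (hamiltonian_field (dxi H p.2) (dmu H p.2) (dnu H p.2) p) v
  = - dfun (H \o @red R n G) p v.
Proof.
move=> sH; apply: etrans (Omega_hamiltonian_field _ _ _ _ _) _; congr (- _).
apply: esym; apply: etrans (dfun_pullback _ _ sH) _.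
exact: d_functional_derivatives.
Qed.

Lemma Omega_antisym (p : trivTsTG G) (u v : P) : Omega p u v = - Omega p v u.
Proof.
rewrite !OmegaE brN pairingNr.
move: (pairing _ _) (pairing _ _) (pairing _ _) (pairing _ _) (pairing _ _).
by move=> a1 a2 a3 a4 a5; ring.
Qed.

(** If [X] is the field selected for [K] and [Y] the explicit one for [H], both sides equal Omega(X,
    Y): one through the equation of [Y] and antisymmetry, the other through the equation of [X]. *)
Lemma reduced_bracket (H K : reduced R n -> R^o) (p : trivTsTG G) :
  smooth_fun H -> smooth_fun K ->
  bracketTsTG (H \o @red R n G) (K \o @red R n G) p =
    - dfun (K \o @red R n G) p
        (hamiltonian_field (dxi H p.2) (dmu H p.2) (dnu H p.2) p).
Proof.
move=> sH sK; rewrite /bracketTsTG /poisson.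
set Y := hamiltonian_field _ _ _ _.
have : forall v, Omega p (ham (@Omega R n G) (K \o @red R n G) p) v =
    - dfun (K \o @red R n G) p v.
  exact: (hamP (fun v => hamiltonian_fieldP p v sK)).
move: (ham _ _ _) => X XP.
rewrite -(XP Y) Omega_antisym; apply: esym; apply: etrans (congr1 _ (hamiltonian_fieldP p X sH)) _.
by rewrite opprK.
Qed.

Lemma pairing_hamiltonian_field (a a' : gd) (b c b' c' : g) (p : trivTsTG G)
    (Y := hamiltonian_field a b c p) :
  - (pairing a' Y.2.1 + pairing Y.2.2.1 b' + pairing Y.2.2.2 c') =
  pairing a c' - pairing a' c + pairing p.2.2.1 (br G b b')
  - pairing (ads G p.2.1 a') b + pairing (ads G p.2.1 a) b'
  + pairing p.2.2.2 (br G b c' - br G b' c).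
Proof.
case: p @Y => x [xi [mu nu]] /=.
have lb : br G (c - br G xi b) b' = br G c b' - br G (br G xi b) b'.
  have := br_linl G b' (-1) (br G xi b) c.
  by rewrite /= !scaleN1r ![- _ + _]addrC.
have -> : pairing a' (c - br G xi b) = pairing a' c - pairing a' (br G xi b).
  by rewrite pairingDr pairingNr.
have -> : pairing (ads G b nu - a) c' = - pairing nu (br G b c') - pairing a c'.
  by rewrite pairingDl pairingNl pairing_ads.
have -> : pairing nu (br G b c' - br G b' c) = pairing nu (br G b c') + pairing nu (br G c b').
  by rewrite (brN G b' c) opprK pairingDr.
rewrite !pairing_ads.
have -> : pairing (ads G b (mom ((x, (xi, (mu, nu))) : trivTsTG G)) +
    (ads G (c - br G xi b) nu + ads G xi (ads G b nu - a))) b' =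
  - pairing mu (br G b b') - pairing nu (br G xi (br G b b'))
  - (pairing nu (br G c b') - pairing nu (br G (br G xi b) b'))
  + (pairing nu (br G b (br G xi b')) + pairing a (br G xi b')).
  have E1 : pairing (ads G b (mom ((x, (xi, (mu, nu))) : trivTsTG G))) b' =
      - pairing mu (br G b b') - pairing nu (br G xi (br G b b')).
    by rewrite pairing_ads /mom /= pairingDl pairingNl pairing_ads opprK opprD.
  have E2 : pairing (ads G (c - br G xi b) nu) b' =
      - (pairing nu (br G c b') - pairing nu (br G (br G xi b) b')).
    by rewrite pairing_ads lb pairingDr pairingNr.
  have E3 : pairing (ads G xi (ads G b nu - a)) b' =
      pairing nu (br G b (br G xi b')) + pairing a (br G xi b').
    by rewrite pairing_ads pairingDl pairingNl pairing_ads opprB opprK addrC.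
  move: (ads G b _) (ads G _ nu) (ads G xi _) E1 E2 E3 => s1 s2 s3 E1 E2 E3.
  by rewrite !pairingDl E1 E2 E3 addrA.
(* Three nested brackets are paired with [nu]: one from the term - ad^*_xi nu in the momentum, two
   from the variation of ad^*_xi nu. They cancel by the Jacobi identity. *)
have -> : pairing nu (br G xi (br G b b')) =
    pairing nu (br G (br G xi b) b') + pairing nu (br G b (br G xi b')).
  by rewrite br_jacobi pairingDr.
generalize (pairing nu (br G (br G xi b) b')) (pairing nu (br G b (br G xi b')))
  (pairing mu (br G b b')) (pairing nu (br G c b')) (pairing nu (br G b c'))
  (pairing a (br G xi b')) (pairing a' (br G xi b)) (pairing a c') (pairing a' c).
by move=> *; ring.
Qed.

End Reduction.

Unset Implicit Arguments.

Theorem proposition4p3 (R : realType) (n : nat) (G : lieGroup R n) :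
  [/\ forall p q : trivTsTG G, (exists x : G, q = act p x) <-> red p = red q,
      forall r : reduced R n, exists p : trivTsTG G, red p = r,
      forall F : trivTsTG G -> R^o,
        (smooth_fun F /\
         (forall p (x : G), F (act p x) = F p)) <->
        (exists2 H : reduced R n -> R^o,
           smooth_fun H & F = H \o @red R n G) &
      forall H K : reduced R n -> R^o,
        smooth_fun H ->
        smooth_fun K ->
        forall (x : G) (xi : 'rV[R]_n) (mu nu : 'cV[R]_n),
        let r : reduced R n := (xi, (mu, nu)) in
        let br := lie_bracket G in
        bracketTsTG (H \o @red R n G) (K \o @red R n G) (x, r) =
          pairing (dxi H r) (dnu K r) - pairing (dxi K r) (dnu H r)
          + pairing mu (br (dmu H r) (dmu K r))
          - pairing (ads G xi (dxi K r)) (dmu H r)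
          + pairing (ads G xi (dxi H r)) (dmu K r)
          + pairing nu (br (dmu H r) (dnu K r) - br (dmu K r) (dnu H r))].
Proof.
split.
- move=> [x r] [y s]; split=> [[z ->] //|/= <-].
  by exists (x^-1 * y)%g; rewrite /act /= mulVKg.
- by move=> r; exists (1%g, r).
- move=> F; split=> [[sF inv]|[H sH ->]].
    (* Every point [(x, r)] is the image of [(1, r)] under the action of [x], so invariance
       determines [F] by its values over the identity. *)
    exists (fun r => F (1%g, r)); first exact: smooth_section.
    apply/funext => -[x r]; have := inv (1%g, r) x.
    by rewrite /act /= mul1g.
  by split; [exact: smooth_pullback|].
move=> H K sH sK x xi mu nu r b.
pose p : trivTsTG G := (x, r).
have -> : b = br G by apply/funext => u; apply/funext => v; exact: lie_bracketE.
apply: etrans (reduced_bracket p sH sK) _.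
apply: etrans (congr1 -%R (etrans (dfun_pullback _ _ sK) (d_functional_derivatives _ _ sK))) _.
exact: pairing_hamiltonian_field.
Qed.
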